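(* Let $d\geq1$ be an integer and, for $u\in[0,\infty)$, let $$m(u)=\frac{2^{\frac d2}\,\Gamma\left(\frac{d+1}{2}\right)}{\sqrt{\pi}}\int_{2\pi u}^{\infty} r^{-\frac d2}J_{\frac d2}(r)\,\mathrm{d}r .$$ Let $t>0$. Then the inverse Fourier transform of the function $\xi\mapsto m(t|\xi|)$ on $\mathbb{R}^d$ is the function $$\varphi_t(x)= \begin{cases} \dfrac{\Gamma\left(\frac{1+d}{2}\right)^2\,t}{\pi^{1+\frac{d}{2}}\,|x|^{1+d}\,\Gamma\left(1+\frac{d}{2}\right)}\; {}_2F_1\left[\frac{1}{2}, \frac{1+d}{2}; \frac{2+d}{2}; \frac{t^2}{|x|^2}\right], & t<|x|,\\[3mm] \dfrac{\Gamma\left(\frac{1+d}{2}\right)^2\,t^{-d}}{\pi^{1+\frac{d}{2}}\,\Gamma\left(1+\frac{d}{2}\right)}\; {}_2F_1\left[\frac{1}{2}, \frac{1+d}{2}; \frac{2+d}{2}; \frac{|x|^2}{t^2}\right], & |x|<t . \end{cases}$$ Moreover, $\|\varphi_t\|_{L^1(\mathbb{R}^d)}=1$.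
   Context: $J_\alpha$ denotes the Bessel function of the first kind, $J_\alpha(r)=\sum_{k=0}^\infty \frac{(-1)^k}{\Gamma(k+\alpha+1)\,k!}\left(\frac r2\right)^{2k+\alpha}$ for $r>0$. The integral to $\infty$ defining $m$ is a (possibly improper) integral $\lim_{R\to\infty}\int_{2\pi u}^{R}$. The hypergeometric function is ${}_2F_1[a,b;c;z]=\sum_{n=0}^\infty \frac{(a)_n(b)_n}{(c)_n}\frac{z^n}{n!}$ for $|z|<1$, with $(q)_0=1$ and $(q)_n=q(q+1)\cdots(q+n-1)$ for $n\ge1$. Fourier convention: $\widehat f(\xi)=\int_{\mathbb{R}^d}f(x)e^{-2\pi i\langle x,\xi\rangle}\,\mathrm{d}x$, and the inverse Fourier transform is $f^\vee(x)=\widehat f(-x)$, both extended to $L^2(\mathbb{R}^d)$ by Plancherel's theorem. The function $\xi\mapsto m(t|\xi|)$ belongs to $L^2(\mathbb{R}^d)$, and its inverse Fourier transform is understood in this $L^2$ sense, so that the identity with $\varphi_t$ is an equality almost everywhere (the sphere $|x|=t$ is a null set, on which $\varphi_t$ need not be defined). *)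

(* Defs.v *)
From HB Require Import structures.
From mathcomp Require Import all_boot all_order all_algebra.
From mathcomp Require Import all_classical all_reals all_analysis.
From mathcomp Require Import complex.

Set Implicit Arguments.
Unset Strict Implicit.
Unset Printing Implicit Defensive.

Import Order.TTheory GRing.Theory Num.Theory.
Import numFieldNormedType.Exports.

Local Open Scope classical_set_scope.
Local Open Scope ring_scope.

(* R^d as d-tuples with the product Borel sigma-algebra; [measurableTypeR R] is
   R with the display for which [lebesgue_measure] is defined. *)
Notation Rn R d := (d.-tuple (measurableTypeR R)).

Section lebesgue_measure_Rn.
Context {R : realType}.

Definition consRn n (p : measurableTypeR R * Rn R n) : Rn R n.+1 :=
  [tuple of p.1 :: p.2].

Lemma measurable_consRn n : measurable_fun setT (@consRn n).
Proof. exact: measurable_cons. Qed.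

Lemma behead_consRn n (p : measurableTypeR R * Rn R n) :
  [tuple of behead (consRn p)] = p.2.
Proof. exact: val_inj. Qed.

Section step.
Variables (n : nat) (m : {sigma_finite_measure set (Rn R n) -> \bar R}).

Definition lebesgue_step : set (Rn R n.+1) -> \bar R :=
  pushforward (@lebesgue_measure R \x m)%E (@consRn n).

Let lebesgue_step0 : lebesgue_step set0 = 0%E.
Proof. by rewrite /lebesgue_step /pushforward preimage_set0 measure0. Qed.

Let lebesgue_step_ge0 A : (0 <= lebesgue_step A)%E.
Proof. by have mc := @measurable_consRn n; exact: measure_ge0. Qed.

Let lebesgue_step_sigma_additive : semi_sigma_additive lebesgue_step.
Proof.
by have mc := @measurable_consRn n; exact: measure_semi_sigma_additive.
Qed.

HB.instance Definition _ := isMeasure.Build _ _ _ lebesgue_step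
  lebesgue_step0 lebesgue_step_ge0 lebesgue_step_sigma_additive.

Lemma lebesgue_stepE (A : set (measurableTypeR R)) (B : set (Rn R n)) :
  measurable A -> measurable B ->
  lebesgue_step [set x | A (thead x) /\ B [tuple of behead x]] =
  (lebesgue_measure A * m B)%E.
Proof.
move=> mA mB; rewrite -product_measure1E// /lebesgue_step /pushforward.
congr product_measure1; apply/funext => p.
by rewrite /preimage /setX /mkset behead_consRn.
Qed.

Let lebesgue_step_sigma_finite : sigma_finite setT lebesgue_step.
Proof.
have /sigma_finiteP[F [TF ndF Foo]] := sigma_finiteT (@lebesgue_measure R).
have /sigma_finiteP[G [TG ndG Goo]] := sigma_finiteT m.
exists (fun i => [set x | F i (thead x) /\ G i [tuple of behead x]]).
  apply/seteqP; split=> // x _.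
  have [i _ Fi] : (\bigcup_i F i) (thead x) by rewrite -TF.
  have [j _ Gj] : (\bigcup_i G i) [tuple of behead x] by rewrite -TG.
  exists (maxn i j) => //; split.
    by move: Fi; exact/subsetPset/ndF/leq_maxl.
  by move: Gj; exact/subsetPset/ndG/leq_maxr.
move=> k; have [mF Fk] := Foo k; have [mG Gk] := Goo k; split.
  apply: measurableI; rewrite -[X in measurable X]setTI.
    exact: measurable_tnth.
  exact: measurable_behead.
by rewrite lebesgue_stepE// lte_mul_pinfty// ge0_fin_numE.
Qed.

HB.instance Definition _ := Measure_isSigmaFinite.Build _ _ _ lebesgue_step
  lebesgue_step_sigma_finite.

End step.

Fixpoint lebesgue_Rn n : {sigma_finite_measure set (Rn R n) -> \bar R} :=
  match n with
  | 0 => \d_([tuple] : Rn R 0)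
  | n'.+1 => lebesgue_step (lebesgue_Rn n')
  end.

Lemma lebesgue_Rn_box n (A : 'I_n -> set (measurableTypeR R)) :
  (forall i, measurable (A i)) ->
  lebesgue_Rn n [set x | forall i, A i (tnth x i)] =
  (\big[*%E/1%E]_(i < n) lebesgue_measure (A i))%E.
Proof.
elim: n A => [|n IH] A mA.
  rewrite big_ord0 /= diracE (_ : [set x | _] = setT) ?in_setT//.
  by apply/seteqP; split=> // x _ [].
rewrite big_ord_recl -(IH (fun i => A (lift ord0 i)))// -lebesgue_stepE//.
  rewrite /=; congr lebesgue_step; apply/seteqP; split=> x /= Ax.
    split=> [|i]; first exact: Ax.
    by have := Ax (lift ord0 i); rewrite [x in tnth x _]tuple_eta tnthS.
  by move=> i; case: (unliftP ord0 i) => [j|] ->; [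
    rewrite [x in tnth x _]tuple_eta tnthS; exact: Ax.2 | exact: Ax.1].
rewrite (_ : mkset _ =
  \bigcap_(i in [set: 'I_n]) ((fun x : Rn R n => tnth x i) @^-1` A (lift ord0 i))).
  apply: fin_bigcap_measurable => [|i _]; first exact: finite_finset.
  by rewrite -[X in measurable X]setTI; exact: measurable_tnth.
by apply/seteqP; split=> x /= Ax i; [move=> _|]; exact: Ax.
Qed.

End lebesgue_measure_Rn.
Arguments lebesgue_Rn R n : clear implicits.

Section fourier.
Context {R : realType} (d : nat).
Local Notation V := (Rn R d).
Local Notation mu := (lebesgue_Rn R d).
Implicit Types (f g : V -> R[i]) (x xi : V) (p : \bar R).

Definition dotV x xi : R := \sum_(i < d) (tnth x i : R) * (tnth xi i : R).

(* The Euclidean norm; tuples carry no norm in the library. *)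
Definition normV x : R := Num.sqrt (dotV x x).

Definition oppV x : V := [tuple - (tnth x i : R) | i < d].

Definition expi (theta : R) : R[i] := (cos theta +i* sin theta)%C.

(* Lebesgue integral of a complex-valued function (meaningful when f is in
   L^1): the real and imaginary parts are integrated separately. *)
Definition cintegral f : R[i] :=
  ((\int[mu]_x complex.Re (f x))%R +i* (\int[mu]_x complex.Im (f x))%R)%C.

Definition cLnorm p f : \bar R :=
  Lnorm mu p (fun x => (ComplexField.Normc.normc (f x))%:E).

Definition cLp p f : Prop :=
  [/\ measurable_fun [set: V] (fun x => complex.Re (f x) : R),
      measurable_fun [set: V] (fun x => complex.Im (f x) : R) &
      (cLnorm p f < +oo)%E].

Definition fourier f (xi : V) : R[i] :=
  cintegral (fun x => f x * expi (- (2 * pi * dotV x xi))).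

(* g is (a representative of) the Fourier transform of f in the sense of
   L^2(R^d): the operator [fourier], defined on the dense subspace
   L^1 \cap L^2, is extended by continuity of the L^2 norm.  By Plancherel's
   theorem g exists for every f in L^2, is unique up to equality almost
   everywhere, and does not depend on the approximating sequence h. *)
Definition is_fourierL2 f g : Prop :=
  [/\ cLp 2%:E f, cLp 2%:E g &
    exists h : nat -> V -> R[i],
      [/\ forall n, cLp 1%:E (h n) /\ cLp 2%:E (h n),
          cLnorm 2%:E (fun x => h n x - f x) @[n --> \oo] --> 0%E &
          cLnorm 2%:E (fun xi => fourier (h n) xi - g xi) @[n --> \oo] --> 0%E]].

(* g(x) = \hat f(-x), i.e. \hat f(xi) = g(-xi), almost everywhere. *)
Definition is_inv_fourierL2 f g : Prop := is_fourierL2 f (fun xi => g (oppV xi)).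

End fourier.

Section special_functions.
Context {R : realType}.
Local Notation lambda := (@lebesgue_measure R).
Implicit Types a b c q r s u z : R.

(* Euler's integral, convergent for s > 0. *)
Definition Gamma s : R :=
  (\int[lambda]_(r in `]0%R, +oo[) (r `^ (s - 1) * expR (- r)))%R.

(* Only used for r > 0, where [powR] is the usual real power. *)
Definition besselJ a r : R :=
  limn (series (fun k : nat =>
    (-1) ^+ k / (Gamma (k%:R + a + 1) * k`!%:R) * (r / 2) `^ (2 * k%:R + a))).

Definition pochhammer q (n : nat) : R := \prod_(i < n) (q + i%:R).

Definition hyp2F1 a b c z : R :=
  limn (series (fun n : nat =>
    pochhammer a n * pochhammer b n / pochhammer c n * (z ^+ n / n`!%:R))).

(* Conditionally convergent improper integral.  For u = 0 the integrand takes
   the convention-dependent value 0 `^ _ at the single point r = 0 only. *)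
Definition m_mult (d : nat) u : R :=
  2 `^ (d%:R / 2) * Gamma ((d%:R + 1) / 2) / Num.sqrt pi *
  lim ((\int[lambda]_(r in `[(2 * pi * u)%R, b])
          (r `^ (- (d%:R / 2)) * besselJ (d%:R / 2) r))%R @[b --> +oo%R]).

(* The value 0 on the sphere |x| = t is immaterial. *)
Definition phi (d : nat) (t : R) (x : Rn R d) : R :=
  let C := Gamma ((1 + d%:R) / 2) ^+ 2 in
  let D := Gamma (1 + d%:R / 2) in
  if t < normV x then
    C * t / (pi `^ (1 + d%:R / 2) * normV x ^+ (1 + d) * D) *
      hyp2F1 (1 / 2) ((1 + d%:R) / 2) ((2 + d%:R) / 2) (t ^+ 2 / normV x ^+ 2)
  else if normV x < t then
    C * t ^- d / (pi `^ (1 + d%:R / 2) * D) *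
      hyp2F1 (1 / 2) ((1 + d%:R) / 2) ((2 + d%:R) / 2) (normV x ^+ 2 / t ^+ 2)
  else 0.

End special_functions.

(* Main.v *)
Require Import Defs.
From HB Require Import structures.
From mathcomp Require Import all_boot all_order all_algebra.
From mathcomp Require Import all_classical all_reals all_analysis.
From mathcomp Require Import measurable_realfun complex ring lra.

(** Off the sphere |x| = t, the binomial series (after scaling when |x| > t) gives
    phi_t(x) = c \int_0^{pi/2} sin^d a (1 - |x|^2 sin^2 a / t^2)_+^{-1/2} da,
    so phi_t is an average over a of the probability densities proportional to
    (r^2 - |x|^2)_+^{-1/2}, with r = t / sin a; in particular its integral is 1.
    By rotation invariance its Fourier transform at xi is the average of
    Q(2 pi t |xi| sin b) against cos^{d-1} b db, where Q(s) is the mean of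
    cos(s / sin a) over 0 < a < pi/2.  Injectivity of the Laplace transform yields
    Q(s) = 1 - (2 / pi) \int_0^{pi/2} sin(s sin a) / sin a da.  Integrating the
    power series of the right-hand side against cos^{d-1} b db produces 1 minus the
    integral over [0, s] of a multiple of the Bessel integrand of m, and since
    Q tends to 0 at infinity this is the tail integral m.

    The function phi_t is square integrable and continuous off the sphere.  Multiplying
    its Fourier transform by a Gaussian gives an integrable function whose Fourier
    transform is a Gaussian mollification of phi_t, and both approximations converge
    in L^2 by Jensen's inequality and Fatou's lemma. *)

Set Implicit Arguments.
Unset Strict Implicit.
Unset Printing Implicit Defensive.

Import Order.TTheory GRing.Theory Num.Theory.
Import numFieldNormedType.Exports.

Local Open Scope classical_set_scope.
Local Open Scope ring_scope.

(** * Integration on R^n and rotations *)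

(** Two forms of Q are played against each other. Expanding cos (s / sin a) in powers of s is
    hopeless, since the negative moments of sin diverge, but this form shows by oscillation that Q
    vanishes at infinity. The form with sin (s sin a) / sin a has a power series with explicit
    moments but no visible decay. They agree because the Laplace transforms in s of the means of cos
    (s / sin a) and of sin (s sin a) / sin a contain opposite multiples of 1 / (l sqrt (1 + l^2)),
    so that their sum has the transform of a constant. All constants reduce to the Wallis integrals
    [wc], as Gamma is only evaluated at multiples of 1/2. Where Tonelli exchanges integrals, the
    oscillating factor cos is replaced by 1 + cos and the mass is subtracted afterwards. The density
    phi_t has a logarithmic singularity at the sphere, so it is unbounded and its transform is not
    integrable: the inversion integral does not converge absolutely, whence the Gaussian factors and
    the work in L^2. *)

Section lebesgue_change_of_variable.
Context {R : realType}.
Local Notation mu := (@lebesgue_measure R).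
Local Notation mR := (measurableTypeR R).

Lemma measurable_affine (a b : R) :
  measurable_fun [set: mR] ((fun x => a * x + b) : mR -> mR).
Proof.
have h : measurable_fun [set: R] (fun x : R => a * x + b).
  by apply: measurable_funD => //; exact: measurable_funM.
exact: h.
Qed.

(** Uniqueness of Lebesgue measure reduces the claim to half-open intervals. For [a < 0] the
    preimage is half-open on the other side, which leaves its length unchanged. *)
Lemma lebesgue_measure_affine (a b : R) (A : set R) : a != 0 -> measurable A ->
  mu A = (`|a|%:E * mu ((fun x => a * x + b)%R @^-1` A))%E.
Proof.
move=> a0 mA; pose g : mR -> mR := fun x => a * x + b.
have mg : measurable_fun [set: mR] g := measurable_affine a b.
pose na : {nonneg R} := NngNum (normr_ge0 a).
have -> := @lebesgue_measure_unique R (mscale na (pushforward mu g)) _ A mA; first by [].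
move=> _ [[u v] /= uv <-].
rewrite /mscale/= /pushforward.
have [a_lt0|a_gt0|aE] := ltgtP a 0; last by rewrite aE eqxx in a0.
  2: {
  rewrite (_ : g @^-1` _ = `](u - b) / a, (v - b) / a]%classic); last first.
    apply/seteqP; split=> x /=; rewrite !in_itv/= /g ltr_pdivrMr// ler_pdivlMr//;
      by rewrite ltrBlDr lerBrDr mulrC.
  rewrite !lebesgue_measure_itv/= !lte_fin ltr_pM2r ?invr_gt0// ltrD2r.
  case: ifPn => // _; last by rewrite mule0.
  by rewrite -!EFinB -EFinM gtr0_norm//; congr (_%:E); field. }
rewrite (_ : g @^-1` _ = `[(v - b) / a, (u - b) / a[%classic); last first.
  apply/seteqP; split=> x /=; rewrite !in_itv/= /g ltr_ndivlMr// ler_ndivrMr//;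
    by rewrite ltrBlDr lerBrDr mulrC andbC.
rewrite !lebesgue_measure_itv/= !lte_fin ltr_nM2r ?invr_lt0// ltrD2r.
case: ifPn => // _; last by rewrite mule0.
by rewrite -!EFinB -EFinM ltr0_norm//; congr (_%:E); field.
Qed.

Lemma ge0_integral_affine (a b : R) (f : R -> \bar R) : a != 0 ->
  measurable_fun [set: R] f -> (forall x, 0 <= f x)%E ->
  (\int[mu]_x f (a * x + b)%R = (`|a|^-1)%:E * \int[mu]_x f x)%E.
Proof.
move=> a0 mf f0; pose g : mR -> mR := fun x => a * x + b.
have mg : measurable_fun [set: mR] g := measurable_affine a b.
pose na : {nonneg R} := NngNum (normr_ge0 a).
transitivity (\int[pushforward mu g]_x f x)%E.
  by rewrite ge0_integral_pushforward.
rewrite [in RHS](_ : \int[mu]_x f x = \int[mscale na (pushforward mu g)]_x f x)%E.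
  by rewrite ge0_integral_mscale//= muleA -EFinM mulVf ?normr_eq0// mul1e.
apply: eq_measure_integral => A mA _.
by rewrite [LHS](lebesgue_measure_affine b a0 mA).
Qed.

End lebesgue_change_of_variable.

Section tonelli_real.
Context {R : realType}.
Local Notation mu := (@lebesgue_measure R).
Local Notation mR := (measurableTypeR R).
Variable F : R * R -> \bar R.
Hypothesis mF : measurable_fun [set: R * R] F.
Hypothesis F0 : forall p, (0 <= F p)%E.

Lemma tonelli_real : (\int[mu]_x \int[mu]_y F (x, y) = \int[mu]_y \int[mu]_x F (x, y))%E.
Proof. exact: (fubini_tonelli (m1 := mu) (m2 := mu) F mF F0). Qed.

Lemma measurable_tonelli_realF : measurable_fun [set: R] (fun x => \int[mu]_y F (x, y))%E.
Proof. exact: (measurable_fun_fubini_tonelli_F (m2 := mu) F mF F0). Qed.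

Lemma measurable_tonelli_realG : measurable_fun [set: R] (fun y => \int[mu]_x F (x, y))%E.
Proof. exact: (measurable_fun_fubini_tonelli_G (m1 := mu) F mF F0). Qed.

End tonelli_real.

Section tonelli_Rn.
Context {R : realType}.
Local Notation mu := (@lebesgue_measure R).
Local Notation mR := (measurableTypeR R).

(** [lebesgue_Rn R n.+1] is by construction the image of a product measure under [consRn], so
    Tonelli splits off the first coordinate. The inductions on the dimension below rest on this
    formula. *)
Lemma integral_consRn n (F : Rn R n.+1 -> \bar R) :
  measurable_fun [set: Rn R n.+1] F -> (forall x, 0 <= F x)%E ->
  (\int[lebesgue_Rn R n.+1]_x F x =
   \int[mu]_x \int[lebesgue_Rn R n]_y F (consRn (x, y)))%E.
Proof.
move=> mF F0; rewrite /= /lebesgue_step.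
have mc := @measurable_consRn R n.
rewrite (@ge0_integral_pushforward _ _ _ _ _ _ mc)// preimage_setT.
have mFc : measurable_fun [set: mR * Rn R n] (F \o @consRn R n).
  exact: (measurableT_comp mF mc).
by apply: (fubini_tonelli1 (F \o @consRn R n)) => // x; exact: F0.
Qed.

Lemma integral_Rn0 (F : Rn R 0 -> \bar R) :
  measurable_fun [set: Rn R 0] F ->
  (\int[lebesgue_Rn R 0]_x F x = F [tuple])%E.
Proof.
by move=> mF; rewrite /= integral_dirac// diracT mul1e.
Qed.

Lemma measurable_integral_consRn n (F : mR * Rn R n -> \bar R) :
  measurable_fun [set: mR * Rn R n] F -> (forall x, 0 <= F x)%E ->
  measurable_fun [set: mR] (fun x => \int[lebesgue_Rn R n]_y F (x, y))%E.
Proof. by move=> mF F0; exact: measurable_fun_fubini_tonelli_F. Qed.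

Lemma dotV_cons n (a b : R) (x y : Rn R n) :
  dotV (consRn (a, x)) (consRn (b, y)) = a * b + dotV x y.
Proof.
rewrite /dotV big_ord_recl; congr (_ + _).
by apply: eq_bigr => i _; rewrite !tnthS.
Qed.

Lemma dotV0 (x y : Rn R 0) : dotV x y = 0.
Proof. by rewrite /dotV big_ord0. Qed.

Lemma dotV_ge0 n (x : Rn R n) : 0 <= dotV x x.
Proof. by apply: sumr_ge0 => i _; rewrite -expr2 sqr_ge0. Qed.

Lemma normV_ge0 n (x : Rn R n) : 0 <= normV x.
Proof. exact: sqrtr_ge0. Qed.

Lemma normV_sqr n (x : Rn R n) : normV x ^+ 2 = dotV x x.
Proof. by rewrite sqr_sqrtr// dotV_ge0. Qed.

Lemma measurable_tnthRn n (i : 'I_n) :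
  measurable_fun [set: Rn R n] (fun x => tnth x i : R).
Proof. exact: measurable_tnth. Qed.

Lemma measurable_dotV n : measurable_fun [set: Rn R n * Rn R n]
  (fun p => dotV p.1 p.2).
Proof.
apply: measurable_sum => i; apply: measurable_funM.
  exact: (measurableT_comp (@measurable_tnthRn n i)).
exact: (measurableT_comp (@measurable_tnthRn n i)).
Qed.

Lemma measurable_dotVl n (y : Rn R n) :
  measurable_fun [set: Rn R n] (fun x => dotV x y).
Proof.
have h : measurable_fun [set: Rn R n] (fun x : Rn R n => (x, y)) by apply: measurable_fun_pair.
exact: (measurableT_comp (@measurable_dotV n) h).
Qed.

Lemma measurable_dotVV n : measurable_fun [set: Rn R n] (fun x => dotV x x).
Proof.
have h : measurable_fun [set: Rn R n] (fun x : Rn R n => (x, x)) by apply: measurable_fun_pair.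
exact: (measurableT_comp (@measurable_dotV n) h).
Qed.

Lemma measurable_normV n : measurable_fun [set: Rn R n] (@normV R n).
Proof. apply: (@measurableT_comp _ _ _ _ _ _ (@Num.sqrt R)); last exact: measurable_dotVV.
by apply: continuous_measurable_fun; exact: sqrt_continuous. Qed.

(** A rotation with [a != 0] factors into two one-dimensional affine substitutions: at fixed [y] the
    new variable is [a x - b y], with factor [|a|^-1]; then, at fixed first variable, the new
    variable is [(b x + y) / a], with factor [|a|]. The factors cancel. If [a = 0], the rotation
    exchanges the coordinates up to signs. *)
Lemma rotation_integral2 (a b : R) (H : R * R -> \bar R) :
  measurable_fun [set: R * R] H -> (forall x, 0 <= H x)%E -> a ^+ 2 + b ^+ 2 = 1 ->
  (\int[mu]_x \int[mu]_y H (a * x - b * y, b * x + a * y)%R =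
   \int[mu]_x \int[mu]_y H (x, y))%E.
Proof.
move=> mH H0 ab1.
have msub (g h : R * R -> R) : measurable_fun setT g -> measurable_fun setT h ->
    measurable_fun [set: R * R] (fun p => H (g p, h p)).
  by move=> mg mh; apply: (measurableT_comp mH); exact: measurable_fun_pair.
have mlin (c d : R) : measurable_fun [set: R * R] (fun p : R * R => c * p.1 + d * p.2).
  by apply: measurable_funD; apply: measurable_funM.
have mlin' (c d : R) : measurable_fun [set: R * R] (fun p : R * R => c * p.1 - d * p.2).
  by under eq_fun do rewrite -mulNr; exact: mlin.
have mH1 y : measurable_fun [set: R] (fun x => H (x, y)) by exact: measurableT_comp.
have mH2 x : measurable_fun [set: R] (fun y => H (x, y)) by exact: measurableT_comp.
have [a0|a0] := eqVneq a 0.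
  move: ab1; rewrite a0 expr0n add0r => /eqP; rewrite sqrf_eq1 => b1.
  have bn1 : `|b| = 1 by case/orP: b1 => /eqP->; rewrite ?normrN normr1.
  have b0 : b != 0 by rewrite -normr_eq0 bn1 oner_neq0.
  rewrite [RHS](tonelli_real mH H0).
  have := @ge0_integral_affine R b 0 _ b0 (measurable_tonelli_realG mH H0).
  rewrite bn1 invr1 mul1e => <-; last by move=> y; exact: integral_ge0.
  apply: eq_integral => x _.
  have Nb0 : - b != 0 by rewrite oppr_eq0.
  have := @ge0_integral_affine R (- b) 0 _ Nb0 (mH1 (b * x + 0)).
  rewrite normrN bn1 invr1 mul1e => <-; last by [].
  by apply: eq_integral => y _; rewrite !mul0r sub0r !addr0 mulNr.
rewrite (tonelli_real (F := fun p => H (a * p.1 - b * p.2, b * p.1 + a * p.2)%R)) /=; last 2 first.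
- exact: msub.
- by [].
pose G (p : R * R) := H (p.1, (b * p.1 + p.2) / a).
have G0 p : (0 <= G p)%E by exact: H0.
have mG : measurable_fun [set: R * R] G.
  apply: msub => //; apply: measurable_funM => //.
  by apply: measurable_funD => //; exact: measurable_funM.
(* After the first substitution the second coordinate has to be a function of the new variable
   [a u - b v] and of [v]; this is where [a^2 + b^2 = 1] enters. *)
have rotE (u v : R) : b * u + a * v = (b * (a * u - b * v) + v) / a.
  apply: (mulIf a0); rewrite mulfVK//; apply/eqP; rewrite -subr_eq0; apply/eqP.
  by transitivity ((a ^+ 2 + b ^+ 2 - 1) * v); [ring|rewrite ab1 subrr mul0r].
have G1 y : (\int[mu]_x H ((a * x - b * y)%R, (b * x + a * y)%R) =
             (`|a|^-1)%:E * \int[mu]_x G (x, y))%E.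
  have mf : measurable_fun [set: R] (fun x => G (x, y)) by exact: measurableT_comp.
  rewrite -(@ge0_integral_affine R a (- (b * y)) _ a0 mf)//=.
  by apply: eq_integral => x _; congr H; congr pair; exact: rotE.
have G2 x : (\int[mu]_y G (x, y) = `|a|%:E * \int[mu]_y H (x, y))%E.
  have Va0 : a^-1 != 0 by rewrite invr_eq0.
  have := @ge0_integral_affine R a^-1 (b * x / a) _ Va0 (mH2 x) (fun=> H0 _).
  rewrite normfV invrK => <-.
  by apply: eq_integral => y _; rewrite /G /=; congr H; congr pair; field.
under eq_integral do rewrite G1.
rewrite ge0_integralZl//; last 2 first.
  exact: (measurable_tonelli_realG mG G0).
  by move=> y _; exact: integral_ge0.
rewrite -(tonelli_real mG G0).
under eq_integral do rewrite G2.
rewrite ge0_integralZl//; last 2 first.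
  exact: (measurable_tonelli_realF mH H0).
  by move=> y _; exact: integral_ge0.
by rewrite muleA -EFinM mulVf ?normr_eq0// mul1e.
Qed.

End tonelli_Rn.

Section rotation_Rn.
Context {R : realType}.
Local Notation mu := (@lebesgue_measure R).
Local Notation mR := (measurableTypeR R).

(** The rotation used is the one that carries [(a, b)] to the first axis; when [a = b = 0] there is
    nothing to rotate. *)
Lemma rotation_invariant2 (a b : R) (H : R * R -> \bar R) :
  measurable_fun [set: R * R] H -> (forall x, 0 <= H x)%E ->
  (\int[mu]_x \int[mu]_y H (x ^+ 2 + y ^+ 2, a * x + b * y)%R =
   \int[mu]_x \int[mu]_y H (x ^+ 2 + y ^+ 2, Num.sqrt (a ^+ 2 + b ^+ 2) * x)%R)%E.
Proof.
move=> mH H0; set c := Num.sqrt _.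
have ab0 : 0 <= a ^+ 2 + b ^+ 2 by rewrite addr_ge0// sqr_ge0.
have c2 : c ^+ 2 = a ^+ 2 + b ^+ 2 by rewrite sqr_sqrtr.
have [c0|c0] := eqVneq c 0.
  have s0 : a ^+ 2 + b ^+ 2 = 0 by rewrite -c2 c0 expr0n.
  have a0 : a = 0.
    by apply/eqP; rewrite -sqrf_eq0 eq_le sqr_ge0 andbT -s0 lerDl sqr_ge0.
  have b0 : b = 0.
    by apply/eqP; rewrite -sqrf_eq0 eq_le sqr_ge0 andbT -s0 lerDr sqr_ge0.
  by rewrite c0 a0 b0; under eq_integral do under eq_integral do rewrite !mul0r addr0;
    under [RHS]eq_integral do under eq_integral do rewrite !mul0r.
pose G (p : R * R) := H (p.1 ^+ 2 + p.2 ^+ 2, c * p.1).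
have mG : measurable_fun [set: R * R] G.
  apply: (measurableT_comp mH); apply: measurable_fun_pair.
    by apply: measurable_funD; exact: measurable_funX.
  exact: measurable_funM.
have G0 p : (0 <= G p)%E by exact: H0.
have ab1 : (a / c) ^+ 2 + (- b / c) ^+ 2 = 1.
  by rewrite !expr_div_n sqrrN -mulrDl -c2 divff// sqrf_eq0.
rewrite -[RHS](rotation_integral2 mG G0 ab1).
have E1 (x y : R) : (a / c * x - - b / c * y) ^+ 2 + (- b / c * x + a / c * y) ^+ 2
    = x ^+ 2 + y ^+ 2.
  transitivity (((a / c) ^+ 2 + (- b / c) ^+ 2) * (x ^+ 2 + y ^+ 2)); first by ring.
  by rewrite ab1 mul1r.
have E2 (x y : R) : c * (a / c * x - - b / c * y) = a * x + b * y by field.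
by apply: eq_integral => x _; apply: eq_integral => y _; rewrite /G /= E1 E2.
Qed.

Definition fstRn n (x : Rn R n) : R := nth 0 x 0.

Lemma fstRn_cons n (a : R) (x : Rn R n) : fstRn (consRn (a, x)) = a.
Proof. by []. Qed.

Lemma measurable_fstRn n : measurable_fun [set: Rn R n.+1] (@fstRn n.+1).
Proof.
rewrite (_ : @fstRn n.+1 = fun x => tnth x ord0); first exact: measurable_tnthRn.
by apply/funext => x; rewrite /fstRn (tnth_nth 0).
Qed.

Lemma consRn_split n (x : Rn R n.+1) : x = consRn (thead x, [tuple of behead x]).
Proof. by rewrite /consRn; case/tupleP: x => a x; apply: val_inj; rewrite /= theadE. Qed.

Lemma normV_cons n (a : R) (v : Rn R n) :
  normV (consRn (a, v)) = Num.sqrt (a ^+ 2 + normV v ^+ 2).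
Proof. by rewrite {1}/normV dotV_cons normV_sqr -expr2. Qed.

Lemma measurable_dotV_fst n (K : R * R -> \bar R) (c d e : R) :
  measurable_fun setT K -> measurable_fun [set: Rn R n.+1]
    (fun x => K (d + dotV x x, e + c * fstRn x)%R).
Proof.
move=> mK; apply: (measurableT_comp mK); apply: measurable_fun_pair.
  by apply: measurable_funD => //; exact: measurable_dotVV.
by apply: measurable_funD => //; apply: measurable_funM => //; exact: measurable_fstRn.
Qed.

Lemma measurable_dotV_dotV n (K : R * R -> \bar R) (v : Rn R n) :
  measurable_fun setT K -> measurable_fun [set: Rn R n]
    (fun x => K (dotV x x, dotV x v)%R).
Proof.
move=> mK; apply: (measurableT_comp mK); apply: measurable_fun_pair.
  exact: measurable_dotVV.
exact: measurable_dotVl.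
Qed.

(** Induction on the dimension, with [H] general. The induction hypothesis turns the tail of [w]
    onto its own first axis; what remains is a rotation in the plane of the first two coordinates,
    the other coordinates entering only through the squared norm. *)
Lemma rotation_invariant n (w : Rn R n.+1) (H : R * R -> \bar R) :
  measurable_fun [set: R * R] H -> (forall x, 0 <= H x)%E ->
  (\int[lebesgue_Rn R n.+1]_x H (dotV x x, dotV x w) =
   \int[lebesgue_Rn R n.+1]_x H (dotV x x, normV w * fstRn x)%R)%E.
Proof.
have m1 m (K : R * R -> \bar R) (c : R) : measurable_fun setT K ->
    measurable_fun [set: Rn R m.+1] (fun x => K (dotV x x, c * fstRn x)%R).
  by move=> mK; have := measurable_dotV_fst (n := m) c 0 0 mK; under eq_fun do rewrite !add0r.
elim: n w H => [|n IH] w H mH H0.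
  rewrite integral_consRn; [|exact: measurable_dotV_dotV|by move=> ?; exact: H0].
  rewrite integral_consRn; [|exact: m1|by move=> ?; exact: H0].
  rewrite (consRn_split w); set a := thead w; set v := [tuple of _].
  have mK (c : R) : measurable_fun [set: R] (fun x : R => H (x ^+ 2, c * x)).
    apply: (measurableT_comp mH); apply: measurable_fun_pair.
      exact: measurable_funX.
    exact: measurable_funM.
  transitivity (\int[mu]_x H (x ^+ 2, a * x)%R)%E.
    apply: eq_integral => x _; rewrite integral_Rn0.
      by rewrite !dotV_cons !dotV0 !addr0 -expr2 [(a * _)%R]mulrC.
    have := measurable_dotV_dotV (consRn (a, v)) mH.
    by move=> h; exact: (measurableT_comp h (measurableT_comp (@measurable_consRn R 0) (measurable_pair1 x))).
  transitivity (\int[mu]_x H (x ^+ 2, `|a| * x)%R)%E; last first.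
    apply: eq_integral => x _; rewrite integral_Rn0.
      rewrite !dotV_cons !dotV0 !addr0 -expr2; congr H; congr pair.
      by rewrite normV_cons normV_sqr dotV0 addr0 sqrtr_sqr.
    have := m1 0%N H (normV (consRn (a, v))) mH.
    by move=> h; exact: (measurableT_comp h (measurableT_comp (@measurable_consRn R 0) (measurable_pair1 x))).
  (* In dimension one [normV w] is the absolute value of the coordinate, and a negative sign is
     removed by the reflection [x -> - x]. *)
  have [a0|a0] := leP 0 (a : R); first by rewrite ger0_norm.
  rewrite ltr0_norm//.
  have N1 : (-1 : R) != 0 by rewrite oppr_eq0 oner_eq0.
  have := @ge0_integral_affine R (-1) 0 _ N1 (mK a) (fun=> H0 _).
  rewrite normrN normr1 invr1 mul1e => <-.
  by apply: eq_integral => x _; rewrite addr0 mulN1r sqrrN mulrN mulNr.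
rewrite integral_consRn; [|exact: measurable_dotV_dotV|by move=> ?; exact: H0].
rewrite integral_consRn; [|exact: m1|by move=> ?; exact: H0].
rewrite (consRn_split w); set a := thead w; set v := [tuple of _].
(* The remaining [n] coordinates are integrated out, which leaves a function of the squared radius
   and of one linear form in the plane, as [rotation_invariant2] accepts. *)
pose K (p : R * R) := (\int[lebesgue_Rn R n]_y H (p.1 + dotV y y, p.2)%R)%E.
have mF : measurable_fun [set: R * R * Rn R n] (fun q => H (q.1.1 + dotV q.2 q.2, q.1.2)%R).
  apply: (measurableT_comp mH); apply: measurable_fun_pair; last first.
    exact: (measurableT_comp measurable_snd).
  apply: measurable_funD; first exact: (measurableT_comp measurable_fst).
  exact: (measurableT_comp (@measurable_dotVV R n)).
have mK : measurable_fun [set: R * R] K.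
  by apply: (measurable_fun_fubini_tonelli_F (m2 := lebesgue_Rn R n) _ mF) => q; exact: H0.
have K0 p : (0 <= K p)%E by apply: integral_ge0 => y _; exact: H0.
have HK (c d : R) : (\int[mu]_x \int[lebesgue_Rn R n.+1]_y
    H (x ^+ 2 + dotV y y, c * x + d * fstRn y)%R =
    \int[mu]_x \int[mu]_y K (x ^+ 2 + y ^+ 2, c * x + d * y)%R)%E.
  apply: eq_integral => x _.
  rewrite integral_consRn; [|exact: measurable_dotV_fst|by move=> ?; exact: H0].
  by apply: eq_integral => y _; apply: eq_integral => z _; rewrite dotV_cons -expr2 addrA.
transitivity (\int[mu]_x \int[lebesgue_Rn R n.+1]_y
    H (x ^+ 2 + dotV y y, a * x + normV v * fstRn y)%R)%E.
  apply: eq_integral => x _; have mHx : measurable_fun [set: R * R]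
      (fun p => H (x ^+ 2 + p.1, a * x + p.2)%R).
    by apply: (measurableT_comp mH); apply: measurable_fun_pair; apply: measurable_funD.
  have := IH v _ mHx (fun=> H0 _) => /= <-.
  by apply: eq_integral => y _; rewrite !dotV_cons -expr2 [(a * _)%R]mulrC.
rewrite HK rotation_invariant2//.
transitivity (\int[mu]_x \int[lebesgue_Rn R n.+1]_y
    H (x ^+ 2 + dotV y y, Num.sqrt (a ^+ 2 + normV v ^+ 2) * x + 0 * fstRn y)%R)%E.
  by rewrite HK; apply: eq_integral => x _; apply: eq_integral => y _; rewrite mul0r addr0.
apply: eq_integral => x _; apply: eq_integral => y _.
by rewrite dotV_cons -expr2 normV_cons mul0r addr0.
Qed.

End rotation_Rn.

(** * Substitution in one-dimensional integrals *)

Section density.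
Context d (T : measurableType d) {R : realType} (mu : {measure set T -> \bar R}).
Variable f : T -> R.
Hypothesis mf : measurable_fun [set: T] f.
Hypothesis f0 : forall x, 0 <= f x.
Local Open Scope ereal_scope.

(* The two proofs are arguments so that the measure instance can be inferred. *)
Definition density_measure (_ : measurable_fun [set: T] f)
  (_ : forall x, (0 <= f x)%R) (A : set T) : \bar R := \int[mu]_(x in A) (f x)%:E.
Local Notation nu := (density_measure mf f0).

Let nu0 : nu set0 = 0. Proof. by rewrite /nu integral_set0. Qed.
Let nu_ge0 A : 0 <= nu A.
Proof. by apply: integral_ge0 => x _; rewrite lee_fin. Qed.
Let nu_sigma : semi_sigma_additive nu.
Proof.
apply: semi_sigma_additive_nng_induced; last by move=> x; rewrite lee_fin.
exact: measurableT_comp.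
Qed.

HB.instance Definition _ := isMeasure.Build _ _ _ nu nu0 nu_ge0 nu_sigma.

Import HBNNSimple.

(** Simple functions approximate [K] from below and monotone convergence applies on both sides; on
    the indicator of a level set the identity is the definition of the measure with density [f]. *)
Lemma ge0_integral_density (K : T -> \bar R) :
  measurable_fun [set: T] K -> (forall x, 0 <= K x) ->
  \int[nu]_x K x = \int[mu]_x (K x * (f x)%:E).
Proof.
move=> mK K0; pose K_ := nnsfun_approx measurableT mK.
have mfE : measurable_fun [set: T] (EFin \o f) by exact: measurableT_comp.
have KE x : (K_ n x)%:E @[n --> \oo] --> K x.
  by apply: cvg_nnsfun_approx => // *; exact: K0.
transitivity (limn (fun n => \int[nu]_x (K_ n x)%:E)).
  rewrite -monotone_convergence//.
  - by apply: eq_integral => y _; apply/esym/cvg_lim.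
  - by move=> n; exact/measurable_EFinP/measurable_funP.
  - by move=> n y _; rewrite lee_fin.
  - by move=> y _ m n mn; rewrite lee_fin; exact/lefP/nd_nnsfun_approx.
rewrite [X in limn X](_ : _ = (fun n => \int[mu]_x ((K_ n x)%:E * (f x)%:E))).
  rewrite -monotone_convergence//; last 3 first.
  - move=> n; apply: emeasurable_funM => //; exact/measurable_EFinP/measurable_funP.
  - by move=> n x _; rewrite mule_ge0 ?lee_fin.
  - move=> x _ m n mn; rewrite lee_wpmul2r ?lee_fin//.
    exact/lefP/nd_nnsfun_approx.
  apply: eq_integral => x _; apply/cvg_lim => //.
  by apply: cvgeZr => //; exact: KE.
apply/funext => n.
have mpre r : measurable (K_ n @^-1` [set r]) by rewrite -[X in measurable X]setTI; exact: measurable_funP.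
transitivity (\sum_(k \in range (K_ n)) \int[nu]_x (k * \1_(K_ n @^-1` [set k]) x)%:E).
  under eq_integral do rewrite fimfunE -fsumEFin//.
  rewrite ge0_integral_fsum//.
  - by move=> r; exact/measurable_EFinP/measurable_funM.
  - by move=> y x _; rewrite nnfun_muleindic_ge0.
transitivity (\sum_(k \in range (K_ n)) \int[mu]_x ((k * \1_(K_ n @^-1` [set k]) x)%:E * (f x)%:E)).
  apply: eq_fsbigr => r rK.
  have r0 : (0 <= r)%R by move: rK; rewrite inE => -[x _ <-].
  rewrite integralZl_indic_nnsfun// integral_indic//= setIT.
  under [RHS]eq_integral do rewrite EFinM -muleA.
  rewrite ge0_integralZl//; last 2 first.
    by apply: emeasurable_funM => //; exact/measurable_EFinP.
    by move=> x _; rewrite mule_ge0 ?lee_fin.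
  congr (_ * _); rewrite /density_measure [LHS]integral_mkcond.
  apply: eq_integral => x _; rewrite patchE indicE; case: (_ \in _) => /=; rewrite ?mul1e ?mul0e//.
rewrite -ge0_integral_fsum//.
- apply: eq_integral => x _; rewrite [in RHS]fimfunE -fsumEFin// ge0_mule_fsuml//.
  by move=> r; rewrite nnfun_muleindic_ge0.
- move=> r; apply: emeasurable_funM => //; exact/measurable_EFinP/measurable_funM.
- by move=> y x _; rewrite mule_ge0 ?lee_fin// -lee_fin nnfun_muleindic_ge0.
Qed.

End density.

Section measure_unique_real.
Context {R : realType}.
Local Notation mu := (@lebesgue_measure R).
Local Notation mR := (measurableTypeR R).
Local Open Scope ereal_scope.

(** Open left rays are stable under intersection and generate the Borel sets; those that end at
    natural numbers have finite measure and cover the line. *)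
Lemma measure_unique_ray (m1 m2 : {measure set mR -> \bar R}) :
  (forall x : R, m1 `]-oo, x[%classic = m2 `]-oo, x[%classic) ->
  (forall x : R, m1 `]-oo, x[%classic < +oo) ->
  forall A, measurable A -> m1 A = m2 A.
Proof.
move=> m12 moo; move=> A mA.
refine (@measure_unique _ R mR (@RGenInftyO.G R) (fun n => `]-oo, (n%:R : R)[%classic) _ _ _ _ m1 m2 _ _ A mA).
- exact: RGenInftyO.measurableE.
- move=> _ _ [x ->] [y ->]; exists (Num.min x y).
  by apply/seteqP; split=> z /=; rewrite !in_itv/= lt_min => /andP.
- by move=> n; exists n%:R.
- apply/seteqP; split=> // x _.
  exists (Num.bound `|x : R|%R) => //=; rewrite in_itv/=.
  by rewrite (le_lt_trans (ler_norm x))//; exact: archi_boundP.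
- by move=> _ [x ->]; exact: m12.
- by move=> n; exact: moo.
Qed.

Lemma integral_FTC (F f : R -> R) (a b : R) : (a <= b)%R ->
  (forall x : R, is_derive x (1%R : R) F (f x)) -> continuous f ->
  \int[mu]_(x in `[a, b]) (f x)%:E = (F b - F a)%:E.
Proof.
move=> ab dF cf; move: ab; rewrite le_eqVlt => /predU1P[<-|ab].
  by rewrite set_itv1 integral_set1 subrr.
have cF : continuous F.
  by move=> x; apply/differentiable_continuous/derivable1_diffP; have [] := dF x.
rewrite (@continuous_FTC2 R f F)//.
- exact: continuous_subspaceT.
- split; first by move=> x _; have [] := dF x.
  + exact/cvg_at_right_filter/cF.
  + exact/cvg_at_left_filter/cF.
- by move=> x _; rewrite derive1E; apply: derive_val.
Qed.

Lemma integral_FTCoo (F f : R -> R) (a b : R) : (a <= b)%R ->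
  (forall x : R, is_derive x (1%R : R) F (f x)) -> continuous f ->
  \int[mu]_(x in `]a, b[) (f x)%:E = (F b - F a)%:E.
Proof.
move=> ab dF cf; rewrite -(integral_FTC ab dF cf) -(@integral_itv_bndoo _ a b _ true false)//.
apply: measurable_funTS; apply: measurableT_comp => //; exact: continuous_measurable_fun.
Qed.

(** [K] is merely measurable, so the formula is deduced from an equality of measures: Lebesgue
    measure on []F a, F b[] is the image under [F] of the measure with density [f] on []a, b[]. On a
    left ray this equality is the fundamental theorem of calculus. *)
Lemma ge0_integral_substitution (F f : R -> R) (a b : R) (K : R -> \bar R) :
  (a <= b)%R -> (forall x : R, is_derive x (1%R : R) F (f x)) -> continuous f ->
  (forall x, a < x < b -> 0 <= f x)%R ->
  {in `[a, b] &, {mono F : x y / (x < y)%R}} ->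
  measurable_fun [set: R] K -> (forall x, 0 <= K x) ->
  \int[mu]_(x in `]a, b[) (K (F x) * (f x)%:E) = \int[mu]_(x in `]F a, F b[) K x.
Proof.
move=> ab dF cf f0 monoF mK K0.
have cF : continuous F.
  by move=> x; apply/differentiable_continuous/derivable1_diffP; have [] := dF x.
have mF : measurable_fun [set: mR] (F : mR -> mR).
  have h : measurable_fun [set: R] F by exact: continuous_measurable_fun.
  exact: h.
pose g (x : R) : R := if (a < x < b)%R then f x else 0%R.
have g0 x : (0 <= g x)%R by rewrite /g; case: ifPn => // /f0.
have mg : measurable_fun [set: mR] g.
  have h : measurable_fun [set: R] g.
    apply: measurable_fun_ifT => //.
      by apply: measurable_and; apply: measurable_fun_ltr.
    exact: continuous_measurable_fun.
  exact: h.
have gE (D : set R) : measurable D -> \int[mu]_(x in D) (g x)%:E =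
    \int[mu]_(x in `]a, b[ `&` D) (f x)%:E.
  move=> mD; rewrite [LHS]integral_mkcond [RHS]integral_mkcond; apply: eq_integral => x _.
  rewrite !patchE /g in_setI mem_setE in_itv/=.
  by case: (a < x < b)%R; case: (x \in D).
have FaFb : (F a <= F b)%R.
  move: ab; rewrite le_eqVlt => /predU1P[->//|ab].
  by rewrite ltW// monoF// in_itv/= ?lexx ltW.
have Fl y : (a < y -> y < b -> F a < F y)%R.
  by move=> ay yb; rewrite monoF// in_itv/= ?lexx ?(ltW ay) ?(ltW yb) ?ab.
have Fr y : (a < y -> y < b -> F y < F b)%R.
  by move=> ay yb; rewrite monoF// in_itv/= ?lexx ?(ltW ay) ?(ltW yb) ?ab.
pose h (x : R) : R := if (F a < x < F b)%R then 1%R else 0%R.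
have h0 x : (0 <= h x)%R by rewrite /h; case: ifPn.
have mh : measurable_fun [set: mR] h.
  have hh : measurable_fun [set: R] h.
    apply: measurable_fun_ifT => //.
    by apply: measurable_and; apply: measurable_fun_ltr.
  exact: hh.
have hE (D : set R) : measurable D -> \int[mu]_(x in D) (h x)%:E =
    mu (`]F a, F b[ `&` D).
  move=> mD; rewrite -(mul1e (mu _)) -integral_cst; last exact: measurableI.
  rewrite [LHS]integral_mkcond [RHS]integral_mkcond; apply: eq_integral => x _.
  rewrite !patchE /h in_setI mem_setE in_itv/=.
  by case: (F a < x < F b)%R; case: (x \in D).
have mE : forall A, measurable A ->
    density_measure mu mh h0 A = pushforward (density_measure mu mg g0) (F : mR -> mR) A.
  apply: measure_unique_ray => x.
    have mFx : measurable (F @^-1` `]-oo, x[).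
      by rewrite -[X in measurable X]setTI; exact: mF.
    rewrite [LHS](hE _ (measurable_itv _)) [RHS](gE _ mFx).
    have [xa|ax] := leP x (F a).
      rewrite (_ : _ `&` _ = set0); last first.
        by apply/seteqP; split=> // y /=; rewrite !in_itv/=; lra.
      rewrite measure0 (_ : _ `&` _ = set0) ?integral_set0//.
      apply/seteqP; split=> // y /=; rewrite !in_itv/= => -[/andP[ay yb] Fyx].
      by have := Fl y ay yb; lra.
    have [bx|xb] := leP (F b) x.
      rewrite (_ : _ `&` _ = `]F a, F b[%classic); last first.
        by apply/seteqP; split=> y /=; rewrite !in_itv/=; lra.
      rewrite lebesgue_measure_itv/= lte_fin (_ : _ `&` _ = `]a, b[%classic); last first.
        apply/seteqP; split=> y /=; rewrite !in_itv/=; first by case.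
        move=> /andP[ay yb]; split; first by rewrite ay yb.
        by rewrite (lt_le_trans _ bx)// Fr.
      rewrite (integral_FTCoo ab dF cf); case: ltP => // ba.
      by rewrite (_ : F b = F a) ?subrr//; apply/eqP; rewrite eq_le ba.
    (* A ray that ends strictly inside []F a, F b[] ends at some [F c], and monotonicity makes []a,
       c[] its preimage in []a, b[]. *)
    have [c cab Fc] : exists2 c, c \in `[a, b]%R & F c = x.
      apply: IVT => //; first exact: continuous_subspaceT.
      by rewrite min_l// max_r// ltW// ltW.
    have /andP[ac cb] : (a <= c <= b)%R by move: cab; rewrite in_itv.
    rewrite (_ : _ `&` _ = `]F a, F c[%classic); last first.
      by apply/seteqP; split=> y /=; rewrite !in_itv/= Fc; lra.
    rewrite lebesgue_measure_itv/= lte_fin Fc ax (_ : _ `&` _ = `]a, c[%classic).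
      by rewrite (integral_FTCoo ac dF cf) Fc.
    apply/seteqP; split=> y /=; rewrite !in_itv/= -Fc.
      move=> [/andP[ay yb]]; rewrite monoF//; first by rewrite ay.
      by rewrite in_itv/= !ltW.
    move=> /andP[ay yc]; have yb := lt_le_trans yc cb.
    by rewrite ay yb; split=> //; rewrite monoF// in_itv/= !ltW.
  rewrite [X in X < _](hE _ (measurable_itv _)).
  apply: (@le_lt_trans _ _ (mu `]F a, F b[%classic)).
    by apply: le_measure; rewrite ?inE//; exact: measurableI.
  by rewrite lebesgue_measure_itv/=; case: ifP; rewrite ltry.
transitivity (\int[density_measure mu mh h0]_x K x); last first.
  rewrite ge0_integral_density// [RHS]integral_mkcond; apply: eq_integral => x _.
  rewrite patchE mem_setE in_itv/= /h.
  by case: (F a < x < F b)%R; rewrite ?mule1 ?mule0.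
transitivity (\int[pushforward (density_measure mu mg g0) (F : mR -> mR)]_x K x); last first.
  by apply: eq_measure_integral => A mA _; exact: (esym (mE _ _)).
rewrite ge0_integral_pushforward// preimage_setT.
have mKF : measurable_fun [set: mR] (K \o F).
  have hh : measurable_fun [set: R] (K \o F) by apply: measurableT_comp.
  exact: hh.
rewrite (ge0_integral_density mu mg g0 mKF); last by move=> x; exact: K0.
rewrite [LHS]integral_mkcond; apply: eq_integral => x _.
rewrite patchE mem_setE in_itv/= /g.
by case: (a < x < b)%R; rewrite ?mule0.
Qed.

End measure_unique_real.

Section real_functions.
Context {R : realType}.
Implicit Types f g : R -> R.

(** Inversion is discontinuous at 0. The formula [x^-1 = x (x^2)^-1] passes through a real power of
    a nonnegative number and remains true at 0, where [0^-1 = 0]. *)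
Lemma measurable_invr : measurable_fun [set: R] (@GRing.inv R).
Proof.
rewrite (_ : @GRing.inv R = fun x => x * ((x ^+ 2) `^ (- 1))).
  apply: measurable_funM => //.
  by apply: (measurableT_comp (measurable_powR _)); exact: measurable_funX.
apply/funext => x; rewrite powR_inv1 ?sqr_ge0//.
have [->|x0] := eqVneq x 0; first by rewrite invr0 mul0r.
by rewrite expr2 invfM mulrA divff// mul1r.
Qed.

(** In this family of rules the derivative is a free [c] constrained by an equation, so that the
    derivative of a compound expression is assembled as a term and the resulting identity is left to
    [ring] or [field]. *)
Lemma is_derive_mul f g (x a b c : R) : is_derive x (1 : R) f a -> is_derive x (1 : R) g b ->
  c = f x * b + g x * a -> is_derive x (1 : R) (fun y => f y * g y) c.
Proof. by move=> df dg ->; exact: (is_derive_eq (is_deriveM df dg)). Qed.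

Lemma is_derive_pow f n (x a c : R) : is_derive x (1 : R) f a ->
  c = n%:R * f x ^+ n.-1 * a -> is_derive x (1 : R) (fun y => f y ^+ n) c.
Proof.
move=> df ->; have := is_deriveX n df.
by rewrite (_ : (f ^+ n)%R = fun y => f y ^+ n)//; apply/funext => y; elim: n => //= n; rewrite !exprS => <-.
Qed.

Lemma is_derive_inv f (x a c : R) : f x != 0 -> is_derive x (1 : R) f a ->
  c = - a / f x ^+ 2 -> is_derive x (1 : R) (fun y => (f y)^-1) c.
Proof.
by move=> f0 df ->; apply: (is_derive_eq (is_deriveV f0 df)); rewrite /GRing.scale/= mulNr mulrC mulNr.
Qed.

Lemma is_derive_add f g (x a b c : R) : is_derive x (1 : R) f a -> is_derive x (1 : R) g b ->
  c = a + b -> is_derive x (1 : R) (fun y => f y + g y) c.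
Proof. by move=> df dg ->; exact: (is_derive_eq (is_deriveD df dg)). Qed.

Lemma is_derive_chain f g (x a b c : R) : is_derive (g x) (1 : R) f a -> is_derive x (1 : R) g b ->
  c = a * b -> is_derive x (1 : R) (fun y => f (g y)) c.
Proof. by move=> df dg ->; exact: is_derive1_comp. Qed.

Lemma is_derive_const (k x : R) : is_derive x (1 : R) (fun _ : R => k) 0.
Proof. exact: is_derive_cst. Qed.

Lemma is_derive_linear (k x : R) : is_derive x (1 : R) (fun y : R => k * y) k.
Proof.
apply: (is_derive_mul (is_derive_const k x) (is_derive_id x 1)).
by rewrite mulr1 mulr0 addr0.
Qed.

Lemma continuous_mul f g : continuous f -> continuous g -> continuous (fun x => f x * g x).
Proof. by move=> cf cg x; exact: cvgM (cf x) (cg x). Qed.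

Lemma continuous_add f g : continuous f -> continuous g -> continuous (fun x => f x + g x).
Proof. by move=> cf cg x; exact: cvgD (cf x) (cg x). Qed.

Lemma continuous_const (k : R) : continuous (fun _ : R => k).
Proof. by move=> x; exact: cst_continuous. Qed.

Lemma continuous_pow f n : continuous f -> continuous (fun x => f x ^+ n).
Proof.
by move=> cf x; apply: (@continuous_comp _ _ _ f (fun y => y ^+ n)); [exact: cf|exact: exprn_continuous].
Qed.

End real_functions.

(** * Powers of A - |x|^2, polar coordinates and Gaussian integrals *)

Section half_integer_powers.
Context {R : realType}.
Local Notation mu := (@lebesgue_measure R).
Local Notation mR := (measurableTypeR R).

(* [hp j A] is the half-integer power A^((j - 1) / 2), extended by 0. *)
Definition hp (j : nat) (A : R) : R :=
  if 0 < A then Num.sqrt A ^+ j / Num.sqrt A else 0.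

Lemma hp_ge0 j A : 0 <= hp j A.
Proof. by rewrite /hp; case: ifPn => // A0; rewrite divr_ge0// ?exprn_ge0// sqrtr_ge0. Qed.

Lemma measurable_sqrt : measurable_fun [set: R] (@Num.sqrt R).
Proof. by apply: continuous_measurable_fun; exact: sqrt_continuous. Qed.

Lemma measurable_hp j : measurable_fun [set: R] (hp j).
Proof.
apply: measurable_fun_ifT; first exact: measurable_fun_ltr.
  apply: measurable_funM; first by apply: measurable_funX; exact: measurable_sqrt.
  exact: (measurableT_comp (@measurable_invr R) measurable_sqrt).
exact: measurable_cst.
Qed.

Lemma hpM j A B : 0 < A -> hp j (A * B) = hp j A * hp j B.
Proof.
move=> A0; rewrite /hp pmulr_rgt0// A0; case: ifPn => B0; last by rewrite mulr0.
by rewrite sqrtrM ?ltW// exprMn invfM mulrACA.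
Qed.

Lemma hpS j A : hp j.+1 A = Num.sqrt A * hp j A.
Proof. by rewrite /hp; case: ifPn; rewrite ?mulr0// exprS mulrA. Qed.

Lemma hp1 A : hp 1 A = (if 0 < A then 1 else 0).
Proof. by rewrite /hp; case: ifPn => // A0; rewrite expr1 divff// gt_eqF// sqrtr_gt0. Qed.

(** From index 2 on the exponent is positive, so the value 0 at [A = 0] is the true power. *)
Lemma hpSE j A : 0 <= A -> hp j.+2 A = Num.sqrt A ^+ j.+1.
Proof.
rewrite le_eqVlt => /predU1P[<-|A0]; first by rewrite /hp ltxx sqrtr0 expr0n.
by rewrite /hp A0 exprSr mulfK// gt_eqF// sqrtr_gt0.
Qed.

(** The Wallis integrals: [wc j] is half of the Beta function at [((j + 1)/2, 1/2)]. *)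
Definition wc (j : nat) : R := (\int[mu]_(x in `[0, (pi / 2)]) cos x ^+ j)%R.

Let continuous_cosX j : continuous (fun x : R => cos x ^+ j).
Proof.
move=> x; apply: (@continuous_comp _ _ _ (@cos R) (fun y => y ^+ j)).
  exact: continuous_cos.
exact: exprn_continuous.
Qed.

Let pih0 : 0 <= (pi : R) / 2.
Proof. by rewrite divr_ge0// pi_ge0. Qed.

Lemma integral_wc j : (\int[mu]_(x in `[0%R, (pi / 2)%R]) (cos x ^+ j)%:E = (wc j)%:E)%E.
Proof.
rewrite /wc /Rintegral fineK//; apply: integrable_fin_num => //.
apply: continuous_compact_integrable; first exact: segment_compact.
apply: continuous_subspaceT; exact: continuous_cosX.
Qed.

Lemma integral_FTC_eq (F f g : R -> R) (a b : R) : a <= b ->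
  (forall x : R, is_derive x (1%R : R) F (f x - g x)) -> continuous f -> continuous g ->
  (\int[mu]_(x in `[a, b]) f x - \int[mu]_(x in `[a, b]) g x = F b - F a)%R.
Proof.
move=> ab dF cf cg; rewrite -RintegralB//.
- rewrite /Rintegral (integral_FTC ab dF)//.
  by move=> x; apply: continuousB; [exact: cf|exact: cg].
- by apply: continuous_compact_integrable; [exact: segment_compact|exact: continuous_subspaceT].
- by apply: continuous_compact_integrable; [exact: segment_compact|exact: continuous_subspaceT].
Qed.

Lemma wc0 : wc 0 = pi / 2.
Proof.
have dF (x : R) : is_derive x (1 : R) (fun y : R => y) 1 by apply: is_derive_id.
have c1 : continuous (fun _ : R => 1 : R) by move=> x; exact: cst_continuous.
rewrite /wc /Rintegral; under eq_integral do rewrite expr0.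
by rewrite (integral_FTC pih0 dF c1)/= subr0.
Qed.

Lemma wc1 : wc 1 = 1.
Proof.
have dF (x : R) : is_derive x (1 : R) (@sin R) (cos x) by exact: is_derive_sin.
rewrite /wc /Rintegral; under eq_integral do rewrite expr1.
by rewrite (integral_FTC pih0 dF (@continuous_cos R))/= sin_pihalf sin0 subr0.
Qed.

(** Integrates the derivative of [sin * cos^(j+1)], a function that vanishes at both ends of
    [[0, pi/2]]. *)
Lemma wc_rec j : j.+2%:R * wc j.+2 = j.+1%:R * wc j.
Proof.
have dF (x : R) : is_derive x (1 : R) (fun y => sin y * cos y ^+ j.+1)
    (j.+2%:R * cos x ^+ j.+2 - j.+1%:R * cos x ^+ j).
  apply: (is_derive_mul (is_derive_sin x) (is_derive_pow (n := j.+1) (is_derive_cos x) erefl)).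
  have := sin2cos2 x; set c := cos x; set s := sin x => cs.
  by rewrite -[j.+2%:R]natr1 /= !exprS; ring: cs.
have cM (a : R) k : continuous (fun x : R => a * cos x ^+ k).
  by apply: continuous_mul; [exact: continuous_const|exact: continuous_cosX].
have := integral_FTC_eq pih0 dF (cM _ _) (cM _ _).
rewrite cos_pihalf sin0 mul0r expr0n mulr0 subrr.
have ic k : mu.-integrable `[0%R, (pi / 2)%R] (EFin \o (fun x : R => cos x ^+ k)).
  by apply: continuous_compact_integrable; [exact: segment_compact|exact: continuous_subspaceT].
by rewrite !RintegralZl// => /eqP; rewrite subr_eq0 => /eqP.
Qed.

Lemma wc_gt0 j : 0 < wc j.
Proof.
have wc01 : 0 < wc 0 /\ 0 < wc 1 by rewrite wc0 wc1 divr_gt0 ?pi_gt0.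
suff : 0 < wc j /\ 0 < wc j.+1 by case.
elim: j => // j [wj wSj]; split=> //.
have j2 : 0 < j.+2%:R :> R by rewrite ltr0n.
by rewrite -(pmulr_rgt0 _ j2) wc_rec mulr_gt0// ltr0n.
Qed.

Lemma ge0_integral_sin_subst (K : R -> \bar R) :
  measurable_fun [set: R] K -> (forall x, 0 <= K x)%E ->
  (\int[mu]_(x in `]0%R, 1%R[) K x =
   \int[mu]_(x in `]0%R, (pi / 2)%R[) (K (sin x) * (cos x)%:E))%E.
Proof.
move=> mK K0; rewrite -[X in `]X, _[](@sin0 R) -[X in `]_, X[](@sin_pihalf R).
rewrite -(@ge0_integral_substitution R (@sin R) (@cos R))//.
- exact: continuous_cos.
- by move=> x /andP[x0 x1]; rewrite ltW// cos_gt0_pihalf// x1 andbT (lt_trans _ x0)// oppr_lt0 divr_gt0// pi_gt0.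
- move=> x y; rewrite !in_itv/= => /andP[x0 x1] /andP[y0 y1].
  have ph : - (pi / 2) <= 0 :> R by rewrite oppr_le0.
  by rewrite ltr_sin// in_itv/= ?(le_trans ph).
Qed.

Lemma ge0_integral_even (K : R -> \bar R) : measurable_fun [set: R] K ->
  (forall x, 0 <= K x)%E -> (forall x, K (- x) = K x) ->
  (\int[mu]_x K x = 2%:E * \int[mu]_(x in `]0%R, +oo[) K x)%E.
Proof.
move=> mK K0 Keven.
have N1 : (-1 : R) != 0 by rewrite oppr_eq0 oner_eq0.
have split : [set: mR] = `]-oo, 0%R] `|` `]0%R, +oo[.
  by apply/seteqP; split=> // x _ /=; rewrite !in_itv/= andbT; case: (leP x 0); [left|right].
rewrite {1}split ge0_integral_setU//; last 2 first.
- by rewrite -split; exact: mK.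
- apply/disj_setPS => x [] /=; rewrite !in_itv/= andbT => /le_lt_trans h /h.
  by rewrite ltxx.
rewrite [X in _ = (X * _)%E](_ : 2%:E = (1 + 1)%E)//.
rewrite ge0_muleDl// mul1e; congr (_ + _)%E.
pose g x : \bar R := (K \_ `]-oo, 0%R]) x.
have mg : measurable_fun [set: R] g.
  by apply/(measurable_restrictT _ _).1 => //; exact: measurable_funTS.
have g0 x : (0 <= g x)%E by apply: erestrict_ge0.
rewrite integral_itv_obnd_cbnd; last exact: measurable_funTS.
rewrite integral_mkcond [RHS]integral_mkcond.
have := @ge0_integral_affine R (-1) 0 g N1 mg g0.
rewrite normrN normr1 invr1 mul1e => <-; apply: eq_integral => x _.
by rewrite /g !patchE !mem_setE !in_itv/= mulN1r addr0 oppr_le0 andbT Keven.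
Qed.

(** Under [x = sin y] the weight [(1 - x^2)^((j-1)/2)] becomes [cos y^(j-1)], and [dx] supplies one
    more cosine. Evenness folds the line onto the half-line, whence the factor 2. *)
Lemma integral_hp_weight j (K : R -> \bar R) : measurable_fun [set: R] K ->
  (forall x, 0 <= K x)%E -> (forall x, K (- x) = K x) ->
  (\int[mu]_x ((hp j (1 - x ^+ 2))%:E * K x) =
   2%:E * \int[mu]_(x in `]0%R, (pi / 2)%R[) ((cos x ^+ j)%:E * K (sin x)))%E.
Proof.
move=> mK K0 Keven; pose G (x : R) := ((hp j (1 - x ^+ 2))%:E * K x)%E.
have mG : measurable_fun [set: R] G.
  apply: emeasurable_funM => //; apply: measurableT_comp => //.
  by apply: (measurableT_comp (measurable_hp j)); apply: measurable_funB.
have G0 x : (0 <= G x)%E by rewrite mule_ge0// lee_fin hp_ge0.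
rewrite (ge0_integral_even mG G0); last by move=> x; rewrite /G sqrrN Keven.
congr (_ * _)%E; transitivity (\int[mu]_(x in `]0%R, 1%R[) G x)%E.
  rewrite integral_mkcond [RHS]integral_mkcond; apply: eq_integral => x _.
  rewrite !patchE !mem_setE !in_itv/= andbT; case: (ltP 0 x) => //= x0.
  case: ifPn => //; rewrite -leNgt => x1.
  rewrite /G /hp ifF ?mul0e//; apply/negbTE; rewrite -leNgt subr_le0.
  by rewrite -[X in X <= _](expr1n _ 2) ler_sqr ?nnegrE// ltW.
rewrite (ge0_integral_sin_subst mG G0); apply: eq_integral => x.
rewrite inE/= in_itv/= => /andP[x0 x1].
have c0 : 0 < cos x.
  by rewrite cos_gt0_pihalf// x1 andbT (lt_trans _ x0)// oppr_lt0 divr_gt0// pi_gt0.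
rewrite /G -cos2sin2 /hp exprn_gt0// sqrtr_sqr gtr0_norm// muleAC -EFinM.
by rewrite divfK// gt_eqF.
Qed.

Lemma integral_hp1 j : (\int[mu]_x (hp j (1 - x ^+ 2))%:E = (2 * wc j)%:E)%E.
Proof.
have := @integral_hp_weight j (fun=> 1%E) (measurable_cst _).
under eq_integral do rewrite mule1.
move=> -> //; under eq_integral do rewrite mule1.
rewrite EFinM -integral_wc; congr (_ * _)%E.
apply/esym/(@integral_itv_bndoo R 0 (pi / 2) _ true false).
apply: measurable_funTS; apply: measurableT_comp => //.
by apply: continuous_measurable_fun; exact: continuous_cosX.
Qed.

Lemma measurable_hpB j (A : R) : measurable_fun [set: R] (fun x : R => hp j (A - x ^+ 2)).
Proof.
by apply: (measurableT_comp (measurable_hp j)); apply: measurable_funB.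
Qed.

(** Homogeneity: after [x -> r x] the weight contributes [r^(j-1)] and [dx] one more factor [r]. *)
Lemma integral_hp_scale j (r : R) (K : R -> \bar R) : 0 < r -> measurable_fun [set: R] K ->
  (forall x, 0 <= K x)%E ->
  (\int[mu]_x ((hp j (r ^+ 2 - x ^+ 2))%:E * K x) =
   (r ^+ j)%:E * \int[mu]_x ((hp j (1 - x ^+ 2))%:E * K (r * x)%R))%E.
Proof.
move=> r0 mK K0; pose G (x : R) := ((hp j (r ^+ 2 - x ^+ 2))%:E * K x)%E.
have mG : measurable_fun [set: R] G.
  by apply: emeasurable_funM => //; apply: measurableT_comp => //; exact: measurable_hpB.
have G0 x : (0 <= G x)%E by rewrite mule_ge0// lee_fin hp_ge0.
have rn0 : r != 0 by rewrite gt_eqF.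
have := @ge0_integral_affine R r 0 G rn0 mG G0.
rewrite gtr0_norm// => /(congr1 (fun y => r%:E * y)%E).
rewrite muleA -EFinM divff// mul1e => <-.
have GE (x : R) : G (r * x + 0) = ((hp j (r ^+ 2))%:E * ((hp j (1 - x ^+ 2))%:E * K (r * x)%R))%E.
  by rewrite /G addr0 exprMn -{1}[r ^+ 2]mulr1 -mulrBr hpM ?exprn_gt0// EFinM muleA.
under eq_integral do rewrite GE.
rewrite ge0_integralZl//; last 3 first.
- apply: emeasurable_funM; first by apply: measurableT_comp => //; exact: measurable_hpB.
  by apply: (measurableT_comp mK); exact: measurable_funM.
- by move=> x _; rewrite mule_ge0// lee_fin hp_ge0.
- by rewrite lee_fin hp_ge0.
rewrite muleA -EFinM; congr (_%:E * _)%E.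
by rewrite /hp exprn_gt0// sqrtr_sqr gtr0_norm// mulrC divfK.
Qed.

Lemma integral_hp j (A : R) :
  (\int[mu]_x (hp j (A - x ^+ 2))%:E = (2 * wc j * hp j.+1 A)%:E)%E.
Proof.
have [A0|A0] := ltP 0 A; last first.
  rewrite /hp ltNge A0/= mulr0 integral0_eq// => x _.
  by rewrite ifF//; apply/negbTE; rewrite -leNgt subr_le0 (le_trans A0)// sqr_ge0.
have sA : 0 < Num.sqrt A by rewrite sqrtr_gt0.
have := @integral_hp_scale j (Num.sqrt A) (fun=> 1%E) sA (measurable_cst _).
under eq_integral do rewrite mule1 sqr_sqrtr ?ltW//.
move=> -> //; under eq_integral do rewrite mule1.
by rewrite integral_hp1 -EFinM hpS /hp A0 [X in _ = (_ * X)%:E]mulrC mulfVK ?gt_eqF// mulrC.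
Qed.

(** Integrating out one coordinate raises the index of [hp] by one and costs a factor [2 * wc]. Thus
    [wprod 1 n] is the volume of the unit ball in dimension [n], and [wprod 0 n] is half of the area
    of the unit sphere in dimension [n + 1]. *)
Definition wprod (j n : nat) : R := \prod_(i < n) (2 * wc (j + i)).

Lemma wprod_gt0 j n : 0 < wprod j n.
Proof. by apply: prodr_gt0 => i _; rewrite mulr_gt0// wc_gt0. Qed.

Lemma measurable_hp_Rn n j (A : R) :
  measurable_fun [set: Rn R n] (fun x => (hp j (A - dotV x x))%:E).
Proof.
have mh : measurable_fun [set: R] (fun y : R => (hp j (A - y))%:E).
  apply: measurableT_comp => //; apply: (measurableT_comp (measurable_hp j)).
  exact: measurable_funB.
exact: (measurableT_comp mh (@measurable_dotVV R n)).
Qed.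

Lemma integral_hp_Rn n j (A : R) :
  (\int[lebesgue_Rn R n]_x (hp j (A - dotV x x))%:E = (wprod j n * hp (j + n) A)%:E)%E.
Proof.
elim: n A => [|n IH] A.
  rewrite integral_Rn0; last exact: measurable_hp_Rn.
  by rewrite dotV0 subr0 /wprod big_ord0 mul1r addn0.
rewrite integral_consRn; [|exact: measurable_hp_Rn|by move=> x; rewrite lee_fin hp_ge0].
under eq_integral => x _.
  under eq_integral => y _ do rewrite dotV_cons -expr2 opprD addrA.
  rewrite IH; over.
under eq_integral do rewrite EFinM.
rewrite ge0_integralZl//; last 3 first.
- by apply: measurableT_comp => //; exact: measurable_hpB.
- by move=> x _; rewrite lee_fin hp_ge0.
- by rewrite lee_fin ltW// wprod_gt0.
by rewrite integral_hp -EFinM mulrA addnS /wprod big_ord_recr.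
Qed.

(** This is the marginal of [(A - |x|^2)_+^(-1/2)] along the first axis: the [n] other coordinates
    raise the index from 0 to [n]. *)
Lemma integral_hp0_fst n (A : R) (K : R -> \bar R) : measurable_fun [set: R] K ->
  (forall x, 0 <= K x)%E ->
  (\int[lebesgue_Rn R n.+1]_x ((hp 0 (A - dotV x x))%:E * K (fstRn x)) =
   (wprod 0 n)%:E * \int[mu]_y ((hp n (A - y ^+ 2))%:E * K y))%E.
Proof.
move=> mK K0.
rewrite integral_consRn; [| |by move=> x; rewrite mule_ge0// lee_fin hp_ge0]; last first.
  apply: emeasurable_funM; first exact: measurable_hp_Rn.
  exact: (measurableT_comp mK (@measurable_fstRn R n)).
under eq_integral => x _.
  under eq_integral => y _ do rewrite dotV_cons -expr2 opprD addrA fstRn_cons.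
  rewrite ge0_integralZr//; last 2 first.
    exact: measurable_hp_Rn.
    by move=> y _; rewrite lee_fin hp_ge0.
  rewrite integral_hp_Rn EFinM -muleA; over.
rewrite ge0_integralZl//.
- by apply: emeasurable_funM => //; apply: measurableT_comp => //; exact: measurable_hpB.
- by move=> x _; rewrite mule_ge0// lee_fin hp_ge0.
- by rewrite lee_fin ltW// wprod_gt0.
Qed.

End half_integer_powers.

(** * Polar coordinates, Gaussian integrals and half-integer values of Gamma *)

Section polar.
Context {R : realType}.
Local Notation mu := (@lebesgue_measure R).
Local Notation mR := (measurableTypeR R).

Lemma integral_powS_oo n (b : R) : 0 <= b ->
  (\int[mu]_(x in `]0%R, b[) (n.+1%:R * x ^+ n)%:E = (b ^+ n.+1)%:E)%E.
Proof.
move=> b0.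
have dF (x : R) : is_derive x (1 : R) (fun y => y ^+ n.+1) (n.+1%:R * x ^+ n).
  by apply: (is_derive_pow (is_derive_id x 1)); rewrite mulr1.
rewrite (integral_FTCoo b0 dF) ?expr0n ?subr0//.
by apply: continuous_mul; [exact: continuous_const|apply: continuous_pow => x; exact: cvg_id].
Qed.

(** [hp 1] is the indicator of the positive reals, so [integral_hp_Rn] contains the volume of
    balls. *)
Lemma lebesgue_Rn_ball n (r : R) : 0 <= r ->
  lebesgue_Rn R n.+1 [set x | normV x < r] = (wprod 1 n.+1 * r ^+ n.+1)%:E.
Proof.
move=> r0.
have mB : measurable [set x : Rn R n.+1 | normV x < r].
  rewrite (_ : [set _ | _] = @normV R n.+1 @^-1` `]-oo, r[).
    rewrite -[X in measurable X]setTI; exact: measurable_normV.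
  by apply/seteqP; split=> x /=; rewrite in_itv.
have := integral_indic (lebesgue_Rn R n.+1) measurableT mB.
rewrite setIT => <-.
transitivity (\int[lebesgue_Rn R n.+1]_x (hp 1 (r ^+ 2 - dotV x x))%:E)%E.
  apply: eq_integral => x _; rewrite indicE hp1 -normV_sqr subr_gt0.
  rewrite ltr_sqr ?nnegrE ?normV_ge0//.
  have [h|h] := ltP (normV x) r; first by rewrite mem_set.
  by rewrite memNset//=; apply/negP; rewrite -leNgt.
by rewrite integral_hp_Rn add1n hpSE ?sqr_ge0// sqrtr_sqr ger0_norm.
Qed.

(** The image of Lebesgue measure under the norm and the measure with density
    [(n + 1) wprod 1 (n + 1) s^n] on the half-line agree on left rays by the volume formula for
    balls, and rays determine them. *)
Lemma ge0_integral_polar n (K : R -> \bar R) : measurable_fun [set: R] K ->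
  (forall x, 0 <= K x)%E ->
  (\int[lebesgue_Rn R n.+1]_x K (normV x) =
   \int[mu]_(s in `]0%R, +oo[) (K s * (n.+1%:R * wprod 1 n.+1 * s ^+ n)%:E))%E.
Proof.
move=> mK K0.
pose g (s : R) : R := if 0 < s then n.+1%:R * wprod 1 n.+1 * s ^+ n else 0.
have V0 : 0 < wprod 1 n.+1 :> R by exact: wprod_gt0.
have g0 s : 0 <= g s.
  by rewrite /g; case: ifPn => // s0; rewrite !mulr_ge0 ?ltW// exprn_gt0.
have mg : measurable_fun [set: mR] g.
  have h : measurable_fun [set: R] g.
    apply: measurable_fun_ifT => //; first exact: measurable_fun_ltr.
    by apply: measurable_funM => //; exact: measurable_funX.
  exact: h.
have mN : measurable_fun [set: Rn R n.+1] (@normV R n.+1 : _ -> mR).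
  have h := @measurable_normV R n.+1; exact: h.
have mE : forall A, measurable A ->
    density_measure mu mg g0 A = pushforward (lebesgue_Rn R n.+1) (@normV R n.+1 : _ -> mR) A.
  have dE (x : R) : 0 <= x -> density_measure mu mg g0 `]-oo, x[ = (wprod 1 n.+1 * x ^+ n.+1)%:E.
    move=> x0; transitivity (\int[mu]_(s in `]0%R, x[) ((wprod 1 n.+1)%:E * (n.+1%:R * s ^+ n)%:E))%E.
      rewrite /density_measure [LHS]integral_mkcond [RHS]integral_mkcond.
      apply: eq_integral => s _; rewrite !patchE !mem_setE !in_itv/= /g -EFinM.
      rewrite mulrCA mulrA.
      by case: (ltP s x); case: (ltP 0 s).
    rewrite ge0_integralZl//; last 3 first.
    - apply: measurable_funTS; apply: measurableT_comp => //.
      by apply: measurable_funM => //; exact: measurable_funX.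
    - by move=> s; rewrite /= in_itv/= => /andP[s0 _]; rewrite lee_fin mulr_ge0// exprn_ge0// ltW.
    - by rewrite lee_fin ltW.
    by rewrite integral_powS_oo// EFinM.
  have dE' (x : R) : density_measure mu mg g0 `]-oo, x[ = pushforward (lebesgue_Rn R n.+1) (@normV R n.+1 : _ -> mR) `]-oo, x[.
    rewrite /pushforward (_ : _ @^-1` _ = [set y | normV y < x]); last first.
      by apply/seteqP; split=> y /=; rewrite in_itv.
    have [x0|x0] := leP 0 x; first by rewrite dE// lebesgue_Rn_ball.
    rewrite (_ : [set y | normV y < x] = set0) ?measure0.
      rewrite /density_measure integral0_eq// => s /=; rewrite in_itv/= => sx.
      by rewrite /g ifF//; apply/negbTE; rewrite -leNgt ltW// (lt_trans sx).
    apply/seteqP; split=> // y /= yx; have := normV_ge0 y.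
    by rewrite leNgt (lt_trans yx).
  apply: measure_unique_ray => x; first exact: dE'.
  have [x0|x0] := leP 0 x; first by rewrite [X in (X < _)%E](dE _ x0) ltry.
  rewrite [X in (X < _)%E](dE' _) /pushforward (_ : _ @^-1` _ = set0) ?measure0//.
  apply/seteqP; split=> // y /=; rewrite in_itv/= => yx; have := normV_ge0 y.
  by rewrite leNgt (lt_trans yx).
transitivity (\int[pushforward (lebesgue_Rn R n.+1) (@normV R n.+1 : _ -> mR)]_s K s)%E.
  by rewrite (ge0_integral_pushforward mN)// => x _; exact: K0.
transitivity (\int[density_measure mu mg g0]_s K s)%E.
  by apply: eq_measure_integral => A mA _; exact: (esym (mE A mA)).
rewrite ge0_integral_density//.
rewrite [RHS]integral_mkcond; apply: eq_integral => s _.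
rewrite patchE mem_setE in_itv/= /g andbT.
by case: (ltP 0 s); rewrite ?mule0.
Qed.

Lemma ge0_integral_cvgy (f : R -> \bar R) : measurable_fun [set: R] f ->
  (forall x, 0 <= f x)%E ->
  (\int[mu]_(x in `]0%R, n%:R[) f x @[n --> \oo] --> \int[mu]_(x in `]0%R, +oo[) f x)%E.
Proof.
move=> mf f0.
have -> : `]0%R, +oo[%classic = \bigcup_n `]0%R, (n%:R : R)[%classic.
  apply/seteqP; split=> x /=; last by move=> [n _]; rewrite /= !in_itv/= andbT => /andP[].
  rewrite in_itv/= andbT => x0; exists (Num.bound x) => //=; rewrite in_itv/= x0/=.
  by apply: archi_boundP; exact: ltW.
apply: ge0_nondecreasing_set_cvg_integral.
- move=> m n mn; apply/subsetPset => x /=; rewrite !in_itv/= => /andP[-> xm].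
  by rewrite (lt_le_trans xm)// ler_nat.
- by move=> n; exact: measurable_itv.
- by move=> n; exact: measurable_funTS.
- by move=> n x _; exact: f0.
Qed.

(** The substitution is made on []0, n[], which squaring maps onto []0, n^2[], and monotone limits
    reach the half-lines. The absolute value in [G] makes it nonnegative on the whole line. *)
Lemma ge0_integral_sqr_subst (K : R -> \bar R) : measurable_fun [set: R] K ->
  (forall x, 0 <= K x)%E ->
  (\int[mu]_(x in `]0%R, +oo[) K x =
   \int[mu]_(x in `]0%R, +oo[) (K (x ^+ 2)%R * (2 * x)%:E))%E.
Proof.
move=> mK K0; pose G (x : R) := (K (x ^+ 2)%R * (2 * `|x|)%:E)%E.
have mG : measurable_fun [set: R] G.
  apply: emeasurable_funM; first by apply: (measurableT_comp mK); exact: measurable_funX.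
  by apply: measurableT_comp => //; apply: measurable_funM => //; exact: measurableT_comp.
have G0 x : (0 <= G x)%E by rewrite mule_ge0// lee_fin mulr_ge0.
transitivity (\int[mu]_(x in `]0%R, +oo[) G x)%E; last first.
  apply: eq_integral => x; rewrite inE/= in_itv/= andbT => x0.
  by rewrite /G gtr0_norm.
have GE n : (\int[mu]_(x in `]0%R, n%:R[) G x = \int[mu]_(x in `]0%R, (n ^ 2)%:R[) K x)%E.
  have n0 : 0 <= n%:R :> R by [].
  have dF (x : R) : is_derive x (1 : R) (fun y => y ^+ 2) (2 * x).
    by apply: (is_derive_pow (is_derive_id x 1)); rewrite mulr1 expr1.
  have := @ge0_integral_substitution R (fun y => y ^+ 2) (fun y => 2 * y) 0 n%:R K n0 dF.
  rewrite expr0n/= natrX => <-//.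
  - apply: eq_integral => x; rewrite inE/= in_itv/= => /andP[x0 _].
    by rewrite /G gtr0_norm.
  - by apply: continuous_mul; [exact: continuous_const|move=> x; exact: cvg_id].
  - by move=> x /andP[x0 _]; rewrite mulr_ge0// ltW.
  - by move=> x y; rewrite !in_itv/= => /andP[x0 _] /andP[y0 _]; rewrite ltr_sqr.
have cG := ge0_integral_cvgy mG G0.
have cK := ge0_integral_cvgy mK K0.
have cK2 : (\int[mu]_(x in `]0%R, (n ^ 2)%:R[) K x @[n --> \oo] --> \int[mu]_(x in `]0%R, +oo[) K x)%E.
  apply: (cvg_comp (fun n => (n ^ 2)%N) _ _ cK).
  apply/cvgnyPge => A; exists A => // n /= An; rewrite (leq_trans An)//.
  by case: n An => // n _; rewrite expnS expn1 leq_pmulr.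
rewrite -(cvg_lim (@ereal_hausdorff R) cK2) -(cvg_lim (@ereal_hausdorff R) cG).
by congr (limn _); apply/funext => n; rewrite GE.
Qed.

Lemma integral_gauss_affine (k b : R) : 0 < k ->
  (\int[mu]_x (expR (- (k * x + b) ^+ 2))%:E = (Num.sqrt pi / k)%:E)%E.
Proof.
move=> k0; have kn0 : k != 0 by rewrite gt_eqF.
have mg : measurable_fun [set: R] (fun x : R => (gauss_fun x)%:E).
  by apply: measurableT_comp => //; exact: measurable_gauss_fun.
have := @ge0_integral_affine R k b _ kn0 mg.
rewrite integralT_gauss gtr0_norm// -EFinM mulrC => <-//.
by move=> x; rewrite lee_fin gauss_fun_ge0.
Qed.

(* For [e = 1] or [e = -1] this is the squared norm of [x + e y]. *)
Definition sqdist n (e : R) (x y : Rn R n) : R := dotV x x + 2 * e * dotV x y + dotV y y.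

Lemma sqdist_cons n (e a b : R) (x y : Rn R n) : e ^+ 2 = 1 ->
  sqdist e (consRn (a, x)) (consRn (b, y)) = (a + e * b) ^+ 2 + sqdist e x y.
Proof. by move=> e1; rewrite /sqdist !dotV_cons sqrrD exprMn e1; ring. Qed.

Lemma measurable_sqdist n (e : R) (y : Rn R n) :
  measurable_fun [set: Rn R n] (fun x => sqdist e x y).
Proof.
apply: measurable_funD; last exact: measurable_cst.
apply: measurable_funD; first exact: measurable_dotVV.
by apply: measurable_funM; [exact: measurable_cst|exact: measurable_dotVl].
Qed.

Lemma measurable_expR_sqdist n (e k : R) (y : Rn R n) :
  measurable_fun [set: Rn R n] (fun x => (expR (- (k ^+ 2 * sqdist e x y)))%:E).
Proof.
have h : measurable_fun [set: R] (fun z : R => (expR (- (k ^+ 2 * z)))%:E).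
  apply: measurableT_comp => //; apply: measurableT_comp => //.
  by apply: measurable_funN; exact: measurable_funM.
exact: (measurableT_comp h (measurable_sqdist e y)).
Qed.

Lemma integral_gauss_sqdist n (e k : R) (y : Rn R n) : 0 < k -> e ^+ 2 = 1 ->
  (\int[lebesgue_Rn R n]_x (expR (- (k ^+ 2 * sqdist e x y)))%:E =
   ((Num.sqrt pi / k) ^+ n)%:E)%E.
Proof.
move=> k0 e1; elim: n y => [|n IH] y.
  rewrite integral_Rn0; last exact: measurable_expR_sqdist.
  by rewrite /sqdist !dotV0 !mulr0 !addr0 mulr0 oppr0 expR0 expr0.
rewrite integral_consRn; [|exact: measurable_expR_sqdist|by move=> x; rewrite lee_fin expR_ge0].
rewrite (consRn_split y); set b : R := thead y; set v := [tuple of _].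
under eq_integral => x _.
  under eq_integral => z _.
    rewrite sqdist_cons// mulrDr opprD expRD EFinM; over.
  rewrite ge0_integralZl; [|exact: measurableT|exact: measurable_expR_sqdist
    |by move=> z _; rewrite lee_fin expR_ge0|by rewrite lee_fin expR_ge0].
  rewrite IH -exprMn mulrDr; over.
have mE : measurable_fun [set: R] (fun x : R => (expR (- (k * x + k * (e * b)) ^+ 2))%:E).
  apply: measurableT_comp => //; apply: measurableT_comp => //.
  by apply: measurable_funN; apply: measurable_funX; apply: measurable_funD => //; exact: measurable_funM.
rewrite ge0_integralZr; [|exact: measurableT|exact: mE|by move=> z _; rewrite lee_fin expR_ge0
  |by rewrite lee_fin exprn_ge0// divr_ge0 ?sqrtr_ge0// ltW].
by rewrite integral_gauss_affine// -EFinM exprS.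
Qed.

Definition zeroRn n : Rn R n := [tuple 0 | i < n].

Lemma dotV_zero n (x : Rn R n) : dotV x (zeroRn n) = 0.
Proof. by rewrite /dotV big1// => i _; rewrite tnth_mktuple mulr0. Qed.

Lemma integral_gauss_Rn n (k : R) : 0 < k ->
  (\int[lebesgue_Rn R n]_x (expR (- (k ^+ 2 * dotV x x)))%:E =
   ((Num.sqrt pi / k) ^+ n)%:E)%E.
Proof.
move=> k0; rewrite -(@integral_gauss_sqdist n 1 k (zeroRn n) k0) ?expr1n//.
by apply: eq_integral => x _; rewrite /sqdist !dotV_zero mulr0 !addr0.
Qed.

(** Compares two evaluations of the Gaussian integral in dimension [n + 1]: as a product of
    one-dimensional ones, and in polar coordinates. *)
Lemma integral_gauss_moment n :
  (\int[mu]_(s in `]0%R, +oo[) (expR (- s ^+ 2) * s ^+ n)%:E =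
   (Num.sqrt pi ^+ n.+1 / (n.+1%:R * wprod 1 n.+1))%:E)%E.
Proof.
have W0 : 0 < n.+1%:R * wprod 1 n.+1 :> R by rewrite mulr_gt0 ?ltr0n ?wprod_gt0.
have k1 : (0 : R) < 1 by [].
have := integral_gauss_Rn n.+1 k1.
pose K (s : R) := (expR (- s ^+ 2))%:E.
have mK : measurable_fun [set: R] K.
  apply: measurableT_comp => //; apply: measurableT_comp => //.
  by apply: measurable_funN; exact: measurable_funX.
under eq_integral do rewrite expr1n mul1r -normV_sqr.
rewrite (ge0_integral_polar n mK); last by move=> s; rewrite lee_fin expR_ge0.
rewrite divr1 => HG.
transitivity (((n.+1%:R * wprod 1 n.+1)^-1)%:E * (\int[mu]_(s in `]0%R, +oo[) (K s * (n.+1%:R * wprod 1 n.+1 * s ^+ n)%:E)))%E.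
  rewrite -ge0_integralZl//; last 3 first.
  - apply: measurable_funTS; apply: emeasurable_funM => //; apply: measurableT_comp => //.
    by apply: measurable_funM => //; exact: measurable_funX.
  - move=> s; rewrite /= in_itv/= andbT => s0; rewrite mule_ge0// lee_fin ?expR_ge0//.
    by rewrite mulr_ge0 ?ltW// exprn_gt0.
  - by rewrite lee_fin invr_ge0 ltW.
  apply: eq_integral => s _; rewrite /K -!EFinM; congr EFin.
  by rewrite [RHS]mulrCA mulKf// gt_eqF.
by rewrite HG -EFinM mulrC.
Qed.

(** Euler's integral with [r = s^2] is twice a Gaussian moment. Positivity and the functional
    equation at half-integers are read off from this explicit form. *)
Lemma GammaE n : Gamma (n.+1%:R / 2) = 2 * Num.sqrt pi ^+ n.+1 / (n.+1%:R * wprod 1 n.+1) :> R.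
Proof.
have mGe : measurable_fun [set: R] (fun s : R => (s `^ (n.+1%:R / 2 - 1) * expR (- s))%:E).
  apply: measurableT_comp => //; apply: measurable_funM; first exact: measurable_powR.
  by apply: measurableT_comp => //.
have powE (s : R) : 0 < s -> (s ^+ 2) `^ (n.+1%:R / 2 - 1) * s = s ^+ n.
  move=> s0; rewrite -(powR_mulrn 2 (ltW s0)) -powRrM.
  rewrite (_ : 2%:R * (n.+1%:R / 2 - 1) = n%:R - 1 :> R); last first.
    by rewrite -natr1; field.
  rewrite -[X in _ * X](powRr1 (ltW s0)) -powRD; last by rewrite (gt_eqF s0) implybT.
  by rewrite subrK powR_mulrn// ltW.
have HE : (\int[mu]_(s in `]0%R, +oo[) (s `^ (n.+1%:R / 2 - 1) * expR (- s))%:E =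
   2%:E * \int[mu]_(s in `]0%R, +oo[) (expR (- s ^+ 2) * s ^+ n)%:E)%E.
  rewrite (ge0_integral_sqr_subst mGe); last first.
    by move=> x; rewrite lee_fin mulr_ge0 ?powR_ge0 ?expR_ge0.
  rewrite -ge0_integralZl//; last 2 first.
  - apply: measurable_funTS; apply: measurableT_comp => //.
    by apply: measurable_funM; [apply: measurableT_comp => //; apply: measurable_funN; exact: measurable_funX|exact: measurable_funX].
  - by move=> s; rewrite /= in_itv/= andbT => s0; rewrite lee_fin mulr_ge0 ?expR_ge0// exprn_ge0// ltW.
  apply: eq_integral => s; rewrite inE/= in_itv/= andbT => s0; rewrite -!EFinM; congr EFin.
  by rewrite -(powE s s0); ring.
by rewrite /Gamma /Rintegral HE integral_gauss_moment -EFinM/= mulrA.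
Qed.

Lemma Gamma_gt0 n : 0 < Gamma (n.+1%:R / 2) :> R.
Proof.
by rewrite GammaE divr_gt0// mulr_gt0// ?ltr0n// ?exprn_gt0 ?sqrtr_gt0 ?pi_gt0// wprod_gt0.
Qed.

(** By [wc_rec] the product [(j + 1) wc j wc (j + 1)] does not depend on [j]. *)
Lemma wc_mulS j : wc j * wc j.+1 = pi / 2 / j.+1%:R :> R.
Proof.
elim: j => [|j IH]; first by rewrite wc0 wc1 mulr1 divr1.
have j0 : j.+2%:R != 0 :> R by rewrite pnatr_eq0.
have j1 : j.+1%:R != 0 :> R by rewrite pnatr_eq0.
apply: (mulfI j0); rewrite mulrCA wc_rec mulrCA [wc j.+1 * _]mulrC IH.
by rewrite mulrC divfK// [RHS]mulrC divfK.
Qed.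

Lemma wprodS n : wprod 0 n = n.+1%:R * wprod 1 n.+1 / 2 :> R.
Proof.
elim: n => [|n IH].
  by rewrite /wprod big_ord0 big_ord1 addn0 wc1 mulr1 mul1r divff.
rewrite {1}/wprod big_ord_recr/= -/(wprod 0 n) IH.
rewrite [in RHS]/wprod big_ord_recr/= -/(wprod 1 n.+1) add0n !add1n.
have := @wc_rec R n; set a := wc n; set b := wc n.+2 => ab.
transitivity (wprod 1 n.+1 * (n.+1%:R * a)); first by field.
by rewrite -ab; field.
Qed.

Lemma Gamma_rec n : Gamma (n.+3%:R / 2) = n.+1%:R / 2 * Gamma (n.+1%:R / 2) :> R.
Proof.
rewrite !GammaE /wprod [in LHS]big_ord_recr/= big_ord_recr/= -/(wprod 1 n.+1) !add1n.
have W0 : wprod 1 n.+1 != 0 :> R by rewrite gt_eqF// wprod_gt0.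
have n1 : n.+1%:R != 0 :> R by rewrite pnatr_eq0.
have n3 : n.+3%:R != 0 :> R by rewrite pnatr_eq0.
have c0 : wc n.+2 != 0 :> R by rewrite gt_eqF// wc_gt0.
have c1 : wc n.+3 != 0 :> R by rewrite gt_eqF// wc_gt0.
have E : pi = Num.sqrt pi ^+ 2 :> R by rewrite sqr_sqrtr// pi_ge0.
have W : wc n.+3 = Num.sqrt pi ^+ 2 / 2 / n.+3%:R / wc n.+2 :> R.
  by rewrite -E -wc_mulS mulrC mulKf.
have s0 : Num.sqrt pi != 0 :> R by rewrite gt_eqF// sqrtr_gt0 pi_gt0.
rewrite W !exprS; field.
have n1' : 1 + n%:R != 0 :> R by rewrite addrC natr1.
have n3' : 3 + n%:R != 0 :> R by rewrite -natrD.
by rewrite s0 W0 n1' n3' c0.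
Qed.

End polar.

(** * The mean of cos (a / sin x) *)

Section laplace.
Context {R : realType}.
Local Notation mu := (@lebesgue_measure R).
Local Notation mR := (measurableTypeR R).
Local Notation J := (`]0%R, ((pi : R) / 2)%R[%classic).

Lemma continuous_inv (f : R -> R) : continuous f -> (forall x, f x != 0) ->
  continuous (fun x => (f x)^-1).
Proof. by move=> cf f0 x; apply: cvgV; [exact: f0|exact: cf]. Qed.

Lemma pihalf_ge0 : 0 <= (pi : R) / 2.
Proof. by rewrite divr_ge0// pi_ge0. Qed.

Lemma tonelli_restrict (D1 D2 : set R) (F : R * R -> \bar R) :
  measurable D1 -> measurable D2 -> measurable_fun [set: R * R] F ->
  (forall p, 0 <= F p)%E ->
  (\int[mu]_(x in D1) \int[mu]_(y in D2) F (x, y) =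
   \int[mu]_(y in D2) \int[mu]_(x in D1) F (x, y))%E.
Proof.
move=> m1 m2 mF F0; pose G := F \_ (D1 `*` D2).
have mG : measurable_fun [set: R * R] G.
  apply/(measurable_restrictT _ _).1; first exact: measurableX.
  exact: measurable_funTS.
have G0 p : (0 <= G p)%E by apply: erestrict_ge0.
have := tonelli_real mG G0.
have E1 x : (\int[mu]_y G (x, y) = ((fun x => \int[mu]_(y in D2) F (x, y)) \_ D1) x)%E.
  rewrite patchE; case: ifPn => xD.
    rewrite [RHS]integral_mkcond; apply: eq_integral => y _.
    by rewrite /G !patchE in_setX/= xD.
  by apply: integral0_eq => y _; rewrite /G patchE in_setX/= (negbTE xD).
have E2 y : (\int[mu]_x G (x, y) = ((fun y => \int[mu]_(x in D1) F (x, y)) \_ D2) y)%E.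
  rewrite patchE; case: ifPn => yD.
    rewrite [RHS]integral_mkcond; apply: eq_integral => x _.
    by rewrite /G !patchE in_setX/= yD andbT.
  by apply: integral0_eq => x _; rewrite /G patchE in_setX/= (negbTE yD) andbF.
under eq_integral do rewrite E1.
under [RHS]eq_integral do rewrite E2.
by rewrite -!integral_mkcond.
Qed.

(** The usual antiderivative atan (b tan x) is undefined at [pi / 2]. By the addition formula for
    atan it equals x + atan ((b - 1) sin x cos x / (cos^2 x + b sin^2 x)) before that point, and
    this expression is smooth everywhere, with value [pi / 2] at the right end. *)
Lemma integral_trig_kernel (b : R) : 0 < b ->
  (\int[mu]_(x in J) (b / (cos x ^+ 2 + b ^+ 2 * sin x ^+ 2))%:E = (pi / 2)%:E)%E.
Proof.
move=> b0.
pose D (x : R) := cos x ^+ 2 + b * sin x ^+ 2.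
pose E (x : R) := cos x ^+ 2 + b ^+ 2 * sin x ^+ 2.
have pos (e : R) x : 0 < e -> 0 < cos x ^+ 2 + e * sin x ^+ 2.
  move=> e0; have [s0|s0] := eqVneq (sin x) 0.
    by rewrite s0 expr0n mulr0 addr0 cos2sin2 s0 expr0n subr0.
  by rewrite ltr_wpDl ?sqr_ge0// mulr_gt0// lt_neqAle sqr_ge0 andbT eq_sym sqrf_eq0.
have D0 x : D x != 0 by rewrite gt_eqF// pos.
have E0 x : E x != 0 by rewrite gt_eqF// pos// exprn_gt0.
have cs := @continuous_sin R; have cc := @continuous_cos R.
have dN (x : R) : is_derive x (1 : R) (fun y => (b - 1) * (sin y * cos y))
    ((b - 1) * (cos x ^+ 2 - sin x ^+ 2)).
  apply: (is_derive_mul (is_derive_const _ x)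
    (is_derive_mul (is_derive_sin x) (is_derive_cos x) erefl)).
  by rewrite mulr0 addr0; congr (_ * _); ring.
have dD (x : R) : is_derive x (1 : R) D (2 * (b - 1) * (sin x * cos x)).
  apply: (is_derive_add (is_derive_pow (n := 2) (is_derive_cos x) erefl)
    (is_derive_mul (is_derive_const b x) (is_derive_pow (n := 2) (is_derive_sin x) erefl) erefl)).
  by rewrite /= !expr1; ring.
have dF (x : R) : is_derive x (1 : R)
    (fun y => y + atan ((b - 1) * (sin y * cos y) * (D y)^-1)) (b / E x).
  apply: (is_derive_add (is_derive_id x 1) (is_derive_chain (is_derive1_atan _)
    (is_derive_mul (dN x) (is_derive_inv (D0 x) (dD x) erefl) erefl) erefl)).
  have key : D x ^+ 2 + ((b - 1) * (sin x * cos x)) ^+ 2 = E x.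
    have := cos2sin2 x; rewrite /D /E; set c := cos x; set s := sin x => cs2.
    by rewrite !exprMn cs2; ring.
  have key2 : (b - 1) * (cos x ^+ 2 - sin x ^+ 2) * D x
      - (b - 1) * (sin x * cos x) * (2 * (b - 1) * (sin x * cos x)) =
      (b - 1) * (cos x ^+ 2 - b * sin x ^+ 2).
    have := cos2sin2 x; rewrite /D; set c := cos x; set s := sin x => cs2.
    transitivity ((b - 1) * (c ^+ 2 - s ^+ 2) * (c ^+ 2 + b * s ^+ 2)
      - 2 * (b - 1) ^+ 2 * s ^+ 2 * c ^+ 2); first by ring.
    by rewrite cs2; ring.
  have dx := D0 x; have ex := E0 x.
  have -> : (1 + ((b - 1) * (sin x * cos x) / D x) ^+ 2)^-1 = D x ^+ 2 / E x.
    by rewrite -key; field; rewrite key dx ex.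
  have -> : b / E x = 1 + (b - 1) * (cos x ^+ 2 - b * sin x ^+ 2) / E x.
    apply: (mulIf ex); rewrite mulrDl !mulfVK// mul1r /E.
    by have := cos2sin2 x; set c := cos x; set s := sin x => cs2; rewrite cs2; ring.
  by rewrite -key2; field; rewrite dx ex.
have cE : continuous (fun x => b / E x).
  apply: continuous_mul; first exact: continuous_const.
  apply: continuous_inv E0; apply: continuous_add; first exact: continuous_pow.
  by apply: continuous_mul; [exact: continuous_const|exact: continuous_pow].
rewrite (integral_FTCoo pihalf_ge0 dF cE).
by rewrite cos_pihalf sin0 mul0r !mulr0 !mul0r !atan0 !addr0 subr0.
Qed.

Lemma integral_oneD_sqr_sin (l : R) : 0 < l ->
  (\int[mu]_(x in J) (1 + l ^+ 2 * sin x ^+ 2)^-1%:E =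
   (pi / 2 / Num.sqrt (1 + l ^+ 2))%:E)%E.
Proof.
move=> l0; set b := Num.sqrt _.
have l1 : 0 < 1 + l ^+ 2 by rewrite addr_gt0// exprn_gt0.
have b0 : 0 < b by rewrite sqrtr_gt0.
have b2 : b ^+ 2 = 1 + l ^+ 2 by rewrite sqr_sqrtr// ltW.
have EE x : cos x ^+ 2 + b ^+ 2 * sin x ^+ 2 = 1 + l ^+ 2 * sin x ^+ 2.
  by rewrite b2 cos2sin2; ring.
have pos x : 0 < 1 + l ^+ 2 * sin x ^+ 2 by rewrite ltr_pwDl// mulr_ge0// sqr_ge0.
have := integral_trig_kernel b0; under eq_integral do rewrite EE.
move=> /(congr1 (fun z => (b^-1)%:E * z)%E).
rewrite -ge0_integralZl//.
- rewrite -EFinM [b^-1 * _]mulrC => <-; apply: eq_integral => x _.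
  by rewrite -EFinM; congr EFin; rewrite mulKf// gt_eqF.
- apply: measurable_funTS; apply: measurableT_comp => //.
  apply: continuous_measurable_fun; apply: continuous_mul; first exact: continuous_const.
  apply: continuous_inv; last by move=> x; rewrite gt_eqF.
  apply: continuous_add; first exact: continuous_const.
  apply: continuous_mul; [exact: continuous_const|apply: continuous_pow; exact: continuous_sin].
- by move=> x _; rewrite lee_fin divr_ge0// ltW.
- by rewrite lee_fin invr_ge0 ltW.
Qed.

Lemma integral_sqrD_sqr_sin (l : R) : 0 < l ->
  (\int[mu]_(x in J) (l ^+ 2 + sin x ^+ 2)^-1%:E =
   (pi / 2 / Num.sqrt (1 + l ^+ 2) / l)%:E)%E.
Proof.
move=> l0; have Vl0 : 0 < l^-1 by rewrite invr_gt0.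
have ln0 : l != 0 by rewrite gt_eqF.
have pos x : 0 < 1 + l^-1 ^+ 2 * sin x ^+ 2 by rewrite ltr_pwDl// mulr_ge0// sqr_ge0.
have E x : (l ^+ 2 + sin x ^+ 2)^-1 = (l ^+ 2)^-1 * (1 + l^-1 ^+ 2 * sin x ^+ 2)^-1.
  by rewrite -invfM mulrDr mulr1 mulrA -exprMn divff// expr1n mul1r.
under eq_integral do rewrite E EFinM.
rewrite ge0_integralZl//.
- rewrite integral_oneD_sqr_sin// -EFinM; congr (_%:E).
  have -> : 1 + l ^+ 2 = l ^+ 2 * (1 + l^-1 ^+ 2).
    by rewrite mulrDr mulr1 -exprMn divff// expr1n addrC.
  rewrite sqrtrM ?sqr_ge0// sqrtr_sqr gtr0_norm//.
  have : 0 < Num.sqrt (1 + l^-1 ^+ 2) by rewrite sqrtr_gt0 addr_gt0// exprn_gt0.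
  by set z := Num.sqrt _ => z0; field; rewrite ln0 gt_eqF.
- apply: measurable_funTS; apply: measurableT_comp => //.
  apply: continuous_measurable_fun.
  apply: continuous_inv; last by move=> x; rewrite gt_eqF.
  apply: continuous_add; first exact: continuous_const.
  apply: continuous_mul; [exact: continuous_const|apply: continuous_pow; exact: continuous_sin].
- by move=> x _; rewrite lee_fin invr_ge0 ltW.
- by rewrite lee_fin invr_ge0 sqr_ge0.
Qed.

(** The exponential bound makes the antiderivative vanish at infinity, so that only its value at 0
    is left. *)
Lemma integral_exp_FTCy (l C : R) (f F : R -> R) : 0 < l ->
  (forall x, 0 <= x -> 0 <= f x) -> continuous f ->
  (forall x : R, is_derive x (1 : R) F (f x)) ->
  (forall x, 0 <= x -> `|F x| <= C * expR (- (l * x))) ->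
  (\int[mu]_(x in `]0%R, +oo[) (f x)%:E = (- F 0)%:E)%E.
Proof.
move=> l0 f0 cf dF FC.
have cF : continuous F.
  by move=> x; apply/differentiable_continuous/derivable1_diffP; have [] := dF x.
have F0 : F x @[x --> +oo%R] --> (0 : R).
  apply: norm_cvg0.
  have e0 : C * expR (- (l * x)) @[x --> +oo%R] --> C * (0 : R).
    apply: cvgM; first exact: cvg_cst.
    apply: (cvg_comp (fun x => l * x) (fun x => expR (- x))); last exact: cvgr_expR.
    exact: gt0_cvgMry.
  rewrite mulr0 in e0.
  apply: (@squeeze_cvgr _ _ _ _ (cst 0) (fun x => C * expR (- (l * x)))) => //.
    near=> x; rewrite normr_ge0/=; apply: FC; near: x; exact: nbhs_pinfty_ge.
  exact: cvg_cst.
have mf : measurable_fun (`]0%R, +oo[%classic : set R) (EFin \o f).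
  apply: measurable_funTS; apply: measurableT_comp => //; exact: continuous_measurable_fun.
rewrite (integral_itv_obnd_cbnd mf) (@ge0_continuous_FTC2y R f F 0 0)//.
- by rewrite EFinN sub0e.
- exact: continuous_subspaceT.
- exact/cvg_at_right_filter/cF.
- by move=> x _; rewrite derive1E; apply: derive_val.
Unshelve. all: by end_near. Qed.

End laplace.

Section integrable_real.
Context d (T : measurableType d) {R : realType} (mu : {measure set T -> \bar R}).
Variables (D : set T) (mD : measurable D).
Implicit Types f g : T -> R.

Lemma integrable_realZ f (k : R) : mu.-integrable D (EFin \o f) ->
  mu.-integrable D (EFin \o (fun x => k * f x)).
Proof.
move=> h; have := integrableZl mD k h.
by apply: eq_integrable => // x _; rewrite /= EFinM.
Qed.

Lemma integrable_realD f g : mu.-integrable D (EFin \o f) -> mu.-integrable D (EFin \o g) ->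
  mu.-integrable D (EFin \o (fun x => f x + g x)).
Proof.
move=> hf hg; have := integrableD mD hf hg.
by apply: eq_integrable => // x _; rewrite /= EFinD.
Qed.

Lemma integrable_realB f g : mu.-integrable D (EFin \o f) -> mu.-integrable D (EFin \o g) ->
  mu.-integrable D (EFin \o (fun x => f x - g x)).
Proof.
move=> hf hg; have := integrableB mD hf hg.
by apply: eq_integrable => // x _; rewrite /= EFinB.
Qed.

Lemma integrable_realM f g (C : R) : mu.-integrable D (EFin \o f) ->
  measurable_fun D g -> (forall x, D x -> `|g x| <= C) ->
  mu.-integrable D (EFin \o (fun x => f x * g x)).
Proof.
move=> hf mg gC; apply: (@le_integrable _ _ _ mu D _ _ (EFin \o (fun x => C * f x))) => //.
- apply/measurable_EFinP; apply: measurable_funM => //.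
  by apply/measurable_EFinP; exact: measurable_int hf.
- move=> x Dx; rewrite /= lee_fin !normrM mulrC ler_wpM2r//.
  by rewrite (le_trans (gC x Dx))// ler_norm.
- exact: integrable_realZ.
Qed.

Lemma integrable_bounded f (C : R) : (mu D < +oo)%E -> measurable_fun D f ->
  (forall x, D x -> `|f x| <= C) -> mu.-integrable D (EFin \o f).
Proof.
move=> Doo mf fC.
have h1 : mu.-integrable D (EFin \o (fun=> 1 : R)).
  apply/integrableP; split; first exact: measurable_cst.
  by under eq_integral do rewrite /= normr1; rewrite integral_cst// mul1e.

by have := integrable_realM h1 mf fC; under eq_fun do rewrite mul1r.
Qed.

End integrable_real.

(** * Injectivity of the Laplace transform, sampled at the positive integers *)

Section laplace_injective.
Context {R : realType}.
Local Notation mu := (@lebesgue_measure R).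
Local Notation mR := (measurableTypeR R).
Local Notation H := (`]0%R, +oo[%classic : set R).

Let mH : measurable (H : set mR). Proof. exact: measurable_itv. Qed.

(** If all moments in [exp (-x)] vanish, so do the integrals against powers of a quadratic in
    [exp (-x)], the polynomials from which [laplace_injective_pos] builds its peak. The extra factor
    [expR (- x) ^+ k] carries the induction on [n]. *)
Lemma integral_moment_pow (D : R -> R) (a b c : R) :
  mu.-integrable H (EFin \o D) ->
  (forall k, (\int[mu]_(x in H) (D x * expR (- x) ^+ k))%R = 0) ->
  forall n k, (\int[mu]_(x in H) (D x * (expR (- x) ^+ k *
    (a + b * expR (- x) + c * expR (- x) ^+ 2) ^+ n)))%R = 0.
Proof.
move=> iD D0; elim=> [|n IH] k.
  by under eq_Rintegral do rewrite expr0 mulr1; exact: D0.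
pose q x := a + b * expR (- x) + c * expR (- x) ^+ 2.
have cexp : continuous (fun x : R => expR (- x)).
  by move=> x; apply: continuous_comp; [exact: opp_continuous|exact: continuous_expR].
have cq : continuous q.
  apply: continuous_add; [apply: continuous_add; first exact: continuous_const|].
    by apply: continuous_mul; [exact: continuous_const|].
  by apply: continuous_mul; [exact: continuous_const|exact: continuous_pow].
have e1 (x : R) : 0 < x -> `|expR (- x)| <= 1.
  by move=> x0; rewrite ger0_norm ?expR_ge0// -expR0 ler_expR oppr_le0 ltW.
have qb (x : R) : 0 < x -> `|q x| <= `|a| + `|b| + `|c|.
  move=> x0; rewrite (le_trans (ler_normD _ _))// lerD//.
    rewrite (le_trans (ler_normD _ _))// lerD// normrM ler_piMr//; exact: e1.
  by rewrite normrM ler_piMr// normrX exprn_ile1//; exact: e1.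
have iDk m : mu.-integrable H (EFin \o (fun x => D x * (expR (- x) ^+ m * q x ^+ n))).
  apply: (integrable_realM (C := (`|a| + `|b| + `|c|) ^+ n) mH iD).
    apply: measurable_funTS; apply: continuous_measurable_fun.
    by apply: continuous_mul; exact: continuous_pow.
  move=> x; rewrite /= in_itv/= andbT => x0; rewrite normrM -[leRHS]mul1r ler_pM//.
    by rewrite normrX exprn_ile1//; exact: e1.
  by rewrite normrX lerXn2r ?nnegrE ?normr_ge0// ?qb// !addr_ge0.
transitivity (a * (\int[mu]_(x in H) (D x * (expR (- x) ^+ k * q x ^+ n))) +
   b * (\int[mu]_(x in H) (D x * (expR (- x) ^+ k.+1 * q x ^+ n))) +
   c * (\int[mu]_(x in H) (D x * (expR (- x) ^+ k.+2 * q x ^+ n))))%R.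
  rewrite -!RintegralZl//; try exact: iDk.
  have iZ m (l : R) := integrable_realZ mH l (iDk m).
  rewrite -RintegralD; [|exact: mH|exact: iZ|exact: iZ].
  rewrite -RintegralD; [|exact: mH|exact: (integrable_realD mH (iZ _ _) (iZ _ _))|exact: iZ].
  by apply: eq_Rintegral => x _; rewrite /q !exprS; ring.
by rewrite !IH !mulr0 !addr0.
Qed.

(** If [D x0 > 0], take a quadratic in [exp (-x)] that exceeds 1 near [x0] and has absolute value at
    most 1 away from it. The integral of [D] against its [n]-th power is 0, yet the part near [x0]
    grows like [(1 + h)^n] while the rest stays above minus the integral of [|D|]. *)
Lemma laplace_injective_pos (D : R -> R) (x0 : R) : 0 < x0 ->
  mu.-integrable H (EFin \o D) -> {for x0, continuous D} ->
  (forall k, (\int[mu]_(x in H) (D x * expR (- x) ^+ k))%R = 0) -> D x0 <= 0.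
Proof.
move=> x0_gt0 iD cD D0; rewrite leNgt; apply/negP => Dx0.
pose e x : R := expR (- x).
have cexp : continuous e.
  by move=> x; apply: continuous_comp; [exact: opp_continuous|exact: continuous_expR].
pose d := D x0 / 2; have d0 : 0 < d by rewrite divr_gt0.
have [r r0 rD] : exists2 r : R, 0 < r & forall x, `|x0 - x| < r -> d < D x.
  have /cvgrPdist_lt /(_ _ d0) [r /= r0 rP] := cD.
  exists r => // x /rP; rewrite ltr_norml => /andP[_].
  by rewrite /d; lra.
(* As [e] is decreasing, a value within [rho] of [e x0] can only be taken within [r] of [x0], where
   [D > d]. *)
pose rho := Num.min (e x0 - e (x0 + r)) (e (x0 - r) - e x0).
have rho0 : 0 < rho.
  rewrite lt_min !subr_gt0 !ltr_expR; apply/andP; split; lra.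
have rho_lt1 : rho < 1.
  rewrite gt_min; apply/orP; left.
  have : e x0 < 1 by rewrite -expR0 ltr_expR; lra.
  by have := expR_gt0 (- (x0 + r)); rewrite -/(e _); lra.
have far x : `|e x - e x0| < rho -> d < D x.
  rewrite lt_min => /andP[h1 h2]; apply: rD.
  rewrite ltr_norml; apply/andP; split.
    rewrite ltrNl opprB ltrBlDr addrC -ltrN2 -ltr_expR -/(e (x0 + r)) -/(e x).
    by have := ler_norm (e x0 - e x); rewrite distrC; lra.
  rewrite ltrBlDr -ltrBlDl -ltrN2 -ltr_expR -/(e (x0 - r)) -/(e x).
  by have := ler_norm (e x - e x0); lra.
have rho20 : 0 < rho / 2 by rewrite divr_gt0.
have [k k0 kP] : exists2 k : R, 0 < k & forall x, `|x0 - x| < k -> `|e x0 - e x| < rho / 2.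
  by have /cvgrPdist_lt /(_ _ rho20) [k /= k0 kP] := cexp x0; exists k.
(* The quadratic is [1 + rho^2 / 2 - (e x - e x0)^2]: positive where [|e x - e x0| < rho], at least
   [1 + rho^2 / 4] on half that distance, and of absolute value at most 1 beyond [rho], because [e]
   takes its values in []0, 1[]. *)
pose a := 1 + rho ^+ 2 / 2 - e x0 ^+ 2.
pose q x := a + (2 * e x0) * expR (- x) + (-1) * expR (- x) ^+ 2.
have qE x : q x = 1 + rho ^+ 2 / 2 - (e x - e x0) ^+ 2.
  by rewrite /q /a -/(e x); ring.
have Dq n : (\int[mu]_(x in H) (D x * q x ^+ n))%R = 0.
  have := integral_moment_pow a (2 * e x0) (-1) iD D0 n 0%N.
  by under eq_Rintegral do rewrite expr0 mul1r.
have e01 x : 0 < x -> 0 < e x < 1.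
  by move=> x_gt0; rewrite expR_gt0 /= -expR0 ltr_expR; lra.
have qnorm x : 0 < x -> rho <= `|e x - e x0| -> `|q x| <= 1.
  move=> x_gt0 h; have := e01 x x_gt0; have := e01 x0 x0_gt0.
  have h2 : rho ^+ 2 <= (e x - e x0) ^+ 2 by rewrite -[leRHS]real_normK ?num_real// ler_sqr ?nnegrE// ltW.
  have r2 : 0 < rho ^+ 2 by rewrite exprn_gt0.
  have r21 : rho ^+ 2 < 1 by rewrite -[ltRHS](expr1n _ 2) ltr_sqr ?nnegrE ?ltW.
  move=> /andP[u1 u2] /andP[v1 v2].
  have h3 : (e x - e x0) ^+ 2 <= 1.
    by rewrite -[leLHS]real_normK ?num_real// expr_le1// ler_norml; lra.
  by rewrite qE ler_norml; lra.
have qpos x : `|e x - e x0| < rho -> 0 < q x.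
  move=> h; have h2 : (e x - e x0) ^+ 2 < rho ^+ 2.
    by rewrite -[ltLHS]real_normK ?num_real// ltr_sqr ?nnegrE// ltW.
  have r21 : rho ^+ 2 < 1 by rewrite -[ltRHS](expr1n _ 2) ltr_sqr ?nnegrE ?ltW.
  by rewrite qE; lra.
pose h := rho ^+ 2 / 4; have h0 : 0 < h by rewrite divr_gt0// exprn_gt0.
have qbig x : `|e x - e x0| < rho / 2 -> 1 + h <= q x.
  move=> hx; have h2 : (e x - e x0) ^+ 2 < (rho / 2) ^+ 2.
    by rewrite -[ltLHS]real_normK ?num_real// ltr_sqr ?nnegrE// ltW.
  have h3 : (rho / 2) ^+ 2 = h by rewrite /h; field.
  by rewrite qE; move: h2; rewrite h3 /h; lra.
have cq : continuous q.
  apply: continuous_add; [apply: continuous_add; first exact: continuous_const|].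
    by apply: continuous_mul; [exact: continuous_const|exact: cexp].
  by apply: continuous_mul; [exact: continuous_const|apply: continuous_pow; exact: cexp].
have mD : measurable_fun H D by apply/measurable_EFinP; exact: measurable_int iD.
have mq n : measurable_fun H (fun x => q x ^+ n).
  by apply: measurable_funTS; apply: continuous_measurable_fun; exact: continuous_pow.
have qbound x : 0 < x -> `|q x| <= 2.
  move=> x_gt0; have := e01 x x_gt0; have := e01 x0 x0_gt0.
  have r21 : rho ^+ 2 < 1 by rewrite -[ltRHS](expr1n _ 2) ltr_sqr ?nnegrE ?ltW.
  have r2 : 0 < rho ^+ 2 by rewrite exprn_gt0.
  move=> /andP[u1 u2] /andP[v1 v2].
  have h3 : (e x - e x0) ^+ 2 <= 1.
    by rewrite -[leLHS]real_normK ?num_real// expr_le1// ler_norml; lra.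
  have h4 : 0 <= (e x - e x0) ^+ 2 by exact: sqr_ge0.
  by rewrite qE ler_norml; lra.
have iDq n : mu.-integrable H (EFin \o (fun x => D x * q x ^+ n)).
  apply: (integrable_realM (C := 2 ^+ n) mH iD (mq n)).
  move=> x; rewrite /= in_itv/= andbT => x_gt0; rewrite normrX.
  by rewrite lerXn2r ?nnegrE ?normr_ge0// qbound.
have inD : mu.-integrable H (EFin \o (fun x => `|D x|)) by exact: integrable_norm.
have G0 n x : 0 < x -> 0 <= D x * q x ^+ n + `|D x|.
  move=> x_gt0; have [hx|hx] := ltP `|e x - e x0| rho.
    by rewrite addr_ge0// mulr_ge0// ?exprn_ge0// ltW ?qpos// (lt_trans d0)// far.
  have : `|D x * q x ^+ n| <= `|D x|.
    by rewrite normrM normrX ler_piMr// exprn_ile1// qnorm.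
  by rewrite ler_norml => /andP[]; rewrite -lerBlDr sub0r.
pose I := (\int[mu]_(x in H) `|D x|)%R.
have mG n : measurable_fun H (fun x => D x * q x ^+ n + `|D x|).
  by apply: measurable_funD; [exact: (measurable_funM mD (mq n))|exact: measurableT_comp].
(* Adding [|D|] makes the integrand nonnegative, and the other term integrates to 0. So [I] is the
   integral of [D q^n + |D|] for every [n], bounded below by the part over []x0, x0 + k[]. *)
have bnd n : d * (1 + h) ^+ n * k <= I.
  have N : (`]x0, (x0 + k)%R[%classic `<=` H).
    by move=> x /=; rewrite !in_itv/= andbT => /andP[/(lt_trans x0_gt0)].
  rewrite -lee_fin.
  have -> : (d * (1 + h) ^+ n * k)%:E = (\int[mu]_(x in `]x0, (x0 + k)%R[) (d * (1 + h) ^+ n)%:E)%E.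
    rewrite integral_cst//= lebesgue_measure_itv/= lte_fin ltrDl k0 -EFinB -EFinM.
    by congr (_ * _)%:E; ring.
  have -> : I%:E = (\int[mu]_(x in H) (D x * q x ^+ n + `|D x|)%:E)%E.
    rewrite -[RHS]fineK; last by apply: integrable_fin_num => //; exact: (integrable_realD mH (iDq n) inD).
    congr EFin; transitivity (\int[mu]_(x in H) (D x * q x ^+ n + `|D x|))%R; last by [].
    by rewrite RintegralD// Dq add0r.
  apply: (@le_trans _ _ (\int[mu]_(x in `]x0, (x0 + k)%R[) (D x * q x ^+ n + `|D x|)%:E)%E).
    apply: ge0_le_integral => //.
    - by move=> x _; rewrite lee_fin !mulr_ge0 ?exprn_ge0 ?addr_ge0 ?ltW.
    - by apply/measurable_EFinP; exact: measurable_funS (mG n).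
    - move=> x /=; rewrite in_itv/= => /andP[xl xr].
      have hk : `|x0 - x| < k by rewrite ltr_norml; lra.
      have hq : `|e x - e x0| < rho / 2 by rewrite distrC; exact: kP.
      have dD : d < D x by apply: far; lra.
      have h1 : 0 <= 1 + h by rewrite addr_ge0// ltW.
      rewrite lee_fin -[leLHS]addr0 lerD//; apply: ler_pM.
      + exact: ltW.
      + exact: exprn_ge0.
      + exact: ltW.
      + by rewrite lerXn2r ?nnegrE ?qbig// (le_trans _ (qbig _ hq)).
  apply: ge0_subset_integral => //.
    by apply/measurable_EFinP; exact: mG.
  by move=> x; rewrite /= in_itv/= andbT => x_gt0; rewrite lee_fin G0.
have bern n : 1 + n%:R * h <= (1 + h) ^+ n.
  elim: n => [|n IH]; first by rewrite mul0r addr0 expr0.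
  rewrite exprS -natr1; apply: (@le_trans _ _ ((1 + h) * (1 + n%:R * h))).
    have : 0 <= n%:R * h * h by rewrite !mulr_ge0// ltW.
    by lra.
  by rewrite ler_wpM2l// addr_ge0// ltW.
have dhk : 0 < d * h * k by rewrite !mulr_gt0.
have I0 : 0 <= I by apply: Rintegral_ge0.
have := archi_boundP (divr_ge0 I0 (ltW dhk)); set n := Num.bound _ => hn.
have := bnd n; rewrite leNgt => /negP; apply.
apply: (@lt_le_trans _ _ (d * (n%:R * h) * k)).
  by rewrite ltr_pdivrMr// in hn; rewrite (lt_le_trans hn)//; lra.
rewrite ler_wpM2r ?(ltW k0)// ler_wpM2l ?(ltW d0)//.
by rewrite (le_trans _ (bern n))// lerDr.
Qed.

(** The transform at [k + 1] is the [k]-th moment in [exp (-x)] of [exp (-x) f]. Hence all moments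
    of [D = exp (-x) (f - g)] vanish, and [D] is integrable because the transforms at 1 are finite.
    The one-sided lemma is applied to [D] and to [- D]. *)
Lemma laplace_injective (f g : R -> R) :
  (forall x : R, 0 < x -> 0 <= f x) -> (forall x : R, 0 < x -> 0 <= g x) ->
  measurable_fun H f -> measurable_fun H g ->
  (forall x : R, 0 < x -> {for x, continuous f}) -> (forall x : R, 0 < x -> {for x, continuous g}) ->
  (forall k, (\int[mu]_(x in H) (expR (- (k.+1%:R * x)) * f x)%:E < +oo)%E) ->
  (forall k, \int[mu]_(x in H) (expR (- (k.+1%:R * x)) * f x)%:E =
    \int[mu]_(x in H) (expR (- (k.+1%:R * x)) * g x)%:E)%E ->
  forall x, 0 < x -> f x = g x.
Proof.
move=> f0 g0 mf mg cf cg foo fg x x_gt0.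
have cexp : continuous (fun x : R => expR (- x)).
  by move=> y; apply: continuous_comp; [exact: opp_continuous|exact: continuous_expR].
have mE k : measurable_fun H (fun x : R => expR (- (k.+1%:R * x))).
  apply: measurable_funTS; apply: measurableT_comp => //.
  by apply: measurable_funN; exact: measurable_funM.
have ih (h : R -> R) k : (forall x : R, 0 < x -> 0 <= h x) -> measurable_fun H h ->
    (\int[mu]_(x in H) (expR (- (k.+1%:R * x)) * h x)%:E < +oo)%E ->
    mu.-integrable H (EFin \o (fun x => expR (- (k.+1%:R * x)) * h x)).
  move=> h0 mh hoo; apply/integrableP; split.
    by apply/measurable_EFinP; exact: (measurable_funM (mE k) mh).
  apply: le_lt_trans hoo; apply: ge0_le_integral => //.
  - by apply/measurable_EFinP; apply: measurableT_comp => //; exact: (measurable_funM (mE k) mh).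
  - by apply/measurable_EFinP; exact: (measurable_funM (mE k) mh).
  - move=> y; rewrite /= in_itv/= andbT => y0.
    by rewrite lee_fin ger0_norm// mulr_ge0 ?expR_ge0// h0.
have goo k : (\int[mu]_(x in H) (expR (- (k.+1%:R * x)) * g x)%:E < +oo)%E by rewrite -fg.
have ifk k := ih f k f0 mf (foo k).
have igk k := ih g k g0 mg (goo k).
pose D y := expR (- y) * (f y - g y).
have DE k y : D y * expR (- y) ^+ k =
    expR (- (k.+1%:R * y)) * f y - expR (- (k.+1%:R * y)) * g y.
  rewrite -mulrN expRM_natl /D exprS; ring.
have D0 k : (\int[mu]_(y in H) (D y * expR (- y) ^+ k))%R = 0.
  under eq_Rintegral do rewrite DE.
  by rewrite RintegralB// /Rintegral fg subrr.
have iD : mu.-integrable H (EFin \o D).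
  have := integrable_realB mH (ifk 0%N) (igk 0%N).
  by apply: eq_integrable => // y _ /=; rewrite -(DE 0%N) expr0 mulr1.
have cD y : 0 < y -> {for y, continuous D}.
  by move=> y0; apply: cvgM; [exact: cexp|apply: cvgB; [exact: cf|exact: cg]].
have le0 := laplace_injective_pos x_gt0 iD (cD x x_gt0) D0.
have ge0 : 0 <= D x.
  rewrite -oppr_le0; apply: (@laplace_injective_pos (fun y => - D y)) => //.
  - have := integrable_realZ mH (-1) iD.
    by apply: eq_integrable => // y _ /=; rewrite mulN1r.
  - by apply: cvgN; exact: cD.
  - move=> k; under eq_Rintegral do rewrite mulNr -mulN1r.
    rewrite RintegralZl ?D0 ?mulr0//.
    have := integrable_realB mH (ifk k) (igk k).
    by apply: eq_integrable => // y _ /=; rewrite -DE.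
have /eqP : D x = 0 by apply/eqP; rewrite eq_le le0 ge0.
by rewrite mulf_eq0 gt_eqF ?expR_gt0//= subr_eq0 => /eqP.
Qed.

End laplace_injective.

(** * The identity between the means of cos (a / sin x) and sin (a sin x) / sin x *)

Section sine_average.
Context {R : realType}.
Local Notation mu := (@lebesgue_measure R).
Local Notation mR := (measurableTypeR R).
Local Notation H := (`]0%R, +oo[%classic : set R).
Local Notation J := (`]0%R, ((pi : R) / 2)%R[%classic : set R).

Let mH : measurable (H : set mR). Proof. exact: measurable_itv. Qed.
Let mJ : measurable (J : set mR). Proof. exact: measurable_itv. Qed.

Lemma derive_continuous (f f' : R -> R) :
  (forall x : R, is_derive x (1 : R) f (f' x)) -> continuous f.
Proof. by move=> df x; apply/differentiable_continuous/derivable1_diffP; have [] := df x. Qed.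

(** Half of the exponent absorbs the linear growth, by [1 + y <= exp y] at [y = l x / 2]. *)
Lemma linear_expR_le (l C k x : R) : 0 < l -> 0 <= C -> 0 <= k -> 0 <= x ->
  expR (- (l * x)) * (C + k * x) <= (C + 2 * k / l) * expR (- (l / 2 * x)).
Proof.
move=> l0 C0 k0 x0; have ln : l != 0 by rewrite gt_eqF.
have y0 : 0 <= l / 2 * x by rewrite mulr_ge0// divr_ge0// ltW.
have -> : expR (- (l / 2 * x)) = expR (- (l * x)) * expR (l / 2 * x).
  by rewrite -expRD; congr expR; field.
rewrite mulrCA ler_wpM2l ?expR_ge0// mulrDl lerD//.
  by rewrite ler_peMr// (le_trans _ (expR_ge1Dx _))// lerDl.
have -> : k * x = 2 * k / l * (l / 2 * x) by field.
rewrite ler_wpM2l//; first by rewrite divr_ge0// ?mulr_ge0// ltW.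
by rewrite (le_trans _ (expR_ge1Dx _))// lerDr.
Qed.

Lemma sinJ_gt0 (x : R) : J x -> 0 < sin x.
Proof. by rewrite /= in_itv/= => x01; exact: sin_gt0_pihalf. Qed.

Lemma cosJ_gt0 (x : R) : J x -> 0 < cos x.
Proof.
rewrite /= in_itv/= => /andP[x0 x1].
by rewrite cos_gt0_pihalf// x1 andbT (lt_trans _ x0)// oppr_lt0 divr_gt0// pi_gt0.
Qed.

(** [y + sin y] and [y - sin y] vanish at 0 and have nonnegative derivatives. *)
Lemma normr_sin_le (x : R) : `|sin x| <= `|x|.
Proof.
have FTC (e y : R) : `|e| = 1 -> 0 <= y -> 0 <= y + e * sin y.
  move=> e1 y0; have dF (z : R) : is_derive z (1 : R) (fun w => w + e * sin w) (1 + e * cos z).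
    apply: (is_derive_add (is_derive_id z 1) (is_derive_mul (is_derive_const e z) (is_derive_sin z) erefl)).
    by rewrite mulr0 addr0.
  have cF : continuous (fun z : R => 1 + e * cos z).
    apply: continuous_add; first exact: continuous_const.
    by apply: continuous_mul; [exact: continuous_const|exact: continuous_cos].
  have := integral_FTC y0 dF cF; rewrite sin0 mulr0 addr0 subr0 -lee_fin => <-.
  apply: integral_ge0 => z _; rewrite lee_fin.
  have : `|e * cos z| <= 1 by rewrite normrM e1 mul1r cos_max.
  by rewrite ler_norml; lra.
have pos (y : R) : 0 <= y -> `|sin y| <= y.
  move=> y0; have := FTC 1 y (normr1 _) y0; have := FTC (-1) y (normrN1 _) y0.
  by rewrite ler_norml; lra.
have [x0|x0] := leP 0 x; first by rewrite (ger0_norm x0) pos.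
by rewrite (ltr0_norm x0) -normrN -sinN pos// oppr_ge0 ltW.
Qed.

(** The means of [cos (a / s)] and [sin (a * s) / s] over [s = sin x] are to be compared. The terms
    [1] and [a] make the kernel nonnegative for [a >= 0], as Tonelli and [laplace_injective]
    require. *)
Definition sine_kernel (s a : R) : R := 1 + cos (a / s) + a + sin (a * s) / s.

Lemma sine_kernel_ge0 (s a : R) : 0 < s -> 0 <= a -> 0 <= sine_kernel s a <= 2 + 2 * a.
Proof.
move=> s0 a0; have := cos_max (a / s); have := normr_sin_le (a * s).
rewrite normrM (ger0_norm a0) (gtr0_norm s0) !ler_norml.
move=> /andP[s1 s2] /andP[c1 c2].
have h1 : - a <= sin (a * s) / s by rewrite ler_pdivlMr// mulNr.
have h2 : sin (a * s) / s <= a by rewrite ler_pdivrMr.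
by rewrite /sine_kernel; lra.
Qed.

(** An explicit antiderivative is [- exp (- l a) u a], where [u] is an affine function plus
    trigonometric terms. The four terms of the result are the transforms of [1], [a], [cos (a / s)]
    and [sin (a s) / s], in this order. *)
Lemma laplace_sine_kernel (l s : R) : 0 < l -> 0 < s ->
  (\int[mu]_(a in H) (expR (- (l * a)) * sine_kernel s a)%:E =
   (l^-1 + l^-1 ^+ 2 + l^-1 * (1 - (1 + l ^+ 2 * s ^+ 2)^-1) + (l ^+ 2 + s ^+ 2)^-1)%:E)%E.
Proof.
move=> l0 s0.
have ln : l != 0 by rewrite gt_eqF.
have sn : s != 0 by rewrite gt_eqF.
have p1 : 1 + l ^+ 2 * s ^+ 2 != 0 by rewrite gt_eqF// ltr_pwDl// mulr_ge0// sqr_ge0.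
have p2 : l ^+ 2 + s ^+ 2 != 0 by rewrite gt_eqF// addr_gt0// exprn_gt0.
pose q1 := (1 + l ^+ 2 * s ^+ 2)^-1; pose q2 := (l ^+ 2 + s ^+ 2)^-1.
have q1E : q1 * (1 + l ^+ 2 * s ^+ 2) = 1 by rewrite mulVf.
have q2E : q2 * (l ^+ 2 + s ^+ 2) = 1 by rewrite mulVf.
(* The two inverses become unknowns tied by [q1E] and [q2E], so that the identities below are
   polynomial in them. *)
rewrite -/q1 -/q2; move: q1 q2 q1E q2E => q1 q2 q1E q2E.
pose u a := l^-1 + (l^-1 * a + l^-1 ^+ 2) +
  ((l * s ^+ 2 * cos (s^-1 * a) - s * sin (s^-1 * a)) * q1 +
   (l * s^-1 * sin (s * a) + cos (s * a)) * q2).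
pose u' a := l^-1 +
  ((- (l * s) * sin (s^-1 * a) - cos (s^-1 * a)) * q1 +
   (l * cos (s * a) - s * sin (s * a)) * q2).
have dsin (k x : R) : is_derive x (1 : R) (fun a => sin (k * a)) (k * cos (k * x)).
  by apply: (is_derive_chain (is_derive_sin _) (is_derive_linear k x)); rewrite mulrC.
have dcos (k x : R) : is_derive x (1 : R) (fun a => cos (k * a)) (- k * sin (k * x)).
  by apply: (is_derive_chain (is_derive_cos _) (is_derive_linear k x)); ring.
have dZ (k x : R) (f : R -> R) f' : is_derive x (1 : R) f f' ->
    is_derive x (1 : R) (fun a => k * f a) (k * f').
  by move=> df; apply: (is_derive_mul (is_derive_const k x) df); rewrite mulr0 addr0.
have dZr (k x : R) (f : R -> R) f' : is_derive x (1 : R) f f' ->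
    is_derive x (1 : R) (fun a => f a * k) (f' * k).
  by move=> df; apply: (is_derive_mul df (is_derive_const k x)); rewrite mulr0 add0r mulrC.
have dN (x : R) (f : R -> R) f' : is_derive x (1 : R) f f' ->
    is_derive x (1 : R) (fun a => - f a) (- f').
  by move=> df; have := dZ (-1) x f f' df; rewrite mulN1r; under eq_fun do rewrite mulN1r.
have du (x : R) : is_derive x (1 : R) u (u' x).
  apply: (is_derive_add
    (is_derive_add (is_derive_const _ x) (is_derive_add (is_derive_linear _ x) (is_derive_const _ x) erefl) erefl)
    (is_derive_add
      (dZr _ _ _ _ (is_derive_add (dZ _ _ _ _ (dcos s^-1 x)) (dN _ _ _ (dZ _ _ _ _ (dsin s^-1 x))) erefl))
      (dZr _ _ _ _ (is_derive_add (dZ _ _ _ _ (dsin s x)) (dcos s x) erefl)) erefl)).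
  by rewrite /u'; field; rewrite ?ln ?sn.
have dexp (x : R) : is_derive x (1 : R) (fun a => expR (- (l * a))) (- l * expR (- (l * x))).
  apply: (is_derive_chain (is_derive_expR _) (dN _ _ _ (is_derive_linear l x))); ring.
have dF (x : R) : is_derive x (1 : R) (fun a => - (expR (- (l * a)) * u a))
    (expR (- (l * x)) * sine_kernel s x).
  have := dN _ _ _ (is_derive_mul (dexp x) (du x) erefl).
  move=> dE; apply: (is_derive_eq dE); rewrite /sine_kernel /u /u' [x / s]mulrC [x * s]mulrC.
  set S := sin (s * x); set C := cos (s * x); set S' := sin _; set C' := cos _; set E := expR _.
  transitivity (E * (1 + C' * (q1 * (1 + l ^+ 2 * s ^+ 2)) + x + s^-1 * S * (q2 * (l ^+ 2 + s ^+ 2)))).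
    by field; rewrite ?ln ?sn.
  by rewrite q1E q2E !mulr1 [s^-1 * _]mulrC.
have cker : continuous (fun x => expR (- (l * x)) * sine_kernel s x).
  apply: continuous_mul; first exact: derive_continuous dexp.
  rewrite (_ : sine_kernel s = fun a => 1 + cos (s^-1 * a) + a + sin (s * a) * s^-1); last first.
    by apply/funext => a; rewrite /sine_kernel [a / s]mulrC [a * s]mulrC.
  apply: continuous_add; last first.
    by apply: continuous_mul; [exact: derive_continuous (dsin s)|exact: continuous_const].
  apply: continuous_add; last by move=> x; exact: cvg_id.
  by apply: continuous_add; [exact: continuous_const|exact: derive_continuous (dcos s^-1)].
have trig (A B y z : R) : `|A * cos y + B * sin z| <= `|A| + `|B|.
  rewrite (le_trans (ler_normD _ _))// !normrM lerD// ler_piMr//.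
    exact: cos_max.
  exact: sin_max.
have [C C0 uC] : exists2 C, 0 <= C & forall x, 0 <= x -> `|u x| <= C + l^-1 * x.
  exists (`|l^-1| + `|l^-1 ^+ 2| + ((`|l * s ^+ 2| + `|- s|) * `|q1| +
    (`|1| + `|l * s^-1|) * `|q2|)).
    by rewrite !addr_ge0// mulr_ge0// addr_ge0.
  move=> x x0; have -> : u x = l^-1 + l^-1 ^+ 2 + ((l * s ^+ 2 * cos (s^-1 * x) + - s * sin (s^-1 * x)) *
      q1 + (1 * cos (s * x) + l * s^-1 * sin (s * x)) * q2) + l^-1 * x.
    by rewrite /u; ring.
  rewrite (le_trans (ler_normD _ _))// lerD//; last first.
    by rewrite ger0_norm// mulr_ge0// invr_ge0 ltW.
  rewrite (le_trans (ler_normD _ _))// lerD//; first exact: ler_normD.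
  rewrite (le_trans (ler_normD _ _))//.
  by rewrite lerD// normrM ler_wpM2r//; exact: trig.
have l20 : 0 < l / 2 by rewrite divr_gt0.
rewrite (@integral_exp_FTCy R (l / 2) (C + 2 * l^-1 / l) _ _ l20 _ cker dF).
- rewrite mulr0 !oppr0 expR0 mul1r opprK /u !mulr0 cos0 sin0; congr EFin.
  have q1E' : 1 - q1 = l ^+ 2 * s ^+ 2 * q1 by rewrite -[X in X - _]q1E; ring.
  by rewrite q1E'; field; rewrite ?ln ?sn.
- by move=> x x0; rewrite mulr_ge0 ?expR_ge0//; have /andP[] := sine_kernel_ge0 s0 x0.
- move=> x x0; rewrite normrN normrM ger0_norm ?expR_ge0//.
  apply: (le_trans _ (linear_expR_le l0 C0 _ x0)); last by rewrite invr_ge0 ltW.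
  by rewrite ler_wpM2l ?expR_ge0// uC.
Qed.

Lemma continuous_sine_kernel (s : R) : continuous (sine_kernel s).
Proof.
rewrite (_ : sine_kernel s = fun a => 1 + cos (s^-1 * a) + a + sin (s * a) * s^-1); last first.
  by apply/funext => a; rewrite /sine_kernel [a / s]mulrC [a * s]mulrC.
have clin (k : R) : continuous (fun a : R => k * a).
  by apply: continuous_mul; [exact: continuous_const|move=> x; exact: cvg_id].
apply: continuous_add; last first.
  apply: continuous_mul; last exact: continuous_const.
  by move=> x; apply: continuous_comp; [exact: clin|exact: continuous_sin].
apply: continuous_add; last by move=> x; exact: cvg_id.
apply: continuous_add; first exact: continuous_const.
by move=> x; apply: continuous_comp; [exact: clin|exact: continuous_cos].
Qed.

Lemma lebesgue_J : (mu J = (pi / 2)%:E)%E.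
Proof.
rewrite /= lebesgue_measure_itv/= lte_fin.
by rewrite divr_gt0 ?pi_gt0// oppr0 addr0.
Qed.

Lemma measurable_sine_kernel_sin :
  measurable_fun [set: R * R] (fun p : R * R => sine_kernel (sin p.2) p.1).
Proof.
have ms : measurable_fun [set: R * R] (fun p : R * R => sin p.2).
  by apply: (measurableT_comp (continuous_measurable_fun (@continuous_sin R))).
have mV : measurable_fun [set: R * R] (fun p : R * R => (sin p.2)^-1).
  exact: (measurableT_comp (@measurable_invr R) ms).
have mc := continuous_measurable_fun (@continuous_cos R).
have msi := continuous_measurable_fun (@continuous_sin R).
apply: measurable_funD; last first.
  apply: measurable_funM => //; apply: (measurableT_comp msi).
  exact: measurable_funM.
apply: measurable_funD => //; apply: measurable_funD => //.
by apply: (measurableT_comp mc); exact: measurable_funM.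
Qed.

Lemma measurable_sine_kernel_J (a : R) : measurable_fun J (fun x : R => sine_kernel (sin x) a).
Proof.
apply: measurable_funTS.
exact: (measurableT_comp measurable_sine_kernel_sin (measurable_pair1 a)).
Qed.

Lemma integrable_sine_kernel (a : R) : 0 <= a ->
  mu.-integrable J (EFin \o (fun x : R => sine_kernel (sin x) a)).
Proof.
move=> a0; apply: (integrable_bounded mJ (C := 2 + 2 * a)).
- by rewrite [X in (X < _)%E]lebesgue_J ltry.
- exact: measurable_sine_kernel_J.
- move=> x Jx; have /andP[h1 h2] := sine_kernel_ge0 (sinJ_gt0 Jx) a0.
  by rewrite ger0_norm.
Qed.

(** With [w = 1 / (l sqrt (1 + l^2))], the last two terms integrate to [(pi / 2) (1 / l - w)] and
    [(pi / 2) w]. The square roots cancel, and the transform of an affine function of [a] is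
    left. *)
Lemma integral_J_laplace (l : R) : 0 < l ->
  (\int[mu]_(x in J) (l^-1 + l^-1 ^+ 2 + l^-1 * (1 - (1 + l ^+ 2 * sin x ^+ 2)^-1) +
     (l ^+ 2 + sin x ^+ 2)^-1)%:E = (pi / 2 * (2 / l + l^-1 ^+ 2))%:E)%E.
Proof.
move=> l0; have ln : l != 0 by rewrite gt_eqF.
have p1 x : 0 < 1 + l ^+ 2 * sin x ^+ 2 by rewrite ltr_pwDl// mulr_ge0// sqr_ge0.
have p2 x : 0 < l ^+ 2 + sin x ^+ 2 by rewrite ltr_pwDl ?exprn_gt0// sqr_ge0.
have Joo : (mu J < +oo)%E by rewrite [X in (X < _)%E]lebesgue_J ltry.
have cs2 : continuous (fun x : R => sin x ^+ 2) by apply: continuous_pow; exact: continuous_sin.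
have iA : mu.-integrable J (EFin \o (fun x : R => (1 + l ^+ 2 * sin x ^+ 2)^-1)).
  apply: (integrable_bounded mJ (C := 1)) => //.
    apply: measurable_funTS; apply: continuous_measurable_fun.
    apply: continuous_inv; last by move=> x; rewrite gt_eqF.
    apply: continuous_add; first exact: continuous_const.
    by apply: continuous_mul; first exact: continuous_const.
  move=> x _; rewrite ger0_norm; last by rewrite invr_ge0 ltW.
  by rewrite invf_le1// lerDl mulr_ge0// sqr_ge0.
have iB : mu.-integrable J (EFin \o (fun x : R => (l ^+ 2 + sin x ^+ 2)^-1)).
  apply: (integrable_bounded mJ (C := (l ^+ 2)^-1)) => //.
    apply: measurable_funTS; apply: continuous_measurable_fun.
    apply: continuous_inv; last by move=> x; rewrite gt_eqF.
    by apply: continuous_add; first exact: continuous_const.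
  move=> x _; rewrite ger0_norm; last by rewrite invr_ge0 ltW.
  by rewrite lef_pV2 ?posrE ?exprn_gt0// lerDl sqr_ge0.
have iC (k : R) : mu.-integrable J (EFin \o (fun x : R => k)).
  by apply: (integrable_bounded mJ (C := `|k|)).
have iA' := integrable_realZ mJ l^-1 (integrable_realB mJ (iC 1) iA).
have iCA := integrable_realD mJ (iC (l^-1 + l^-1 ^+ 2)) iA'.
have iall := integrable_realD mJ iCA iB.
rewrite -[LHS]fineK; last exact: integrable_fin_num.
congr EFin; rewrite -[LHS]/(Rintegral _ _ _).
have RA : (\int[mu]_(x in J) (1 + l ^+ 2 * sin x ^+ 2)^-1)%R = pi / 2 / Num.sqrt (1 + l ^+ 2).
  by rewrite /Rintegral integral_oneD_sqr_sin.
have RB : (\int[mu]_(x in J) (l ^+ 2 + sin x ^+ 2)^-1)%R = pi / 2 / Num.sqrt (1 + l ^+ 2) / l.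
  by rewrite /Rintegral integral_sqrD_sqr_sin.
have RC (k : R) : (\int[mu]_(x in J) k)%R = k * (pi / 2).
  by rewrite Rintegral_cst//= [X in fine X]lebesgue_J.
rewrite RintegralD// RB RintegralD// RC RintegralZl; [|exact: mJ|exact: (integrable_realB mJ (iC 1) iA)].
rewrite RintegralB// RC RA.
have : 0 < Num.sqrt (1 + l ^+ 2) by rewrite sqrtr_gt0 ltr_pwDl// sqr_ge0.
by move: (Num.sqrt _) => w w0; field; rewrite ln gt_eqF.
Qed.

Lemma laplace_linear (l : R) : 0 < l ->
  (\int[mu]_(a in H) (expR (- (l * a)) * (pi / 2 * (2 + a)))%:E =
   (pi / 2 * (2 / l + l^-1 ^+ 2))%:E)%E.
Proof.
move=> l0; have ln : l != 0 by rewrite gt_eqF.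
have ph : 0 <= (pi : R) / 2 by rewrite divr_ge0// pi_ge0.
have dlin (x : R) : is_derive x (1 : R) (fun a => (- pi / 2) * (l^-1 * a + (2 * l^-1 + l^-1 ^+ 2))) ((- pi / 2) * l^-1).
  apply: (is_derive_mul (is_derive_const _ x) (is_derive_add (is_derive_linear _ x) (is_derive_const _ x) erefl)).
  by rewrite addr0 mulr0 addr0.
have dexp (x : R) : is_derive x (1 : R) (fun a => expR (- l * a)) (- l * expR (- l * x)).
  by apply: (is_derive_chain (is_derive_expR _) (is_derive_linear (- l) x)); rewrite mulrC.
have dF (x : R) : is_derive x (1 : R)
    (fun a => expR (- l * a) * ((- pi / 2) * (l^-1 * a + (2 * l^-1 + l^-1 ^+ 2))))
    (expR (- (l * x)) * (pi / 2 * (2 + x))).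
  apply: (is_derive_mul (dexp x) (dlin x)); rewrite -mulNr.
  by set E := expR _; field.
have cf : continuous (fun x : R => expR (- (l * x)) * (pi / 2 * (2 + x))).
  apply: continuous_mul.
    have := derive_continuous dexp; under eq_fun do rewrite mulNr.
    exact.
  apply: continuous_mul; first exact: continuous_const.
  by apply: continuous_add; [exact: continuous_const|move=> x; exact: cvg_id].
have l20 : 0 < l / 2 by rewrite divr_gt0.
rewrite (@integral_exp_FTCy R (l / 2) (pi / 2 * (2 * l^-1 + l^-1 ^+ 2) + 2 * (pi / 2 * l^-1) / l) _ _ l20 _ cf dF).
- by rewrite !mulr0 expR0 mul1r add0r; congr EFin; field.
- by move=> x x0; rewrite mulr_ge0 ?expR_ge0// mulr_ge0// addr_ge0.
- move=> x x0; rewrite normrM ger0_norm ?expR_ge0// mulNr.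
  have K0 : 0 <= 2 * l^-1 + l^-1 ^+ 2 by rewrite addr_ge0 ?mulr_ge0 ?sqr_ge0// invr_ge0 ltW.
  have k0 : 0 <= pi / 2 * l^-1 by rewrite mulr_ge0// invr_ge0 ltW.
  apply: (le_trans _ (linear_expR_le l0 (mulr_ge0 ph K0) k0 x0)).
  rewrite ler_wpM2l ?expR_ge0// !mulNr normrN ger0_norm; last first.
    by rewrite mulr_ge0// addr_ge0// mulr_ge0// invr_ge0 ltW.
  by rewrite mulrDr addrC mulrA.
Qed.

(** Both sides are nonnegative, continuous in [a] and have the same Laplace transform: Tonelli moves
    the transform inside the average, where [laplace_sine_kernel] and [integral_J_laplace] evaluate
    it. Continuity gives equality at each [a > 0] and not just almost everywhere. *)
Lemma integral_sine_kernel (a : R) : 0 < a ->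
  (\int[mu]_(x in J) sine_kernel (sin x) a)%R = pi / 2 * (2 + a).
Proof.
pose f a := (\int[mu]_(x in J) sine_kernel (sin x) a)%R.
have f0 (b : R) : 0 < b -> 0 <= f b.
  move=> b0; apply: Rintegral_ge0 => x Jx.
  by have /andP[] := sine_kernel_ge0 (sinJ_gt0 Jx) (ltW b0).
have cf (b : R) : 0 < b -> {for b, continuous f}.
  move=> b0; have bI : b \in (`]0, (b + 1)[%classic : set R) by rewrite inE/= in_itv/= b0/= ltrDl.
  apply: (@continuity_under_integral R _ _ mu (fun a x => sine_kernel (sin x) a) J mJ 0 (b + 1)
    _ _ (fun=> 2 + 2 * (b + 1)) _ _ b bI).
  - move=> c; rewrite /= in_itv/= => /andP[c0 _]; exact: (integrable_sine_kernel (ltW c0)).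
  - by apply: aeW => x _ c _; exact: continuous_sine_kernel.
  - apply: (integrable_bounded mJ (C := `|2 + 2 * (b + 1)|)) => //.
    by rewrite [X in (X < _)%E]lebesgue_J ltry.
  - move=> c; rewrite /= in_itv/= => /andP[c0 cb]; apply: aeW => x Jx.
    have /andP[h1 h2] := sine_kernel_ge0 (sinJ_gt0 Jx) (ltW c0).
    by rewrite ger0_norm//; lra.
have mf : measurable_fun H f.
  apply: open_continuous_measurable_fun; first exact: interval_open.
  by move=> b; rewrite inE/= in_itv/= andbT => /cf.
have Lf (l : R) : 0 < l -> (\int[mu]_(b in H) (expR (- (l * b)) * f b)%:E =
    (pi / 2 * (2 / l + l^-1 ^+ 2))%:E)%E.
  move=> l0; pose F (p : R * R) := (`|expR (- (l * p.1)) * sine_kernel (sin p.2) p.1|)%:E.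
  have F0 p : (0 <= F p)%E by rewrite lee_fin.
  have mF : measurable_fun [set: R * R] F.
    apply: measurableT_comp => //; apply: measurableT_comp => //.
    apply: measurable_funM; last exact: measurable_sine_kernel_sin.
    apply: measurableT_comp => //; apply: measurable_funN.
    by apply: measurable_funM.
  have FE (b x : R) : 0 < b -> J x -> F (b, x) = (expR (- (l * b)) * sine_kernel (sin x) b)%:E.
    move=> b0 Jx; have /andP[h1 h2] := sine_kernel_ge0 (sinJ_gt0 Jx) (ltW b0).
    by rewrite /F ger0_norm// mulr_ge0 ?expR_ge0.
  transitivity (\int[mu]_(b in H) \int[mu]_(x in J) F (b, x))%E.
    apply: eq_integral => b; rewrite inE/= in_itv/= andbT => b0.
    transitivity (\int[mu]_(x in J) ((expR (- (l * b)))%:E * (sine_kernel (sin x) b)%:E))%E.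
      rewrite ge0_integralZl; [|exact: mJ|by apply/measurable_EFinP; exact: measurable_sine_kernel_J
        |by move=> x Jx; rewrite lee_fin; have /andP[] := sine_kernel_ge0 (sinJ_gt0 Jx) (ltW b0)
        |by rewrite lee_fin expR_ge0].
      rewrite EFinM /f /Rintegral fineK//.
      by apply: integrable_fin_num => //; exact: (integrable_sine_kernel (ltW b0)).
    by apply: eq_integral => x; rewrite inE => Jx; rewrite FE// EFinM.
  rewrite (tonelli_restrict _ _ mF F0)//.
  rewrite -integral_J_laplace//; apply: eq_integral => x; rewrite inE => Jx.
  rewrite -(laplace_sine_kernel l0 (sinJ_gt0 Jx)).
  by apply: eq_integral => b; rewrite inE/= in_itv/= andbT => b0; rewrite FE.
apply: (@laplace_injective R f (fun a => pi / 2 * (2 + a)) f0 _ mf) => //.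
- by move=> b b0; rewrite mulr_ge0 ?divr_ge0 ?pi_ge0// addr_ge0// ltW.
- by apply: measurable_funTS; apply: measurable_funM => //; exact: measurable_funD.
- move=> b b0; apply: continuous_mul; first exact: continuous_const.
  by apply: continuous_add; [exact: continuous_const|move=> x; exact: cvg_id].
- by move=> k; rewrite Lf ?ltr0n// ltry.
- by move=> k; rewrite Lf ?ltr0n// laplace_linear// ltr0n.
Qed.

End sine_average.

(** * Power series of the multiplier *)

Section termwise_integration.
Context {R : realType} d (T : measurableType d) (mu : {measure set T -> \bar R}).
Variables (D : set T) (mD : measurable D) (Doo : (mu D < +oo)%E).

Lemma Rintegral_dominated_cst (h : nat -> T -> R) (H : T -> R) (C : R) :
  (forall k, measurable_fun D (h k)) -> (forall k x, D x -> `|h k x| <= C) ->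
  (forall x, D x -> h k x @[k --> \oo] --> H x) ->
  (\int[mu]_(x in D) h k x)%R @[k --> \oo] --> (\int[mu]_(x in D) H x)%R.
Proof.
move=> mh hC hH.
have mH : measurable_fun D H by exact: measurable_fun_cvg mh hH.
have iC : mu.-integrable D (EFin \o (fun _ : T => C)).
  by apply: (integrable_bounded mD (C := `|C|)) => //; exact: measurable_cst.
have [] := @dominated_convergence _ _ _ mu D mD (fun k => EFin \o h k) (EFin \o H)
  (EFin \o (fun=> C)).
- by move=> k; exact/measurable_EFinP.
- exact/measurable_EFinP.
- by apply: aeW => x Dx; apply: cvg_EFin; [exact: nearW|exact: hH].
- exact: iC.
- by apply: aeW => x k Dx; rewrite /= lee_fin hC.
move=> iH _ h1; apply: fine_cvg; rewrite fineK; last exact: integrable_fin_num.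
exact: h1.
Qed.

Lemma Rintegral_sum n (h : nat -> T -> R) :
  (forall k, mu.-integrable D (EFin \o h k)) ->
  mu.-integrable D (EFin \o (fun x => \sum_(0 <= k < n) h k x)) /\
  (\int[mu]_(x in D) (\sum_(0 <= k < n) h k x) = \sum_(0 <= k < n) \int[mu]_(x in D) h k x)%R.
Proof.
move=> ih; elim: n => [|n [iS IH]].
  under eq_fun do rewrite big_geq//.
  rewrite big_geq//; split; first by exact: (@integrable0 _ _ _ mu D).
  by rewrite Rintegral_cst// mul0r.
have -> : (fun x => \sum_(0 <= k < n.+1) h k x) = fun x => \sum_(0 <= k < n) h k x + h n x.
  by apply/funext => x; rewrite big_nat_recr.
split; first exact: integrable_realD.
by rewrite RintegralD// IH [RHS]big_nat_recr.
Qed.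

(** Weierstrass test: the partial sums are bounded by the constant [limn (series b)], which is
    integrable because [D] has finite measure, and dominated convergence applies. *)
Lemma Rintegral_series (h : nat -> T -> R) (b : nat -> R) (H : T -> R) :
  (forall k, measurable_fun D (h k)) -> (forall k x, D x -> `|h k x| <= b k) ->
  (forall k, 0 <= b k) -> cvgn (series b) ->
  (forall x, D x -> series (h^~ x) @ \oo --> H x) ->
  series (fun k => \int[mu]_(x in D) h k x)%R @ \oo --> (\int[mu]_(x in D) H x)%R.
Proof.
move=> mh hb b0 cb hH.
have ih k : mu.-integrable D (EFin \o h k) by apply: (integrable_bounded mD Doo (mh k) (hb k)).
rewrite (_ : series _ = fun n => \int[mu]_(x in D) (\sum_(0 <= k < n) h k x))%R; last first.
  by apply/funext => n; rewrite (Rintegral_sum n ih).2.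
apply: (@Rintegral_dominated_cst _ _ (limn (series b))) => //.
- by move=> n; apply: measurable_sum.
- move=> n x Dx; rewrite (le_trans (ler_norm_sum _ _ _))//.
  apply: (@le_trans _ _ (series b n)); first by apply: ler_sum => k _; exact: hb.
  by apply: nondecreasing_cvgn_le => //; exact: nondecreasing_series.
Qed.

Lemma normr_Rintegral_le_cst (f : T -> R) (C : R) : measurable_fun D f ->
  (forall x, D x -> `|f x| <= C) -> `|(\int[mu]_(x in D) f x)%R| <= C * fine (mu D).
Proof.
move=> mf fC; have fi := integrable_bounded mD Doo mf fC.
rewrite (le_trans (le_normr_Rintegral mD fi))// -Rintegral_cst//.
apply: le_Rintegral => //.
- apply: (integrable_bounded mD Doo (C := C)) => [|x Dx]; last by rewrite normr_id fC.
  exact: (measurableT_comp (@normr_measurable R setT) mf).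
- apply: (integrable_bounded mD Doo (C := `|C|)) => //; exact: measurable_cst.
Qed.

End termwise_integration.

Section sin_cos_moments.
Context {R : realType}.
Local Notation mu := (@lebesgue_measure R).
Local Notation J := (`]0%R, ((pi : R) / 2)%R[%classic : set R).
Local Notation mR := (measurableTypeR R).
Let mJ : measurable (J : set mR). Proof. exact: measurable_itv. Qed.
Let Joo : (mu (J : set mR) < +oo)%E. Proof. by rewrite [X in (X < _)%E]lebesgue_J ltry. Qed.

(** Half of the Beta function at [((p + 1)/2, (q + 1)/2)]. *)
Definition sin_cos_moment (p q : nat) : R := (\int[mu]_(x in J) (sin x ^+ p * cos x ^+ q))%R.

Lemma measurable_sin_cos p q : measurable_fun J (fun x : R => sin x ^+ p * cos x ^+ q).
Proof.
apply: measurable_funTS; apply: measurable_funM; apply: measurable_funX.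
  exact: continuous_measurable_fun (@continuous_sin R).
exact: continuous_measurable_fun (@continuous_cos R).
Qed.

Lemma sin_cos_norm_le1 p q (x : R) : `|sin x ^+ p * cos x ^+ q| <= 1.
Proof.
by rewrite normrM !normrX mulr_ile1// ?exprn_ge0// exprn_ile1// ?sin_max ?cos_max.
Qed.

Lemma integrable_sin_cos p q : mu.-integrable J (EFin \o (fun x : R => sin x ^+ p * cos x ^+ q)).
Proof.
apply: (integrable_bounded mJ Joo (measurable_sin_cos p q) (C := 1)) => x _.
exact: sin_cos_norm_le1.
Qed.

Lemma sin_cos_moment_ge0 p q : 0 <= sin_cos_moment p q.
Proof.
apply: Rintegral_ge0 => x Jx; rewrite mulr_ge0// exprn_ge0// ltW//.
  exact: sinJ_gt0.
exact: cosJ_gt0.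
Qed.

Lemma sin_cos_moment_le p q : sin_cos_moment p q <= pi / 2.
Proof.
rewrite (le_trans (ler_norm _))//.
have := normr_Rintegral_le_cst mJ Joo (measurable_sin_cos p q) (fun x _ => sin_cos_norm_le1 p q x).
by rewrite [X in _ * fine X](_ : _ = (pi / 2)%:E) ?mul1r//; exact: lebesgue_J.
Qed.

(** The function [sin^(p+1) cos^(q+1)] vanishes at both ends of the interval, and its derivative is
    a combination of the two integrands. *)
Lemma sin_cos_moment_rec p q :
  (p + q).+2%:R * sin_cos_moment p.+2 q = p.+1%:R * sin_cos_moment p q.
Proof.
have dF (x : R) : is_derive x (1 : R) (fun y => sin y ^+ p.+1 * cos y ^+ q.+1)
    (p.+1%:R * (sin x ^+ p * cos x ^+ q) - (p + q).+2%:R * (sin x ^+ p.+2 * cos x ^+ q)).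
  apply: (is_derive_mul (is_derive_pow (n := p.+1) (is_derive_sin x) erefl)
    (is_derive_pow (n := q.+1) (is_derive_cos x) erefl)).
  rewrite /= -addSn -addnS !natrD.
  have c2 : cos x ^+ 2 = 1 - sin x ^+ 2 by rewrite -[X in X - _](cos2Dsin2 x) addrK.
  rewrite (_ : sin x ^+ p.+2 = sin x ^+ p * sin x ^+ 2); last by rewrite -exprD addn2.
  rewrite (exprS (cos x) q) (exprS (sin x) p).
  rewrite (_ : cos x * cos x ^+ q * _ = p.+1%:R * sin x ^+ p * cos x ^+ q * cos x ^+ 2); last by ring.
  by rewrite c2; ring.
have cs : continuous (fun y : R => sin y ^+ p * cos y ^+ q).
  by apply: continuous_mul; apply: continuous_pow; [exact: continuous_sin|exact: continuous_cos].
have cs2 : continuous (fun y : R => sin y ^+ p.+2 * cos y ^+ q).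
  by apply: continuous_mul; apply: continuous_pow; [exact: continuous_sin|exact: continuous_cos].
have := @integral_FTCoo R _ _ 0 (pi / 2) (@pihalf_ge0 R) dF.
rewrite sin0 cos_pihalf !expr0n/= mulr0 mul0r subrr => FTC.
apply/esym/eqP; rewrite -subr_eq0; apply/eqP.
rewrite -!RintegralZl//; [|exact: integrable_sin_cos..].
rewrite -RintegralB//; [|by apply: integrable_realZ => //; exact: integrable_sin_cos..].
rewrite /Rintegral FTC//.
apply: continuous_add; first by apply: continuous_mul; [exact: continuous_const|].
by move=> x; apply: cvgN; apply: cvgM; [exact: cvg_cst|exact: cs2].
Qed.

Lemma sin_cos_moment0 q : sin_cos_moment 0 q = wc q.
Proof.
rewrite /sin_cos_moment /wc /Rintegral.
rewrite [in RHS](@integral_itv_bndoo R 0 (pi / 2) _ true false); last first.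
  apply/measurable_EFinP; have := measurable_sin_cos 0 q.
  by apply: eq_measurable_fun => x _; rewrite expr0 mul1r.
by congr fine; apply: eq_integral => x _; rewrite expr0 mul1r.
Qed.

Lemma sin_cos_moment1 q : sin_cos_moment 1 q = q.+1%:R^-1.
Proof.
have q0 : q.+1%:R != 0 :> R by rewrite pnatr_eq0.
have dF (x : R) : is_derive x (1 : R) (fun y => (- q.+1%:R^-1) * cos y ^+ q.+1)
    (sin x ^+ 1 * cos x ^+ q).
  apply: (is_derive_mul (is_derive_const _ x) (is_derive_pow (n := q.+1) (is_derive_cos x) erefl)).
  by rewrite /= expr1; move: (sin x) (cos x ^+ q) => s c; field; rewrite -natr1 in q0.
have cs : continuous (fun y : R => sin y ^+ 1 * cos y ^+ q).
  by apply: continuous_mul; apply: continuous_pow; [exact: continuous_sin|exact: continuous_cos].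
have := @integral_FTCoo R _ _ 0 (pi / 2) (@pihalf_ge0 R) dF cs.
rewrite /sin_cos_moment /Rintegral => -> /=.
by rewrite cos0 cos_pihalf expr0n expr1n/= mulr0 sub0r mulNr opprK mulr1.
Qed.

End sin_cos_moments.

(** * Coefficients of the multiplier and of the Bessel series *)

Section bessel_coefficients.
Context {R : realType}.

(* In dimension n.+1 the Fourier multiplier is
   [1 - \sum_k (-1)^k * mult_coef n k * u^(2k+1)]. *)
Definition mult_coef (n k : nat) : R :=
  2 / pi * sin_cos_moment k.*2 0 * sin_cos_moment k.*2.+1 n / (wc n * (k.*2.+1)`!%:R).

Lemma mult_coef_ge0 n k : 0 <= mult_coef n k.
Proof.
rewrite /mult_coef mulr_ge0 ?invr_ge0 ?mulr_ge0 ?sin_cos_moment_ge0 ?ler0n ?invr_ge0 ?pi_ge0//.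
exact/ltW/wc_gt0.
Qed.

(** Both moments in [mult_coef] advance by [sin_cos_moment_rec] while the factorial gains two
    factors, one of which cancels. *)
Lemma mult_coefS n k : mult_coef n k.+1 * (2 * k.+1%:R * (k.*2 + n).+3%:R * k.*2.+3%:R) =
  k.*2.+1%:R * mult_coef n k.
Proof.
have p0 : pi != 0 :> R by rewrite gt_eqF// pi_gt0.
have w0 : wc n != 0 :> R by rewrite gt_eqF// wc_gt0.
have f0 : (k.*2.+1)`!%:R != 0 :> R by rewrite pnatr_eq0 -lt0n fact_gt0.
have := @sin_cos_moment_rec R k.*2 0; have := @sin_cos_moment_rec R k.*2.+1 n.
rewrite addn0 addSn /mult_coef doubleS !factS !natrM.
have k2 : k.*2.+2%:R = 2 * k.+1%:R :> R by rewrite -doubleS -mul2n natrM.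
rewrite k2.
have k1 : k.+1%:R != 0 :> R by rewrite pnatr_eq0.
have k3 : k.*2.+3%:R != 0 :> R by rewrite pnatr_eq0.
have f0' := f0; rewrite factS natrM in f0'.
move: f0'; rewrite mulf_eq0 negb_or => /andP[k4 f1].
move: (sin_cos_moment _ _) (sin_cos_moment _ _) (sin_cos_moment _ _) (sin_cos_moment _ _).
move: p0 w0 k1 k3 k4 f1.
move: (wc n) (pi : R) (k.+1%:R : R) (k.*2.+1%:R : R) (k.*2.+3%:R : R) ((k.*2)`!%:R : R)
  ((k.*2 + n).+3%:R : R) => w p a b c f A p0 w0 a0 c0 b0 f0' s1 s2 s3 s4 e1 e2.
transitivity (2 / p * (2 * a * s2) * (A * s4) / (w * (2 * a * (b * f)))).
  by field; rewrite p0 w0 a0 b0 c0 f0'.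
by rewrite e1 e2; field; rewrite p0 w0 a0 b0 f0'.
Qed.

Lemma Gamma_mult_coef n k : Gamma (n.+2%:R / 2) / Num.sqrt pi =
  k.*2.+1%:R * mult_coef n k * (Gamma ((k.*2 + n).+3%:R / 2) * k`!%:R * 4 ^+ k) :> R.
Proof.
elim: k => [|k ->]; last first.
  have k3 : k.*2.+3%:R != 0 :> R by rewrite pnatr_eq0.
  rewrite doubleS !addSn (@Gamma_rec R (k.*2 + n).+2) factS natrM exprS.
  transitivity (mult_coef n k.+1 * (2 * k.+1%:R * (k.*2 + n).+3%:R * k.*2.+3%:R) *
    (Gamma ((k.*2 + n).+3%:R / 2) * k`!%:R * 4 ^+ k)); first by rewrite mult_coefS.
  by field.
have p0 : 0 < pi :> R by exact: pi_gt0.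
have s0 : Num.sqrt pi != 0 :> R by rewrite gt_eqF// sqrtr_gt0.
have s2 : Num.sqrt pi ^+ 2 = pi :> R by rewrite sqr_sqrtr// ltW.
have w0 : wc n != 0 :> R by rewrite gt_eqF// wc_gt0.
have w1 : wc n.+1 != 0 :> R by rewrite gt_eqF// wc_gt0.
have P0 : wprod 1 n.+2 != 0 :> R by rewrite gt_eqF// wprod_gt0.
have a0 : n.+1%:R != 0 :> R by rewrite pnatr_eq0.
have b0 : n.+2%:R != 0 :> R by rewrite pnatr_eq0.
rewrite !double0 add0n /mult_coef sin_cos_moment0 sin_cos_moment1 wc0 mul1r mulr1 expr0 mulr1.
rewrite !GammaE {2}/wprod big_ord_recr/= -/(wprod 1 n.+2) add1n fact0 mulr1.
rewrite (_ : n.+3%:R * (wprod 1 n.+2 * (2 * wc n.+3)) = wprod 1 n.+2 * 2 * (n.+2%:R * wc n.+1)); last first.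
  by rewrite -wc_rec; ring.
have -> : Num.sqrt pi ^+ n.+3 = pi * Num.sqrt pi ^+ n.+1 :> R by rewrite -{2}s2 -exprD.
have -> : Num.sqrt pi ^+ n.+2 = Num.sqrt pi * Num.sqrt pi ^+ n.+1 :> R by rewrite exprS.
have := @wc_mulS R n.
move: s0 {s2}; move: (Num.sqrt (pi : R)) => s s0 e; move: (s ^+ n.+1) => S.
have -> : (pi : R) = 2 * n.+1%:R * (wc n * wc n.+1) by rewrite e; move: a0; move: (n.+1%:R : R) => a a0; field.
move: a0 b0 w0 w1 P0 {e}; move: (wc n) (wc n.+1) (wprod 1 n.+2) (n.+1%:R : R) (n.+2%:R : R).
move=> W0 W1 P a b a0 b0 w0 w1 P0.
by field; rewrite ?a0 ?b0 ?w0 ?w1 ?P0 ?s0.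
Qed.

End bessel_coefficients.

(** * The multiplier as a double average, and its power series *)

Section multiplier.
Context {R : realType}.
Local Notation mu := (@lebesgue_measure R).
Local Notation J := (`]0%R, ((pi : R) / 2)%R[%classic : set R).
Local Notation mR := (measurableTypeR R).
Let mJ : measurable (J : set mR). Proof. exact: measurable_itv. Qed.
Let Joo : (mu (J : set mR) < +oo)%E. Proof. by rewrite [X in (X < _)%E]lebesgue_J ltry. Qed.

Definition cosec_average (a : R) : R := 2 / pi * (\int[mu]_(x in J) cos (a / sin x))%R.

(** Here [n] is the dimension minus one, [u] stands for [2 pi t |xi|], and [cosec_average] is the
    function Q; [wc n] is the total mass of the weight [cos^n]. *)
Definition sphere_multiplier n (u : R) : R :=
  (wc n)^-1 * (\int[mu]_(x in J) (cos x ^+ n * cosec_average (u * sin x)))%R.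

Let measurable_comp_sin (f : R -> R) : measurable_fun [set: R] f ->
  measurable_fun J (fun x : R => f (sin x)).
Proof.
move=> mf; apply: measurable_funTS; apply: (measurableT_comp mf).
exact: continuous_measurable_fun (@continuous_sin R).
Qed.

Lemma measurable_cos_cosec (a : R) : measurable_fun J (fun x : R => cos (a / sin x)).
Proof.
apply: (measurable_comp_sin (f := fun y => cos (a / y))).
apply: (measurableT_comp (continuous_measurable_fun (@continuous_cos R))).
by apply: measurable_funM => //; exact: measurable_invr.
Qed.

Lemma integrable_cos_cosec (a : R) : mu.-integrable J (EFin \o (fun x : R => cos (a / sin x))).
Proof.
by apply: (integrable_bounded mJ Joo (measurable_cos_cosec a) (C := 1)) => x _; exact: cos_max.
Qed.

Lemma measurable_sinc_sin (a : R) : measurable_fun J (fun x : R => sin (a * sin x) / sin x).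
Proof.
apply: (measurable_comp_sin (f := fun y => sin (a * y) / y)); apply: measurable_funM.
  apply: (measurableT_comp (continuous_measurable_fun (@continuous_sin R))).
  by apply: measurable_funM.
exact: measurable_invr.
Qed.

Lemma integrable_sinc_sin (a : R) : mu.-integrable J (EFin \o (fun x : R => sin (a * sin x) / sin x)).
Proof.
apply: (integrable_bounded mJ Joo (measurable_sinc_sin a) (C := `|a|)) => x Jx.
have s0 := sinJ_gt0 Jx.
rewrite normrM normfV (gtr0_norm s0) ler_pdivrMr// (le_trans (normr_sin_le _))//.
by rewrite normrM (gtr0_norm s0).
Qed.

Lemma cosec_average_le1 (a : R) : `|cosec_average a| <= 1.
Proof.
rewrite /cosec_average normrM ger0_norm ?divr_ge0// ?pi_ge0//.
have le : `|\int[mu]_(x in J) cos (a / sin x)|%R <= pi / 2.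
  have := normr_Rintegral_le_cst mJ Joo (measurable_cos_cosec a) (fun x _ => cos_max (a / sin x)).
  by rewrite [X in _ * fine X](_ : _ = (pi / 2)%:E) ?mul1r//; exact: lebesgue_J.
have p0 : (0 : R) < pi by exact: pi_gt0.
have pp : 2 / pi * (pi / 2) = 1 :> R by move: p0; move: (pi : R) => q /gt_eqF/negbT q0; field; rewrite q0.
by rewrite -[leRHS]pp ler_wpM2l// divr_ge0// ltW.
Qed.

(** The elementary terms are subtracted from [integral_sine_kernel], which covers [a > 0]; at
    [a = 0] the integrands are constant. *)
Lemma cosec_averageE (a : R) : 0 <= a ->
  cosec_average a = 1 - 2 / pi * (\int[mu]_(x in J) (sin (a * sin x) / sin x))%R.
Proof.
have p0 : pi != 0 :> R by rewrite gt_eqF// pi_gt0.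
have i1 (k : R) : mu.-integrable J (EFin \o (fun _ : R => k)).
  by apply: (integrable_bounded mJ Joo _ (C := `|k|)) => //; exact: measurable_cst.
have c1 (k : R) : (\int[mu]_(x in J) k)%R = pi / 2 * k.
  rewrite Rintegral_cst// [X in _ * fine X](_ : _ = (pi / 2)%:E); first by rewrite mulrC.
  exact: lebesgue_J.
rewrite le_eqVlt => /predU1P[<-|a0].
  rewrite /cosec_average; under eq_Rintegral do rewrite mul0r cos0.
  under [in RHS]eq_Rintegral do rewrite mul0r sin0 mul0r.
  by rewrite !c1; move: p0; move: (pi : R) => q q0; field; rewrite q0.
have := integral_sine_kernel a0; rewrite /sine_kernel.
have ic := integrable_cos_cosec a; have isn := integrable_sinc_sin a.
have i1c := integrable_realD mJ (i1 1) ic.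
have i1ca := integrable_realD mJ i1c (i1 a).
rewrite !RintegralD// !c1 /cosec_average => e.
move: e; move: (\int[mu]_(x in J) cos (a / sin x))%R (\int[mu]_(x in J) (sin (a * sin x) / sin x))%R.
move=> A B e; have -> : A = pi / 2 - B by lra.
by move: p0; move: (pi : R) => q q0; field; rewrite q0.
Qed.

(** Comparison with the exponential series of [u^2]. *)
Lemma cvg_sqr_series (u : R) (c : nat -> R) (C : R) : (forall k, 0 <= c k <= C / k`!%:R) ->
  cvgn (series (fun k => c k * u ^+ k.*2)).
Proof.
move=> hc; have C0 : 0 <= C.
  by have /andP[c0 c0C] := hc 0%N; rewrite (le_trans c0)// (le_trans c0C)// divr1.
have E k : u ^+ k.*2 = (u ^+ 2) ^+ k by rewrite -mul2n exprM.
apply: (@series_le_cvg _ _ (fun k => C * exp_coeff (u ^+ 2) k)) => [k|k|k|].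
- by have /andP[c0 _] := hc k; rewrite mulr_ge0// E exprn_ge0// sqr_ge0.
- by apply: mulr_ge0 => //; rewrite /exp_coeff/= divr_ge0// exprn_ge0// sqr_ge0.
- rewrite E (_ : C * _ = C / k`!%:R * (u ^+ 2) ^+ k); last by rewrite /exp_coeff/=; ring.
  by have /andP[_ cC] := hc k; rewrite ler_wpM2r// exprn_ge0// sqr_ge0.
- have -> : series (fun k => C * exp_coeff (u ^+ 2) k) =
      fun n => C * series (exp_coeff (u ^+ 2)) n.
    by apply/funext => n; rewrite /series/= big_distrr.
  apply: is_cvgM; first exact: is_cvg_cst.
  exact: is_cvg_series_exp_coeff.
Qed.

Let fact_odd_inv_le k : (k.*2.+1)`!%:R^-1 <= k`!%:R^-1 :> R.
Proof.
rewrite lef_pV2 ?posrE ?ltr0n ?fact_gt0// ler_nat leq_fact//.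
by rewrite (leq_trans _ (leqnSn _))// -addnn leq_addr.
Qed.

Lemma cvg_odd_fact_series (a : R) : 0 <= a ->
  cvgn (series (fun k => a ^+ k.*2.+1 / (k.*2.+1)`!%:R)).
Proof.
move=> a0; rewrite (_ : (fun k => _) = fun k => a / (k.*2.+1)`!%:R * a ^+ k.*2); last first.
  by apply/funext => k; rewrite exprS; ring.
by apply: (cvg_sqr_series (C := a)) => k; rewrite divr_ge0//= ler_wpM2l.
Qed.

(** In the form of [cosec_averageE] the sine series can be divided by [sin x] term by term, the
    [k]-th term staying below [a^(2k+1) / (2k+1)!], and then integrated. *)
Lemma cosec_average_series (a : R) : 0 <= a ->
  series (fun k => (-1) ^+ k * (a ^+ k.*2.+1 / (k.*2.+1)`!%:R) * (2 / pi * sin_cos_moment k.*2 0))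
    @ \oo --> 1 - cosec_average a.
Proof.
move=> a0; rewrite cosec_averageE// opprB addrC subrK.
have := @Rintegral_series _ _ _ mu J mJ Joo
  (fun k x => (-1) ^+ k * (a ^+ k.*2.+1 / (k.*2.+1)`!%:R) * (sin x ^+ k.*2 * cos x ^+ 0))
  (fun k => a ^+ k.*2.+1 / (k.*2.+1)`!%:R) (fun x => sin (a * sin x) / sin x).
have s0 k : 0 <= a ^+ k.*2.+1 / (k.*2.+1)`!%:R by rewrite divr_ge0// exprn_ge0.
have -> : series (fun k => (-1) ^+ k * (a ^+ k.*2.+1 / (k.*2.+1)`!%:R) *
    (2 / pi * sin_cos_moment k.*2 0)) =
    fun n => 2 / pi * series (fun k => \int[mu]_(x in J) ((-1) ^+ k *
      (a ^+ k.*2.+1 / (k.*2.+1)`!%:R) * (sin x ^+ k.*2 * cos x ^+ 0)))%R n.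
  apply/funext => n; rewrite /series/= big_distrr/=; apply: eq_bigr => k _.
  by rewrite RintegralZl//; [rewrite mulrCA|exact: integrable_sin_cos].
move=> h; apply: cvgM; first exact: cvg_cst.
apply: h => //.
- by move=> k; apply: measurable_funM => //; exact: measurable_sin_cos.
- move=> k x _; rewrite normrM normrM normrX normrN1 expr1n mul1r (ger0_norm (s0 k)).
  by rewrite ler_piMr// sin_cos_norm_le1.
- exact: cvg_odd_fact_series.
- move=> x Jx; have sx := sinJ_gt0 Jx; have sn : sin x != 0 by rewrite gt_eqF.
  rewrite (_ : series _ = fun n => series (sin_coeff' (a * sin x)) n * (sin x)^-1).
    by apply: cvgM; [exact: cvg_sin_coeff'|exact: cvg_cst].
  apply/funext => n; rewrite /series/= big_distrl/=; apply: eq_bigr => k _.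
  rewrite /sin_coeff' exprMn exprS [sin x ^+ _.+1]exprS expr0 mulr1.
  have : (k.*2.+1)`!%:R != 0 :> R by rewrite pnatr_eq0 -lt0n fact_gt0.
  move: ((_)`!%:R : R) (a ^+ k.*2) (sin x ^+ k.*2) => f A S f0; rewrite -exprnP; field.
  by rewrite sn f0.
Qed.

Lemma mult_coef_le n k : mult_coef n k <= (pi / 2 / wc n) / (k.*2.+1)`!%:R :> R.
Proof.
have p0 : pi != 0 :> R by rewrite gt_eqF// pi_gt0.
have w0 := @wc_gt0 R n.
rewrite /mult_coef invfM [leLHS]mulrA ler_wpM2r ?invr_ge0// ler_wpM2r ?invr_ge0 ?(ltW w0)//.
rewrite (@le_trans _ _ (2 / pi * (pi / 2) * (pi / 2)))//.
  by rewrite !ler_pM ?mulr_ge0 ?invr_ge0 ?sin_cos_moment_ge0 ?sin_cos_moment_le ?pi_ge0.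
by move: p0; move: (pi : R) => q q0; rewrite le_eqVlt; apply/orP; left; apply/eqP; field.
Qed.

Let oneB_cosec (n : nat) (u x : R) := cos x ^+ n * (1 - cosec_average (u * sin x)).
Let oneB_cosec_term (n : nat) (u : R) k (x : R) := (-1) ^+ k * (u ^+ k.*2.+1 / (k.*2.+1)`!%:R) *
  (2 / pi * sin_cos_moment k.*2 0) * (sin x ^+ k.*2.+1 * cos x ^+ n).

Let measurable_oneB_cosec_term n u k : measurable_fun J (oneB_cosec_term n u k).
Proof. by apply: measurable_funM => //; exact: measurable_sin_cos. Qed.

Let oneB_cosec_series n (u x : R) : 0 <= u -> J x ->
  series (oneB_cosec_term n u ^~ x) @ \oo --> oneB_cosec n u x.
Proof.
move=> u0 Jx; have sx := sinJ_gt0 Jx.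
have := @cosec_average_series (u * sin x) (mulr_ge0 u0 (ltW sx)).
move=> h; rewrite (_ : series _ = fun m => cos x ^+ n * series (fun k => (-1) ^+ k *
    ((u * sin x) ^+ k.*2.+1 / (k.*2.+1)`!%:R) * (2 / pi * sin_cos_moment k.*2 0)) m).
  by apply: cvgM; [exact: cvg_cst|exact: h].
apply/funext => m; rewrite /series/= big_distrr/=.
by apply: eq_bigr => k _; rewrite /oneB_cosec_term exprMn; ring.
Qed.

Let measurable_oneB_cosec n (u : R) : 0 <= u -> measurable_fun J (oneB_cosec n u).
Proof.
move=> u0; apply: (@measurable_fun_cvg _ _ _ J (fun m x => series (oneB_cosec_term n u ^~ x) m)).
  by move=> m; rewrite /series/=; apply: measurable_sum => k; exact: measurable_oneB_cosec_term.
by move=> x Jx; exact: oneB_cosec_series.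
Qed.

(** The inner average is measurable in [x] as a pointwise limit of the partial sums of
    [cosec_average_series], whose argument [u sin x] is nonnegative because [u] is. *)
Lemma measurable_sphere_integrand n (u : R) : 0 <= u ->
  measurable_fun J (fun x : R => cos x ^+ n * cosec_average (u * sin x)).
Proof.
move=> u0; rewrite (_ : (fun x => _) = fun x => sin x ^+ 0 * cos x ^+ n - oneB_cosec n u x).
  by apply: measurable_funB; [exact: measurable_sin_cos|exact: measurable_oneB_cosec].
by apply/funext => x; rewrite /oneB_cosec; ring.
Qed.

Lemma sphere_integrand_le1 n (u x : R) : `|cos x ^+ n * cosec_average (u * sin x)| <= 1.
Proof.
by rewrite normrM normrX mulr_ile1// ?exprn_ge0 ?cosec_average_le1// exprn_ile1// cos_max.
Qed.

Lemma integrable_sphere_integrand n (u : R) : 0 <= u ->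
  mu.-integrable J (EFin \o (fun x : R => cos x ^+ n * cosec_average (u * sin x))).
Proof.
move=> u0; apply: (integrable_bounded mJ Joo (measurable_sphere_integrand n u0) (C := 1)) => x _.
exact: sphere_integrand_le1.
Qed.

(** A second termwise integration, now against [cos^n], turns each [sin^(2k+1)] into a Beta moment,
    which yields [mult_coef]. *)
Lemma sphere_multiplier_series n (u : R) : 0 <= u ->
  series (fun k => (-1) ^+ k * mult_coef n k * u ^+ k.*2.+1) @ \oo --> 1 - sphere_multiplier n u.
Proof.
move=> u0; have w0 : wc n != 0 :> R by rewrite gt_eqF// wc_gt0.
have E : 1 - sphere_multiplier n u = (wc n)^-1 * (\int[mu]_(x in J) oneB_cosec n u x)%R.
  rewrite /sphere_multiplier -{1}(mulVf w0) -mulrBr; congr (_ * _).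
  rewrite -sin_cos_moment0 /sin_cos_moment -RintegralB//.
  - by apply: eq_Rintegral => x _; rewrite /oneB_cosec expr0 mul1r mulrBr mulr1.
  - exact: integrable_sin_cos.
  - exact: integrable_sphere_integrand.
rewrite E (_ : series _ = fun m => (wc n)^-1 * series (fun k => \int[mu]_(x in J) oneB_cosec_term n u k x)%R m).
  apply: cvgM; first exact: cvg_cst.
  apply: (Rintegral_series mJ Joo (b := fun k => u ^+ k.*2.+1 / (k.*2.+1)`!%:R)).
  - by move=> k; exact: measurable_oneB_cosec_term.
  - move=> k x _; rewrite normrM -[leRHS]mulr1 ler_pM// ?sin_cos_norm_le1//.
    rewrite normrM [X in X * _]normrM normrX normrN1 expr1n mul1r.
    rewrite ger0_norm ?divr_ge0 ?exprn_ge0// ler_piMr ?divr_ge0 ?exprn_ge0//.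
    rewrite ger0_norm ?mulr_ge0 ?invr_ge0 ?pi_ge0 ?sin_cos_moment_ge0//.
    have p0 : (0 : R) < pi by exact: pi_gt0.
    rewrite (@le_trans _ _ (2 / pi * (pi / 2)))//.
      by rewrite ler_wpM2l ?sin_cos_moment_le// divr_ge0// ltW.
    by move: p0; move: (pi : R) => q q0; rewrite le_eqVlt; apply/orP; left; apply/eqP; field; rewrite gt_eqF.
  - by move=> k; rewrite divr_ge0// exprn_ge0.
  - exact: cvg_odd_fact_series.
  - by move=> x Jx; exact: oneB_cosec_series.
apply/funext => m; rewrite /series/= big_distrr/=; apply: eq_bigr => k _.
rewrite /oneB_cosec_term RintegralZl//; last exact: integrable_sin_cos.
rewrite -/(sin_cos_moment _ _) /mult_coef invfM; ring.
Qed.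

End multiplier.

(** * Decay of the multiplier at infinity *)

Section multiplier_limit.
Context {R : realType}.
Local Notation mu := (@lebesgue_measure R).
Local Notation J := (`]0%R, ((pi : R) / 2)%R[%classic : set R).
Local Notation mR := (measurableTypeR R).
Let mJ : measurable (J : set mR). Proof. exact: measurable_itv. Qed.
Let Joo : (mu (J : set mR) < +oo)%E. Proof. by rewrite [X in (X < _)%E]lebesgue_J ltry. Qed.

(* Integration by parts against [sin (a / sin x)], whose derivative is
   [- a cos x / sin x ^ 2 * cos (a / sin x)]. *)
Lemma cos_cosec_inner_bound (x0 x1 : R) : 0 < x0 -> x0 < x1 -> x1 < pi / 2 ->
  exists2 K, 0 <= K & forall a, 0 < a ->
    `|\int[mu]_(x in `[x0, x1]) cos (a / sin x)|%R <= K / a.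
Proof.
move=> x0_gt0 x01 x1pi.
have sub x : x0 <= x <= x1 -> J x.
  by move=> /andP[xx0 xx1]; rewrite /= in_itv/= (lt_le_trans x0_gt0 xx0) (le_lt_trans xx1 x1pi).
have c1 : 0 < cos x1 by apply: cosJ_gt0; apply: sub; rewrite lexx ltW.
have cle x : x0 <= x <= x1 -> (cos x)^-1 <= (cos x1)^-1.
  move=> xx; have cx := cosJ_gt0 (sub _ xx); rewrite lef_pV2 ?posrE//.
  have /andP[xx0 xx1] := xx; rewrite le_eqVlt in xx1; case/predU1P: xx1 => [->//|xx1].
  have p0 := pi_gt0 R; have pi1 : pi / 2 <= pi :> R by move: p0; move: (pi : R) => q q0; lra.
  have xpi : x <= pi by rewrite (le_trans (ltW xx1))// (le_trans (ltW x1pi)).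
  rewrite ltW// ltr_cos ?in_itv//= ?(le_trans (ltW x0_gt0) xx0)//.
  by rewrite (le_trans (ltW x0_gt0) (ltW x01))/= (le_trans (ltW x1pi)).
pose w (x : R) := sin x ^+ 2 / cos x.
pose w' (x : R) := 2 * sin x + sin x ^+ 3 / cos x ^+ 2.
have s1 (x : R) : `|sin x| <= 1 by exact: sin_max.
have wC x : x0 <= x <= x1 -> `|w x| <= (cos x1)^-1.
  move=> xx; have cx := cosJ_gt0 (sub _ xx).
  rewrite /w normrM normrX normfV (gtr0_norm cx) -[leRHS]mul1r ler_pM ?exprn_ge0 ?invr_ge0 ?(ltW cx)//.
    by rewrite exprn_ile1.
  exact: cle.
have w'C x : x0 <= x <= x1 -> `|w' x| <= 2 + (cos x1)^-1 ^+ 2.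
  move=> xx; have cx := cosJ_gt0 (sub _ xx).
  rewrite /w' (le_trans (ler_normD _ _))// lerD//.
    by rewrite normrM ger0_norm// ler_piMr.
  rewrite normrM normrX normfV normrX (gtr0_norm cx) -[leRHS]mul1r ler_pM ?exprn_ge0 ?invr_ge0 ?exprn_ge0 ?(ltW cx)//.
    by rewrite exprn_ile1.
  by rewrite -exprVn lerXn2r ?nnegrE ?invr_ge0 ?(ltW cx) ?(ltW c1)// cle.
pose K := (2 + (cos x1)^-1 ^+ 2) * (x1 - x0) + 2 * (cos x1)^-1.
exists K.
  by rewrite /K addr_ge0// mulr_ge0 ?subr_ge0 ?(ltW x01) ?addr_ge0 ?invr_ge0 ?exprn_ge0 ?invr_ge0// ltW.
move=> a a0.
pose F (x : R) := w x * sin (a / sin x).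
pose p (x : R) := w' x * sin (a / sin x).
have dw (x : R) : cos x != 0 -> is_derive x (1 : R) w (w' x).
  move=> cx; apply: (is_derive_mul (is_derive_pow (n := 2) (is_derive_sin x) erefl)
    (is_derive_inv cx (is_derive_cos x) erefl)).
  by rewrite /w' /= expr1; move: (sin x) (cos x) cx => s c c0; field.
have dS (x : R) : sin x != 0 -> is_derive x (1 : R) (fun y => sin (a / sin y))
    (- (a * cos x / sin x ^+ 2 * cos (a / sin x))).
  move=> sx; apply: (is_derive_chain (is_derive_sin _)
    (is_derive_mul (is_derive_const a x) (is_derive_inv sx (is_derive_sin x) erefl) erefl)).
  by move: (cos (a / sin x)) => C; move: (sin x) (cos x) sx => s c s0; field.
have dF (x : R) : x0 <= x <= x1 -> is_derive x (1 : R) F (p x - a * cos (a / sin x)).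
  move=> xx; have cx : cos x != 0 by rewrite gt_eqF// cosJ_gt0//; exact: sub.
  have sx : sin x != 0 by rewrite gt_eqF// sinJ_gt0//; exact: sub.
  apply: (is_derive_mul (dw x cx) (dS x sx)).
  by rewrite /p /w; move: (cos (a / sin x)) (sin (a / sin x)) => C S; move: (sin x) (cos x) sx cx => s c s0 c0; field; rewrite ?s0 ?c0.
have cS (x : R) : x0 <= x <= x1 -> {for x, continuous (fun y => a / sin y)}.
  move=> xx; have sx : sin x != 0 by rewrite gt_eqF// sinJ_gt0//; exact: sub.
  apply: cvgM; first exact: cvg_cst.
  by apply: cvgV => //; exact: continuous_sin.
have cc (x : R) : x0 <= x <= x1 -> {for x, continuous (fun y => cos (a / sin y))}.
  by move=> xx; apply: (@continuous_comp _ _ _ (fun y => a / sin y) (@cos R)); [exact: cS|exact: continuous_cos].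
have cp (x : R) : x0 <= x <= x1 -> {for x, continuous p}.
  move=> xx; have cx : cos x != 0 by rewrite gt_eqF// cosJ_gt0//; exact: sub.
  apply: cvgM; last first.
    by apply: (@continuous_comp _ _ _ (fun y => a / sin y) (@sin R)); [exact: cS|exact: continuous_sin].
  apply: cvgD; first by apply: cvgM; [exact: cvg_cst|exact: continuous_sin].
  apply: cvgM; first exact: (continuous_pow (n := 3) (@continuous_sin R)).
  apply: cvgV; first by rewrite expf_neq0.
  exact: (continuous_pow (n := 2) (@continuous_cos R)).
have within (f : R -> R) : (forall x : R, x0 <= x <= x1 -> {for x, continuous f}) ->
    {within `[x0, x1], continuous f}.
  move=> cf; apply: continuous_in_subspaceT => x; rewrite inE/= in_itv/=; exact: cf.
have integ (f : R -> R) : {within `[x0, x1], continuous f} -> mu.-integrable `[x0, x1] (EFin \o f).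
  by move=> cf; apply: continuous_compact_integrable => //; exact: segment_compact.
have FTC := @continuous_FTC2 R (fun x => p x - a * cos (a / sin x)) F x0 x1 x01.
have ip := integ _ (within _ cp); have ic := integ _ (within _ cc).
have mI : measurable (`[x0, x1]%classic : set mR) by exact: measurable_itv.
have e : (\int[mu]_(x in `[x0, x1]) p x - a * \int[mu]_(x in `[x0, x1]) cos (a / sin x) = F x1 - F x0)%R.
  rewrite -RintegralZl// -RintegralB//; last exact: integrable_realZ.
  rewrite /Rintegral FTC//.
  - by apply: within => x xx; apply: cvgB; [exact: cp|apply: cvgM; [exact: cvg_cst|exact: cc]].
  - split.
    + by move=> x; rewrite in_itv/= => /andP[? ?]; have [] := dF x; rewrite ?ltW.
    + apply: cvg_at_right_filter; apply/differentiable_continuous/derivable1_diffP.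
      by have [] := dF x0; rewrite ?lexx ?ltW.
    + apply: cvg_at_left_filter; apply/differentiable_continuous/derivable1_diffP.
      by have [] := dF x1; rewrite ?lexx ?ltW.
  - move=> x; rewrite in_itv/= => /andP[? ?]; rewrite derive1E.
    by have [] := dF x; rewrite ?ltW.
have Ip : `|\int[mu]_(x in `[x0, x1]) p x|%R <= (2 + (cos x1)^-1 ^+ 2) * (x1 - x0).
  have mu1 : mu `[x0, x1]%classic = (x1 - x0)%:E.
    by rewrite lebesgue_measure_itv/= lte_fin x01.
  have Ioo : (mu (`[x0, x1]%classic : set mR) < +oo)%E by rewrite [X in (X < _)%E]mu1 ltry.
  have mp : measurable_fun `[x0, x1] p by have /measurable_int/measurable_EFinP := ip.
  have := normr_Rintegral_le_cst mI Ioo mp (C := 2 + (cos x1)^-1 ^+ 2).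
  rewrite [X in fine X](_ : _ = (x1 - x0)%:E)//; apply => x; rewrite /= in_itv/= => xx.
  by rewrite /p normrM -[leRHS]mulr1 ler_pM// ?sin_max// w'C.
have F1 x : x0 <= x <= x1 -> `|F x| <= (cos x1)^-1.
  by move=> xx; rewrite /F normrM -[leRHS]mulr1 ler_pM// ?sin_max// wC.
rewrite ler_pdivlMr// -[X in _ * X](gtr0_norm a0) -normrM mulrC.
have -> : a * (\int[mu]_(x in `[x0, x1]) cos (a / sin x))%R =
    (\int[mu]_(x in `[x0, x1]) p x)%R - (F x1 - F x0) by rewrite -e opprB addrC subrK.
rewrite (le_trans (ler_normB _ _))// /K lerD// (le_trans (ler_normB _ _))//.
by rewrite mulr_natl mulr2n lerD// F1 ?lexx ?ltW.
Qed.

(** The phase [a / sin x] is singular at 0 and stationary at [pi / 2]. The two end pieces are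
    estimated by their length [del], the middle one by [cos_cosec_inner_bound]. *)
Lemma cosec_average_cvg0 : @cosec_average R a @[a --> +oo%R] --> (0 : R).
Proof.
have p0 : (0 : R) < pi by exact: pi_gt0.
apply/cvgrPdist_le => /= e e0.
(* With the prefactor [2 / pi], two end pieces of at most [e pi / 8] and a middle part of at most
   [e pi / 4] add up to [e]. The bound [pi / 8] keeps the middle interval nondegenerate. *)
pose del : R := Num.min (e * pi / 8) (pi / 8).
have d0 : 0 < del by rewrite lt_min !divr_gt0 ?mulr_gt0.
have de : del <= e * pi / 8 by rewrite ge_min lexx.
have dp : del <= pi / 8 by rewrite ge_min lexx orbT.
pose b : R := pi / 2 - del.
have db : del < b by rewrite /b; move: p0 dp {b d0 de}; move: (pi : R) del => q dl; lra.
have bp : b < pi / 2 by rewrite /b ltrBlDr ltrDl.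
have [K K0 hK] := cos_cosec_inner_bound d0 db bp.
near=> a.
have a0 : 0 < a by near: a; exact: nbhs_pinfty_gt.
have aK : K / a <= e * pi / 4.
  by rewrite ler_pdivrMr// mulrC -ler_pdivrMr ?divr_gt0 ?mulr_gt0//.
rewrite sub0r normrN /cosec_average normrM ger0_norm ?divr_ge0 ?(ltW p0)//.
pose f (x : R) := cos (a / sin x).
have ifJ : mu.-integrable J (EFin \o f) := integrable_cos_cosec a.
have mf (i : interval R) : [set` i] `<=` J -> measurable_fun ([set` i] : set mR) f.
  move=> iJ; apply: measurable_funS (measurable_cos_cosec a); first exact: mJ.
  exact: iJ.
have sub1 : [set` `]0%R, del]] `<=` J.
  by apply: subset_itv; rewrite bnd_simp// (lt_trans _ bp)// (lt_trans _ db).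
have bound (i : interval R) : [set` i] `<=` J -> (mu [set` i] <= del%:E)%E ->
    `|\int[mu]_(x in [set` i]) f x|%R <= del.
  move=> iJ mi; have mi' : measurable ([set` i] : set mR) by exact: measurable_itv.
  have mioo : (mu ([set` i] : set mR) < +oo)%E by rewrite (le_lt_trans mi)// ltry.
  have := normr_Rintegral_le_cst mi' mioo (mf _ iJ) (fun x _ => cos_max (a / sin x)).
  move=> h; rewrite (le_trans h)// mul1r -lee_fin fineK//.
  by rewrite ge0_fin_numE.
have E1 := @Rintegral_itvB R f (BRight 0) (BLeft (pi / 2)) del ifJ.
have E2 := @Rintegral_itvB R f (BRight del) (BLeft (pi / 2)) b.
have sub2 : [set` `]del, pi / 2[ ] `<=` J by apply: subset_itvr; rewrite bnd_simp ltW.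
have ifJ2 : mu.-integrable [set` `]del, pi / 2[ ] (EFin \o f).
  by apply: (integrableS mJ _ sub2 ifJ); exact: measurable_itv.
have {E1} := E1 _ _; rewrite !bnd_simp => /(_ (ltW d0)).
have -> : (del < pi / 2) by exact: lt_trans db bp.
move=> /(_ isT) E1.
have {E2} := E2 ifJ2; rewrite !bnd_simp => /(_ (ltW db) bp) E2.
have EJ : (\int[mu]_(x in J) f x = \int[mu]_(x in `]0, del]) f x +
    (\int[mu]_(x in `]del, b]) f x + \int[mu]_(x in `]b, pi / 2[) f x))%R.
  by rewrite -E2 [X in _ + X]addrC subrK -E1 [RHS]addrC subrK.
have Em : (\int[mu]_(x in `]del, b]) f x = \int[mu]_(x in `[del, b]) f x)%R.
  apply: Rintegral_itv_obnd_cbnd; apply: (integrableS _ _ _ ifJ2).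
  - exact: measurable_itv.
  - exact: measurable_itv.
  - by apply: subset_itvl; rewrite bnd_simp.
have le : `|\int[mu]_(x in J) f x|%R <= del + (e * pi / 4 + del).
  rewrite EJ (le_trans (ler_normD _ _))// lerD//.
    by apply: bound => //; rewrite lebesgue_measure_itv/= lte_fin d0 sube0.
  rewrite (le_trans (ler_normD _ _))// lerD//.
    by rewrite Em (le_trans (hK _ a0)).
  apply: bound; first by apply: subset_itvr; rewrite bnd_simp (le_trans (ltW d0) (ltW db)).
  by rewrite lebesgue_measure_itv/= lte_fin bp -EFinB lee_fin /b; lra.
rewrite (@le_trans _ _ (2 / pi * (del + (e * pi / 4 + del))))//.
  by rewrite ler_wpM2l// divr_ge0// ltW.
rewrite mulrAC ler_pdivrMr//; move: p0 de; move: (pi : R) => q q0 de; lra.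
Unshelve. all: by end_near.
Qed.

(** Dominated convergence along sequences: for each [x] of the open interval [u sin x] tends to
    infinity with [u]. *)
Lemma sphere_multiplier_cvg0 n : @sphere_multiplier R n u @[u --> +oo%R] --> (0 : R).
Proof.
apply/cvg_pinftyP => u uoo.
have u0 : \forall k \near \oo, 0 <= u k by move: uoo => /cvgryPge; exact.
(* Measurability of the integrand is known for nonnegative parameters, hence the maximum with 0,
   which is eventually [u k]. *)
have hmax : (fun k => sphere_multiplier n (Num.max (u k) 0)) @ \oo --> (0 : R).
  rewrite /sphere_multiplier [X in _ --> X](_ : 0 = (wc n)^-1 * (\int[mu]_(x in J) (0 : R))%R); last first.
    by rewrite Rintegral_cst// mul0r mulr0.
  apply: cvgM; first exact: cvg_cst.
  apply: (Rintegral_dominated_cst mJ Joo (C := 1)) => [k|k x _|x Jx].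
  - by apply: measurable_sphere_integrand; rewrite le_max lexx orbT.
  - exact: sphere_integrand_le1.
  - suff : cos x ^+ n * cosec_average (Num.max (u k) 0 * sin x) @[k --> \oo] --> cos x ^+ n * (0 : R).
      by rewrite mulr0.
    apply: cvgM; first exact: cvg_cst.
    move: (cosec_average_cvg0) => /cvg_pinftyP; apply.
    apply/cvgryPge => A; move: uoo => /cvgryPge /(_ (A / sin x)).
    apply: filterS => k; have sx := sinJ_gt0 Jx.
    rewrite ler_pdivrMr// => h; rewrite (le_trans h)// ler_wpM2r ?(ltW sx)//.
    by rewrite le_max lexx.
apply: cvg_trans hmax; apply: near_eq_cvg; near=> k.
by rewrite max_l//; near: k.
Unshelve. all: by end_near.
Qed.

End multiplier_limit.

(** * Bessel functions *)

Section bessel_integral.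
Context {R : realType}.
Local Notation mu := (@lebesgue_measure R).
Local Notation mR := (measurableTypeR R).

Definition bessel_const n : R :=
  2 `^ (n.+1%:R / 2) * Gamma ((n.+1%:R + 1) / 2) / Num.sqrt pi.

Definition bessel_integrand n (r : R) : R :=
  r `^ (- (n.+1%:R / 2)) * besselJ (n.+1%:R / 2) r.

Lemma bessel_const_gt0 n : 0 < bessel_const n.
Proof.
rewrite /bessel_const divr_gt0 ?mulr_gt0 ?powR_gt0 ?sqrtr_gt0 ?pi_gt0//.
by rewrite natr1 Gamma_gt0.
Qed.

Lemma normr_series_limit_le (h b : nat -> R) (l : R) : (forall k, `|h k| <= b k) ->
  cvgn (series b) -> series h @ \oo --> l -> `|l| <= limn (series b).
Proof.
move=> hb cb hl; apply: (cvgr_to_le (cvg_norm hl)); apply: nearW => m.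
rewrite (le_trans (ler_norm_sum _ _ _))// (@le_trans _ _ (series b m))//.
  by apply: ler_sum => k _; exact: hb.
apply: nondecreasing_cvgn_le => //; apply: nondecreasing_series => k _ _.
exact: le_trans (hb k).
Qed.

(** The factors [2^((n+1)/2)] and [r^(-(n+1)/2)] cancel the fractional power of [r / 2], so an even
    power of [r] is left; its coefficient is given by [Gamma_mult_coef]. *)
Lemma besselJ_term n k (r : R) : 0 < r ->
  bessel_const n * r `^ (- (n.+1%:R / 2)) *
    ((-1) ^+ k / (Gamma (k%:R + n.+1%:R / 2 + 1) * k`!%:R) * (r / 2) `^ (2 * k%:R + n.+1%:R / 2)) =
  (-1) ^+ k * (k.*2.+1%:R * mult_coef n k) * r ^+ k.*2.
Proof.
move=> r0; have r2 : 0 < r / 2 by rewrite divr_gt0.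
set a : R := n.+1%:R / 2.
have -> : Gamma (k%:R + a + 1) = Gamma ((k.*2 + n).+3%:R / 2) :> R.
  congr Gamma; rewrite /a -addn3 !natrD -mul2n natrM -natr1; by field.
rewrite powRD; last by rewrite (gt_eqF r2) implybT.
rewrite -natrM mul2n powR_mulrn ?(ltW r2)//.
have E : 2 `^ a * (r / 2) `^ a * r `^ (- a) = 1.
  rewrite -powRM ?(ltW r2)// powRN mulrCA divff ?mulr1 ?divff//.
  by rewrite gt_eqF// powR_gt0.
have := @Gamma_mult_coef R n k; rewrite /bessel_const natr1 -/a.
have Gk : Gamma ((k.*2 + n).+3%:R / 2) != 0 :> R by rewrite gt_eqF// Gamma_gt0.
have k0 : k`!%:R != 0 :> R by rewrite pnatr_eq0 -lt0n fact_gt0.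
have s0 : Num.sqrt pi != 0 :> R by rewrite gt_eqF// sqrtr_gt0 pi_gt0.
have -> : (r / 2) ^+ k.*2 = r ^+ k.*2 / 4 ^+ k :> R.
  by rewrite expr_div_n -[in X in _ / X]mul2n exprM expr2 -natrM.
have q0 : 4 ^+ k != 0 :> R by rewrite expf_neq0.
move: (Gamma ((k.*2 + n).+3%:R / 2)) (Gamma (n.+2%:R / 2)) (k`!%:R : R) Gk k0 => G G' f G0 f0 e.
transitivity ((-1) ^+ k * (2 `^ a * (r / 2) `^ a * r `^ (- a)) * (G' / Num.sqrt pi) / (G * f * 4 ^+ k) * r ^+ k.*2).
  move: (2 `^ a) ((r / 2) `^ a) (r `^ (- a)) (4 ^+ k : R) q0 (Num.sqrt pi : R) s0 => A B C q q0 s s0.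
  by field; rewrite G0 f0 q0 s0.
rewrite E e; move: (4 ^+ k : R) q0 => q q0; move: (k.*2.+1%:R * _) => x.
by field; rewrite G0 f0 q0.
Qed.

(** The factor [2k + 1] is harmless, as [(2k + 1) / (2k + 1)! = 1 / (2k)! <= 1 / k!]. *)
Lemma cvg_bessel_bound n (r : R) : cvgn (series (fun k => k.*2.+1%:R * mult_coef n k * r ^+ k.*2)).
Proof.
apply: (cvg_sqr_series (C := pi / 2 / wc n)) => k.
rewrite mulr_ge0 ?mult_coef_ge0//=.
have C0 : 0 <= pi / 2 / wc n :> R by rewrite !divr_ge0 ?pi_ge0// ltW// wc_gt0.
rewrite (le_trans (ler_wpM2l _ (mult_coef_le n k)))//.
rewrite mulrCA ler_wpM2l// factS natrM invfM mulrA divff ?mul1r ?pnatr_eq0//.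
by rewrite lef_pV2 ?posrE ?ltr0n ?fact_gt0// ler_nat leq_fact// -addnn leq_addr.
Qed.

(** [besselJ] is a [limn], which carries information only once convergence is known; absolute
    convergence comes from [cvg_bessel_bound]. *)
Lemma bessel_series n (r : R) : 0 < r ->
  series (fun k => (-1) ^+ k * (k.*2.+1%:R * mult_coef n k) * r ^+ k.*2) @ \oo -->
  bessel_const n * bessel_integrand n r.
Proof.
move=> r0; set h := fun k => _.
have ch : cvgn (series h).
  apply: normed_cvg; rewrite /normed_series_of/=.
  rewrite (_ : series _ = series (fun k => k.*2.+1%:R * mult_coef n k * r ^+ k.*2)).
    exact: cvg_bessel_bound.
  congr series; apply/funext => k.
  have P0 : 0 <= k.*2.+1%:R * mult_coef n k :> R by rewrite mulr_ge0 ?mult_coef_ge0.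
  rewrite /h normrM [X in X * _]normrM normrX normrN1 expr1n mul1r normrX (gtr0_norm r0).
  by rewrite (ger0_norm P0).
set c := bessel_const n * r `^ (- (n.+1%:R / 2)).
have c0 : c != 0 by rewrite mulf_neq0 ?gt_eqF ?bessel_const_gt0 ?powR_gt0.
rewrite /bessel_integrand mulrA -/c.
suff -> : besselJ (n.+1%:R / 2) r = c^-1 * limn (series h) by rewrite mulVKf.
apply/cvg_lim => //.
rewrite (_ : series _ = fun m => c^-1 * series h m); first by apply: cvgM; [exact: cvg_cst|exact: ch].
apply/funext => m; rewrite /series/= big_distrr/=; apply: eq_bigr => k _.
by rewrite /h -besselJ_term// -/c mulKf.
Qed.

(** Term by term, [(2k + 1) r^(2k)] integrates to [r^(2k+1)], and the resulting series is the one of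
    [sphere_multiplier_series]. The open interval ensures [r > 0], the value at 0 being a convention
    when [a = 0]. *)
Lemma bessel_integral n (a b : R) : 0 <= a -> a <= b ->
  bessel_const n * (\int[mu]_(r in `[a, b]) bessel_integrand n r)%R =
  sphere_multiplier n a - sphere_multiplier n b.
Proof.
move=> a0 ab; have b0 := le_trans a0 ab.
pose I : set mR := `]a, b[%classic.
have mI : measurable I by exact: measurable_itv.
have Ioo : (mu I < +oo)%E.
  by rewrite /I lebesgue_measure_itv/= lte_fin; case: ifP => _; rewrite ?ltry// -EFinB ltry.
have I0 (r : R) : I r -> 0 < r < b.
  by rewrite /I/= in_itv/= => /andP[ar ->]; rewrite (le_lt_trans a0).
have C0 : bessel_const n != 0 by rewrite gt_eqF// bessel_const_gt0.
pose h k (r : R) := (-1) ^+ k * (k.*2.+1%:R * mult_coef n k) * r ^+ k.*2.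
have mh k : measurable_fun I (h k).
  by apply: measurable_funTS; apply: measurable_funM => //; exact: measurable_funX.
have hH (r : R) : I r -> series (h ^~ r) @ \oo --> bessel_const n * bessel_integrand n r.
  by move=> /I0/andP[r0 _]; exact: bessel_series.
have mH : measurable_fun I (fun r => bessel_const n * bessel_integrand n r).
  apply: (@measurable_fun_cvg _ _ _ I (fun m r => series (h ^~ r) m)) => //.
  by move=> m; rewrite /series/=; apply: measurable_sum => k; exact: mh.
have mB : measurable_fun I (bessel_integrand n).
  rewrite (_ : bessel_integrand n = fun r => (bessel_const n)^-1 * (bessel_const n * bessel_integrand n r)).
    by apply: measurable_funM.
  by apply/funext => r; rewrite mulKf.
have hb k (r : R) : I r -> `|h k r| <= k.*2.+1%:R * mult_coef n k * b ^+ k.*2.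
  move=> /I0/andP[r0 rb].
  have P0 : 0 <= k.*2.+1%:R * mult_coef n k :> R by rewrite mulr_ge0 ?mult_coef_ge0.
  rewrite /h normrM [X in X * _]normrM normrX normrN1 expr1n mul1r normrX (gtr0_norm r0).
  by rewrite (ger0_norm P0) ler_wpM2l// lerXn2r ?nnegrE ?(ltW r0) ?(ltW rb).
have h1 := Rintegral_series mI Ioo mh (b := fun k => k.*2.+1%:R * mult_coef n k * b ^+ k.*2) _ _
  (@cvg_bessel_bound n b) hH.
have {}h1 : series (fun k => \int[mu]_(r in I) h k r)%R @ \oo -->
    (\int[mu]_(r in I) (bessel_const n * bessel_integrand n r))%R.
  apply: h1 => [k r Ir|k]; first exact: hb.
  by rewrite mulr_ge0 ?exprn_ge0// mulr_ge0 ?mult_coef_ge0.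
have E : (\int[mu]_(r in I) (bessel_const n * bessel_integrand n r))%R =
    sphere_multiplier n a - sphere_multiplier n b.
  apply: (cvg_unique _ h1) => //=.
  have -> : sphere_multiplier n a - sphere_multiplier n b =
    1 - sphere_multiplier n b - (1 - sphere_multiplier n a) :> R by move: (sphere_multiplier n b) => y; ring.
  rewrite (_ : series _ = fun m => series (fun k => (-1) ^+ k * mult_coef n k * b ^+ k.*2.+1) m -
      series (fun k => (-1) ^+ k * mult_coef n k * a ^+ k.*2.+1) m).
    by apply: cvgB; exact: sphere_multiplier_series.
  apply/funext => m; rewrite /series/= -sumrB; apply: eq_bigr => k _.
  rewrite /h RintegralZl//; last first.
    apply: (integrable_bounded mI Ioo (C := b ^+ k.*2)).
      by apply: measurable_funTS; exact: measurable_funX.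
    move=> r /I0/andP[r0 rb].
    by rewrite normrX (gtr0_norm r0) lerXn2r ?nnegrE ?(ltW r0) ?(ltW rb).
  have k0 : k.*2.+1%:R != 0 :> R by rewrite pnatr_eq0.
  have dF (x : R) : is_derive x (1 : R) (fun y => k.*2.+1%:R^-1 * y ^+ k.*2.+1) (x ^+ k.*2).
    apply: (is_derive_mul (is_derive_const _ x) (is_derive_pow (n := k.*2.+1) (is_derive_id x 1) erefl)).
    by rewrite /= mulr1 mulr0 addr0 mulrA mulVf// mul1r.
  rewrite /Rintegral /I (integral_FTCoo ab dF)/=; last first.
    by apply: (continuous_pow (f := id)); move=> x; exact: cvg_id.
  by field.
have iH : mu.-integrable I (EFin \o (fun r => bessel_const n * bessel_integrand n r)).
  apply: (integrable_bounded mI Ioo mH (C := limn (series (fun k => k.*2.+1%:R * mult_coef n k * b ^+ k.*2)))).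
  move=> r Ir; apply: (normr_series_limit_le _ (@cvg_bessel_bound n b) (hH r Ir)) => k.
  exact: hb.
have iB : mu.-integrable I (EFin \o bessel_integrand n).
  rewrite (_ : bessel_integrand n = fun r => (bessel_const n)^-1 * (bessel_const n * bessel_integrand n r)).
    exact: integrable_realZ.
  by apply/funext => r; rewrite mulKf.
rewrite -E RintegralZl//; congr (_ * _).
rewrite /Rintegral; congr fine; rewrite (@integral_itv_bndoo R a b _ true false)//.
exact/measurable_EFinP.
Qed.

(** The improper integral converges because [sphere_multiplier] vanishes at infinity, and the
    contribution of the lower end is left. *)
Lemma m_multE n (u : R) : 0 <= u -> m_mult n.+1 u = sphere_multiplier n (2 * pi * u).
Proof.
move=> u0; have a0 : 0 <= 2 * pi * u by rewrite !mulr_ge0// pi_ge0.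
have C0 : bessel_const n != 0 by rewrite gt_eqF// bessel_const_gt0.
rewrite /m_mult -/(bessel_const n).
suff h : (\int[mu]_(r in `[(2 * pi * u)%R, b]) bessel_integrand n r)%R @[b --> +oo%R] -->
    (bessel_const n)^-1 * sphere_multiplier n (2 * pi * u).
  by rewrite (cvg_lim _ h)// mulVKf.
have h : (bessel_const n)^-1 * (sphere_multiplier n (2 * pi * u) - sphere_multiplier n b) @[b --> +oo%R] -->
    (bessel_const n)^-1 * (sphere_multiplier n (2 * pi * u) - 0).
  apply: cvgM; first exact: cvg_cst.
  by apply: cvgB; [exact: cvg_cst|exact: sphere_multiplier_cvg0].
move: h; rewrite subr0; apply: cvg_trans; apply: near_eq_cvg; near=> b.
by rewrite -bessel_integral// mulKf.
Unshelve. all: by end_near.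
Qed.

End bessel_integral.

(** * The hypergeometric function as an average *)

Section sphere_average.
Context {R : realType}.
Local Notation mu := (@lebesgue_measure R).
Local Notation J := (`]0%R, ((pi : R) / 2)%R[%classic : set R).
Local Notation mR := (measurableTypeR R).
Let mJ : measurable (J : set mR). Proof. exact: measurable_itv. Qed.
Let Joo : (mu (J : set mR) < +oo)%E. Proof. by rewrite [X in (X < _)%E]lebesgue_J ltry. Qed.

Let sqr_sin_le1 (x : R) : sin x ^+ 2 <= 1.
Proof. by rewrite -(cos2Dsin2 x) lerDr sqr_ge0. Qed.

Let oneB_gt0 (y x : R) : 0 <= y < 1 -> 0 < 1 - y * sin x ^+ 2.
Proof.
move=> /andP[y0 y1]; rewrite subr_gt0 (le_lt_trans _ y1)// ler_piMr// sqr_sin_le1.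
Qed.

Lemma integral_oneB_sqr_sin (y : R) : 0 <= y < 1 ->
  (\int[mu]_(x in J) ((1 - y * sin x ^+ 2)^-1)%:E = (pi / 2 / Num.sqrt (1 - y))%:E)%E.
Proof.
move=> y01; have /andP[y0 y1] := y01; have y2 : 0 < 1 - y by rewrite subr_gt0.
have b0 : 0 < Num.sqrt (1 - y) by rewrite sqrtr_gt0.
have := integral_trig_kernel b0; rewrite sqr_sqrtr ?ltW// => e.
have mf : measurable_fun J (fun x : R => ((1 - y * sin x ^+ 2)^-1)%:E).
  apply/measurable_EFinP; apply: measurable_funTS.
  apply: (measurableT_comp (@measurable_invr R)); apply: measurable_funB => //.
  apply: measurable_funM => //; apply: measurable_funX.
  exact: continuous_measurable_fun (@continuous_sin R).
have E (x : R) : (1 - y * sin x ^+ 2)^-1 = (Num.sqrt (1 - y))^-1 *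
    (Num.sqrt (1 - y) / (cos x ^+ 2 + (1 - y) * sin x ^+ 2)).
  by rewrite mulKf ?gt_eqF//; congr (_^-1); rewrite -[1 in LHS](cos2Dsin2 x); ring.
under eq_integral do rewrite E EFinM.
rewrite ge0_integralZl//.
- by rewrite e -EFinM mulrC.
- apply: (@eq_measurable_fun _ _ _ _ J (fun x : R => (Num.sqrt (1 - y) * (1 - y * sin x ^+ 2)^-1)%:E)).
    by move=> x _; rewrite E mulVKf// gt_eqF.
  by apply/measurable_EFinP; apply: measurable_funM => //; exact/measurable_EFinP.
- move=> x _; rewrite lee_fin divr_ge0 ?(ltW b0)// addr_ge0 ?sqr_ge0//.
  by rewrite mulr_ge0 ?sqr_ge0 ?(ltW y2).
Qed.

(** The binomial series: [(1 - y)^(-1/2)] is the mean of [1 / (1 - y sin^2)], whose geometric series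
    is integrated term by term. *)
Lemma inv_sqrt_series (y : R) : 0 <= y < 1 ->
  series (fun k => 2 / pi * sin_cos_moment k.*2 0 * y ^+ k) @ \oo --> (Num.sqrt (1 - y))^-1.
Proof.
move=> y01; have /andP[y0 y1] := y01.
have p0 : pi != 0 :> R by rewrite gt_eqF// pi_gt0.
have -> : (Num.sqrt (1 - y))^-1 = 2 / pi * (\int[mu]_(x in J) (1 - y * sin x ^+ 2)^-1)%R.
  rewrite /Rintegral integral_oneB_sqr_sin//=.
  by move: p0; move: (pi : R) => q q0; rewrite mulrA [2 / q * _](_ : _ = 1) ?mul1r//; field.
rewrite (_ : series _ = fun m => 2 / pi *
    series (fun k => \int[mu]_(x in J) (y ^+ k * (sin x ^+ k.*2 * cos x ^+ 0)))%R m); last first.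
  apply/funext => m; rewrite /series/= big_distrr/=; apply: eq_bigr => k _.
  rewrite RintegralZl//; last exact: integrable_sin_cos.
  by rewrite -/(sin_cos_moment _ _); ring.
apply: cvgM; first exact: cvg_cst.
apply: (Rintegral_series mJ Joo (b := fun k => y ^+ k)) => [k|k x _|k||x Jx].
- by apply: measurable_funM => //; exact: measurable_sin_cos.
- rewrite normrM normrX (ger0_norm y0) ler_piMr ?exprn_ge0//; exact: sin_cos_norm_le1.
- exact: exprn_ge0.
- rewrite (_ : (fun k => y ^+ k) = geometric 1 y).
    by apply: is_cvg_geometric_series; rewrite ger0_norm.
  by apply/funext => k; rewrite /geometric/= mul1r.
- have ys : `|y * sin x ^+ 2| < 1.
    rewrite ger0_norm ?(mulr_ge0 y0 (sqr_ge0 (sin x)))//.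
    by have := oneB_gt0 x y01; rewrite subr_gt0.
  rewrite (_ : series _ = series (geometric 1 (y * sin x ^+ 2))); last first.
    by congr series; apply/funext => k; rewrite /geometric/= mul1r expr0 mulr1 exprMn -exprM mul2n.
  by have := @cvg_geometric_series _ 1 _ ys; rewrite mul1r.
Qed.

Lemma pochhammerS (q : R) k : pochhammer q k.+1 = pochhammer q k * (q + k%:R).
Proof. by rewrite /pochhammer big_ord_recr. Qed.

Lemma pochhammer_gt0 (q : R) k : 0 < q -> 0 < pochhammer q k.
Proof. by move=> q0; apply: prodr_gt0 => i _; rewrite ltr_pwDl. Qed.

Lemma pochhammer_half k : pochhammer (1 / 2) k / k`!%:R = 2 / pi * sin_cos_moment k.*2 0 :> R.
Proof.
have p0 : pi != 0 :> R by rewrite gt_eqF// pi_gt0.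
elim: k => [|k IH].
  rewrite sin_cos_moment0 wc0 /pochhammer big_ord0 fact0 divr1.
  by move: p0; move: (pi : R) => q q0; field.
have := @sin_cos_moment_rec R k.*2 0; rewrite addn0 doubleS => rec.
have k2 : k.*2.+2%:R = 2 * k.+1%:R :> R by rewrite -doubleS -mul2n natrM.
have k1 : k.+1%:R != 0 :> R by rewrite pnatr_eq0.
have f0 : k`!%:R != 0 :> R by rewrite pnatr_eq0 -lt0n fact_gt0.
have -> : sin_cos_moment k.*2.+2 0 = (2 * k.+1%:R)^-1 * (k.*2.+1%:R * sin_cos_moment k.*2 0) :> R.
  by rewrite -rec k2 mulKf// mulf_neq0.
rewrite mulrCA [2 / pi * (_ * _)]mulrCA -IH pochhammerS factS natrM.
have -> : (1 / 2 + k%:R) = k.*2.+1%:R / 2 :> R by rewrite -[k.*2.+1]addn1 natrD -mul2n natrM; field.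
move: (k.+1%:R : R) (k.*2.+1%:R : R) (k`!%:R : R) k1 f0 => a b f a0 f0.
by field; rewrite a0 f0.
Qed.

(** Both sides obey the two-step recurrence of the sine moments; at [k = 0] the claim is the
    equality of sine and cosine moments. *)
Lemma pochhammer_ratio n k :
  wc n.+1 * (pochhammer ((1 + n.+1%:R) / 2) k / pochhammer ((2 + n.+1%:R) / 2) k) =
  sin_cos_moment (k.*2 + n.+1) 0 :> R.
Proof.
elim: k => [|k IH].
  rewrite /pochhammer !big_ord0 divr1 mulr1 add0n.
  suff : sin_cos_moment n 0 = wc n :> R /\ sin_cos_moment n.+1 0 = wc n.+1 :> R by case.
  elim: n => [|m [IH1 IH2]].
    by rewrite sin_cos_moment0 sin_cos_moment1 wc1 invr1.
  split=> //; have := @sin_cos_moment_rec R m 0; rewrite addn0 IH1 -wc_rec.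
  by apply: mulfI; rewrite pnatr_eq0.
have := @sin_cos_moment_rec R (k.*2 + n.+1) 0; rewrite addn0 -IH => rec.
have c0 : pochhammer ((2 + n.+1%:R) / 2) k != 0 :> R by rewrite gt_eqF// pochhammer_gt0// divr_gt0// ltr_pwDl.
have s0 : (k.*2 + n.+1).+2%:R != 0 :> R by rewrite pnatr_eq0.
rewrite doubleS !addSn; apply: (mulfI s0); rewrite rec !pochhammerS.
have -> : (1 + n.+1%:R) / 2 + k%:R = (k.*2 + n.+1).+1%:R / 2 :> R.
  by rewrite -[(_ + _).+1]addn1 !natrD -mul2n natrM; field.
have E : (2 + n.+1%:R) / 2 + k%:R = (k.*2 + n.+1).+2%:R / 2 :> R.
  by rewrite -[(_ + _).+2]addn2 !natrD -mul2n natrM; field.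
rewrite E; move: s0 c0.
move: ((k.*2 + n.+1).+2%:R : R) ((k.*2 + n.+1).+1%:R : R) (pochhammer _ _) (pochhammer _ _).
by move=> s s' P P' s0 c0; field; rewrite s0 c0.
Qed.

(** Extended-real valued because the integral is infinite at [z = 1], where the integrand is
    [sin^(n+1) / cos]. For [z > 1] the cut-off in [hp] restricts the integral to
    [sin x < z^(-1/2)]. *)
Definition sphere_avg n (z : R) : \bar R :=
  (\int[mu]_(x in J) (sin x ^+ n.+1 * hp 0 (1 - z * sin x ^+ 2))%:E)%E.

Lemma hp0E (A : R) : 0 < A -> hp 0 A = (Num.sqrt A)^-1.
Proof. by move=> A0; rewrite /hp A0 expr0 mul1r. Qed.

Lemma measurable_sphere_avg_integrand n :
  measurable_fun [set: R * R] (fun p : R * R => sin p.2 ^+ n.+1 * hp 0 (1 - p.1 * sin p.2 ^+ 2)).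
Proof.
have ms : measurable_fun [set: R * R] (fun p : R * R => sin p.2).
  by apply: (measurableT_comp (continuous_measurable_fun (@continuous_sin R))).
apply: measurable_funM; first exact: measurable_funX.
apply: (measurableT_comp (measurable_hp 0)); apply: measurable_funB => //.
by apply: measurable_funM => //; exact: measurable_funX.
Qed.

Lemma sphere_avg_integrand_ge0 n (z x : R) : J x ->
  0 <= sin x ^+ n.+1 * hp 0 (1 - z * sin x ^+ 2).
Proof. by move=> Jx; rewrite mulr_ge0 ?hp_ge0// exprn_ge0// ltW// sinJ_gt0. Qed.

(** Expands [inv_sqrt_series] at [z sin^2] and integrates against [sin^(n+1)]: the quotient
    [(1/2)_k / k!] is the binomial coefficient, the other Pochhammer quotient is the moment. *)
Lemma sphere_avg_hyp2F1 n (z : R) : 0 <= z < 1 ->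
  sphere_avg n z =
  (wc n.+1 * hyp2F1 (1 / 2) ((1 + n.+1%:R) / 2) ((2 + n.+1%:R) / 2) z)%:E.
Proof.
move=> z01; have /andP[z0 z1] := z01.
pose f (x : R) := sin x ^+ n.+1 * hp 0 (1 - z * sin x ^+ 2).
have mf : measurable_fun J f.
  apply: measurable_funTS.
  exact: (measurableT_comp (measurable_sphere_avg_integrand n) (measurable_pair1 z)).
have fC (x : R) : J x -> `|f x| <= (Num.sqrt (1 - z))^-1.
  move=> Jx; rewrite /f hp0E ?oneB_gt0// normrM -[leRHS]mul1r ler_pM//.
    by rewrite normrX exprn_ile1// sin_max.
  rewrite ger0_norm ?invr_ge0 ?sqrtr_ge0// lef_pV2 ?posrE ?sqrtr_gt0 ?subr_gt0//; last first.
    by have := oneB_gt0 x z01; rewrite subr_gt0.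
  by rewrite ler_wsqrtr// lerD2l lerN2 ler_piMr.
have fi := integrable_bounded mJ Joo mf fC.
suff -> : wc n.+1 * hyp2F1 (1 / 2) ((1 + n.+1%:R) / 2) ((2 + n.+1%:R) / 2) z = (\int[mu]_(x in J) f x)%R.
  by rewrite /Rintegral fineK//; exact: integrable_fin_num.
pose c k : R := 2 / pi * sin_cos_moment k.*2 0.
have c01 k : 0 <= c k <= 1.
  have p0 := pi_gt0 R; rewrite /c mulr_ge0 ?divr_ge0 ?(ltW p0) ?sin_cos_moment_ge0//=.
  rewrite (@le_trans _ _ (2 / pi * (pi / 2)))//.
    by rewrite ler_wpM2l ?sin_cos_moment_le// divr_ge0// ltW.
  by move: p0; move: (pi : R) => q q0; rewrite le_eqVlt; apply/orP; left; apply/eqP; field; rewrite gt_eqF.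
have h : series (fun k => \int[mu]_(x in J) (c k * z ^+ k * (sin x ^+ (k.*2 + n.+1) * cos x ^+ 0)))%R
    @ \oo --> (\int[mu]_(x in J) f x)%R.
  apply: (Rintegral_series mJ Joo (b := fun k => z ^+ k)) => [k|k x _|k||x Jx].
  - by apply: measurable_funM => //; exact: measurable_sin_cos.
  - have /andP[c0 c1] := c01 k.
    rewrite normrM -[leRHS]mulr1 ler_pM ?sin_cos_norm_le1// ger0_norm ?(mulr_ge0 c0 (exprn_ge0 k z0))//.
    by rewrite ler_piMl// exprn_ge0.
  - exact: exprn_ge0.
  - rewrite (_ : (fun k => z ^+ k) = geometric 1 z).
      by apply: is_cvg_geometric_series; rewrite ger0_norm.
    by apply/funext => k; rewrite /geometric/= mul1r.
  - have zx : 0 <= z * sin x ^+ 2 < 1.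
      by rewrite mulr_ge0 ?sqr_ge0//=; have := oneB_gt0 x z01; rewrite subr_gt0.
    rewrite /f hp0E ?oneB_gt0//.
    rewrite (_ : series _ = fun m => sin x ^+ n.+1 * series (fun k => c k * (z * sin x ^+ 2) ^+ k) m).
      by apply: cvgM; [exact: cvg_cst|exact: inv_sqrt_series].
    apply/funext => m; rewrite /series/= big_distrr/=; apply: eq_bigr => k _.
    by rewrite expr0 mulr1 exprMn -exprM mul2n exprD; ring.
have w0 : wc n.+1 != 0 :> R by rewrite gt_eqF// wc_gt0.
suff -> : hyp2F1 (1 / 2) ((1 + n.+1%:R) / 2) ((2 + n.+1%:R) / 2) z = (wc n.+1)^-1 * (\int[mu]_(x in J) f x)%R.
  by rewrite mulVKf.
apply/cvg_lim => //.
rewrite (_ : series _ = fun m => (wc n.+1)^-1 *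
    series (fun k => \int[mu]_(x in J) (c k * z ^+ k * (sin x ^+ (k.*2 + n.+1) * cos x ^+ 0)))%R m).
  by apply: cvgM; [exact: cvg_cst|exact: h].
apply/funext => m; rewrite /series/= big_distrr/=; apply: eq_bigr => k _.
rewrite RintegralZl//; last exact: integrable_sin_cos.
rewrite -/(sin_cos_moment _ _) -pochhammer_ratio /c -pochhammer_half.
by rewrite [wc n.+1 * _]mulrC [X in _ = _ * X]mulrA [RHS]mulrC mulfK//; ring.
Qed.

(** This inversion explains the two branches of [phi]. As an even integral over the line in the
    variable [sin x], the integrand contains [(1 - x^2)_+^(-1/2) (1 - z x^2)_+^(-1/2)]; for
    [z = q^-2] the dilation [x -> q x] exchanges the two factors up to replacing [z] by [q^2], and
    [|x|^(n+1) dx] gives the power of [q]. *)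
Lemma sphere_avgV n (q : R) : 0 < q ->
  sphere_avg n (q ^+ 2)^-1 = ((q ^+ n.+2)%:E * sphere_avg n (q ^+ 2))%E.
Proof.
move=> q0; have qn : q != 0 by rewrite gt_eqF.
pose K (z x : R) := ((`|x| ^+ n.+1 * hp 0 (1 - z * x ^+ 2))%:E)%E.
have mK z : measurable_fun [set: R] (K z).
  apply/measurable_EFinP; apply: measurable_funM; first by apply: measurable_funX; exact: normr_measurable.
  apply: (measurableT_comp (measurable_hp 0)); apply: measurable_funB => //.
  by apply: measurable_funM => //; exact: measurable_funX.
have K0 z x : (0 <= K z x)%E by rewrite lee_fin mulr_ge0 ?exprn_ge0 ?hp_ge0.
have KE z : (\int[mu]_x ((hp 0 (1 - x ^+ 2))%:E * K z x) = 2%:E * sphere_avg n z)%E.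
  rewrite integral_hp_weight//; last by move=> x; rewrite /K normrN sqrrN.
  congr (_ * _)%E; apply: eq_integral => x; rewrite inE => Jx.
  by rewrite expr0 mul1e /K (gtr0_norm (sinJ_gt0 Jx)).
have two : (0 < 2%:E :> \bar R)%E by rewrite lte_fin.
have inj (a b : \bar R) : (2%:E * a = 2%:E * b)%E -> a = b.
  move=> /(congr1 (fun z => (2^-1%:E * z)%E)); rewrite !muleA -EFinM mulVf ?mul1e//.
apply: inj; rewrite -KE [in RHS]muleCA -KE.
have mH z : measurable_fun [set: R] (fun x : R => ((hp 0 (1 - x ^+ 2))%:E * K z x)%E).
  by apply: emeasurable_funM => //; apply/measurable_EFinP; exact: measurable_hpB.
have H0 x : (0 <= (hp 0 (1 - x ^+ 2))%:E * K ((q ^+ 2)^-1)%R x)%E by rewrite mule_ge0// lee_fin hp_ge0.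
have := @ge0_integral_affine R q 0 _ qn (mH _) H0.
rewrite (gtr0_norm q0) => /(congr1 (fun z => (q%:E * z)%E)).
rewrite [RHS]muleA -EFinM divff// mul1e => <-.
have -> : (q ^+ n.+2)%:E = (q%:E * (q ^+ n.+1)%:E)%E by rewrite -EFinM -exprS.
rewrite -muleA; congr (_ * _)%E.
rewrite -ge0_integralZl//; [| |by move=> x _; rewrite mule_ge0// lee_fin hp_ge0|by rewrite lee_fin exprn_ge0 ?ltW].
  apply: eq_integral => x _; rewrite addr0 /K -!EFinM; congr EFin.
  rewrite normrM (gtr0_norm q0) !exprMn mulKf ?expf_neq0//; ring.
exact: mH.
Qed.

(** Gamma at [(m + 1)/2] is [pi^((m+1)/2) / wprod 0 m], the classical formula for the area of a
    sphere. All powers of pi but one cancel. *)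
Lemma phi_const n :
  Gamma ((1 + n.+1%:R) / 2) ^+ 2 / (pi `^ (1 + n.+1%:R / 2) * Gamma (1 + n.+1%:R / 2)) =
  2 / pi * wc n.+1 / wprod 0 n.+1 :> R.
Proof.
have p0 : 0 < pi :> R by exact: pi_gt0.
have s0 : Num.sqrt pi != 0 :> R by rewrite gt_eqF// sqrtr_gt0.
have s2 : Num.sqrt pi ^+ 2 = pi :> R by rewrite sqr_sqrtr// ltW.
have w0 : wc n.+1 != 0 :> R by rewrite gt_eqF// wc_gt0.
have G m : Gamma (m.+1%:R / 2) = Num.sqrt pi ^+ m.+1 / wprod 0 m :> R.
  have P0 : wprod 1 m.+1 != 0 :> R by rewrite gt_eqF// wprod_gt0.
  have m0 : m.+1%:R != 0 :> R by rewrite pnatr_eq0.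
  rewrite GammaE wprodS; move: (_ ^+ _) (wprod 1 m.+1) (m.+1%:R : R) P0 m0 => S P a P0 a0.
  by field; rewrite P0 a0.
have -> : (1 + n.+1%:R) / 2 = n.+2%:R / 2 :> R by rewrite -[n.+2]add1n natrD.
have -> : 1 + n.+1%:R / 2 = n.+3%:R / 2 :> R.
  by rewrite -[n.+3]addn2 natrD mulrDl [X in _ = X + _]mulrC; field.
rewrite !G {2}/wprod big_ord_recr/= -/(wprod 0 n.+1) add0n.
have W0 : wprod 0 n.+1 != 0 :> R by rewrite gt_eqF// wprod_gt0.
have -> : pi `^ (n.+3%:R / 2) = Num.sqrt pi ^+ n.+3 :> R.
  by rewrite -powR12_sqrt ?(ltW p0)// -powR_mulrn ?powR_ge0// -powRrM mulrC.
rewrite -[X in _ = 2 / X * _ / _]s2.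
have -> : Num.sqrt pi ^+ n.+3 = Num.sqrt pi ^+ 2 * Num.sqrt pi ^+ n.+1 :> R by rewrite -exprD.
have -> : Num.sqrt pi ^+ n.+2 = Num.sqrt pi * Num.sqrt pi ^+ n.+1 :> R by rewrite exprS.
move: (wc n.+1) w0 (wprod 0 n.+1) W0 (Num.sqrt (pi : R)) s0 {s2} => w w0 W W0 s s0.
move: (s ^+ n.+1) (expf_neq0 n.+1 s0) => S S0; by field; rewrite w0 W0 s0 S0.
Qed.

(** Covers both branches at once: outside the sphere [sphere_avgV] is applied with [q = t / |x|]. On
    the sphere [phi] is 0 while [sphere_avg] is infinite. *)
Lemma phi_sphere_avg n (t : R) (x : Rn R n.+1) : 0 < t -> normV x != t ->
  (phi t x)%:E =
  ((2 / pi / (wprod 0 n.+1 * t ^+ n.+1))%:E * sphere_avg n (normV x ^+ 2 / t ^+ 2))%E.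
Proof.
move=> t0 xt; rewrite /phi; set C := _ ^+ 2; set D := Gamma (1 + _).
have tn : t != 0 by rewrite gt_eqF.
have p0 : pi != 0 :> R by rewrite gt_eqF// pi_gt0.
have W0 : wprod 0 n.+1 != 0 :> R by rewrite gt_eqF// wprod_gt0.
have : C / (pi `^ (1 + n.+1%:R / 2) * D) = 2 / pi * wc n.+1 / wprod 0 n.+1 := phi_const n.
have D0 : D != 0.
  rewrite /D gt_eqF// (_ : 1 + n.+1%:R / 2 = n.+3%:R / 2) ?Gamma_gt0//.
  by rewrite -[n.+3]addn2 natrD mulrDl [X in _ = X + _]mulrC; field.
have P0 : pi `^ (1 + n.+1%:R / 2) != 0 :> R by rewrite gt_eqF// powR_gt0// pi_gt0.
move: (pi `^ _) D D0 P0 => P D D0 P0 e.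
case: ifPn => [tx|]; last rewrite -leNgt => tx; last rewrite lt_neqAle xt tx/=.
- have x0 : 0 < normV x by exact: lt_trans tx.
  have xn : normV x != 0 by rewrite gt_eqF.
  have q0 : 0 < t / normV x by rewrite divr_gt0.
  rewrite (_ : normV x ^+ 2 / t ^+ 2 = ((t / normV x) ^+ 2)^-1); last first.
    by rewrite expr_div_n invf_div.
  rewrite sphere_avgV// sphere_avg_hyp2F1; last first.
    by rewrite sqr_ge0/= expr_lt1 ?(ltW q0)// ltr_pdivrMr// mul1r.
  rewrite -!EFinM expr_div_n; congr EFin.
  rewrite -[n.+1 in RHS]/(n.+1) expr_div_n.
  transitivity (C / (P * D) * (t / normV x ^+ (1 + n.+1)) *
    hyp2F1 (1 / 2) ((1 + n.+1%:R) / 2) ((2 + n.+1%:R) / 2) (t ^+ 2 / normV x ^+ 2)).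
    congr (_ * _); move: (normV x ^+ _) (expf_neq0 (1 + n.+1) xn) => Q Q0.
    by field; rewrite P0 Q0 D0.
  rewrite e add1n; move: (hyp2F1 _ _ _ _) => H.
  rewrite [t ^+ n.+2]exprS; move: (normV x ^+ _) (expf_neq0 n.+2 xn) (t ^+ _) (expf_neq0 n.+1 tn) => Q Q0 T T0.
  move: (pi : R) p0 (wprod _ _) W0 => q q1 W W0.
  by field; rewrite q1 W0 T0 Q0.
- rewrite sphere_avg_hyp2F1; last first.
    rewrite divr_ge0 ?sqr_ge0//= ltr_pdivrMr ?exprn_gt0// mul1r.
    by rewrite ltrXn2r// ?nnegrE ?normV_ge0 ?ltW// lt_neqAle xt.
  rewrite -!EFinM; congr EFin.
  transitivity (C / (P * D) * t ^- n.+1 *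
    hyp2F1 (1 / 2) ((1 + n.+1%:R) / 2) ((2 + n.+1%:R) / 2) (normV x ^+ 2 / t ^+ 2)).
    congr (_ * _); move: (t ^+ _) (expf_neq0 n.+1 tn) => T T0.
    by field; rewrite P0 T0 D0.
  rewrite e; move: (hyp2F1 _ _ _ _) => H.
  move: (t ^+ _) (expf_neq0 n.+1 tn) => T T0.
  move: (pi : R) p0 (wprod _ _) W0 => q q1 W W0.
  by field; rewrite q1 W0 T0.
Qed.

End sphere_average.

(** * The Fourier transform of phi *)

Section tonelli_restrict_right.
Context {R : realType} d (T : measurableType d) (m : {sigma_finite_measure set T -> \bar R}).
Local Notation mu := (@lebesgue_measure R).
Local Notation mR := (measurableTypeR R).
Variables (D : set mR) (mD : measurable D) (F : T * mR -> \bar R).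
Hypotheses (mF : measurable_fun [set: T * mR] F) (F0 : forall p, (0 <= F p)%E).

Let G := F \_ (setT `*` D).
Let mG : measurable_fun [set: T * mR] G.
Proof.
apply/(measurable_restrictT _ _).1; first exact: measurableX.
exact: measurable_funTS.
Qed.
Let G0 p : (0 <= G p)%E. Proof. by apply: erestrict_ge0. Qed.

Let GE x : (\int[mu]_(y in D) F (x, y) = \int[mu]_y G (x, y))%E.
Proof.
rewrite [LHS]integral_mkcond; apply: eq_integral => y _.
by rewrite /G !patchE in_setX/= in_setT.
Qed.

Lemma measurable_integral_restrict :
  measurable_fun [set: T] (fun x => \int[mu]_(y in D) F (x, y))%E.
Proof.
under eq_fun do rewrite GE.
exact: (measurable_fun_fubini_tonelli_F (m2 := mu) _ mG G0).
Qed.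

Lemma tonelli_restrict_right :
  (\int[m]_x \int[mu]_(y in D) F (x, y) = \int[mu]_(y in D) \int[m]_x F (x, y))%E.
Proof.
under eq_integral do rewrite GE.
rewrite (fubini_tonelli (m1 := m) (m2 := mu) G mG G0) [RHS]integral_mkcond.
apply: eq_integral => y _; rewrite patchE; case: ifPn => yD.
  by apply: eq_integral => x _; rewrite /G !patchE in_setX/= in_setT yD.
by apply: integral0_eq => x _; rewrite /G patchE in_setX/= (negbTE yD) andbF.
Qed.

End tonelli_restrict_right.

Section reflection.
Context {R : realType}.
Local Notation mu := (@lebesgue_measure R).
Local Notation mR := (measurableTypeR R).

Lemma oppV_cons n (a : R) (x : Rn R n) : oppV (consRn (a, x)) = consRn (- a, oppV x).
Proof.
apply: eq_from_tnth => i; rewrite tnth_mktuple; case: (unliftP ord0 i) => [j|] ->.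
  by rewrite !tnthS tnth_mktuple.
by rewrite !tnth0.
Qed.

Lemma dotV_oppVl n (x y : Rn R n) : dotV (oppV x) y = - dotV x y.
Proof.
by rewrite /dotV -sumrN; apply: eq_bigr => i _; rewrite tnth_mktuple mulNr.
Qed.

Lemma dotV_oppVr n (x y : Rn R n) : dotV x (oppV y) = - dotV x y.
Proof.
by rewrite /dotV -sumrN; apply: eq_bigr => i _; rewrite tnth_mktuple mulrN.
Qed.

Lemma normV_oppV n (x : Rn R n) : normV (oppV x) = normV x.
Proof. by rewrite /normV dotV_oppVl dotV_oppVr opprK. Qed.

Lemma measurable_oppV n : measurable_fun [set: Rn R n] (@oppV R n).
Proof.
apply/measurable_fun_tnthP => i.
suff : measurable_fun [set: Rn R n] (fun x : Rn R n => - (tnth x i : R)).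
  by apply: eq_measurable_fun => x _; rewrite /= tnth_mktuple.
apply: (@measurable_funN _ _ R setT (fun x : Rn R n => (tnth x i : R))).
exact: measurable_tnthRn.
Qed.

Lemma ge0_integral_oppV n (F : Rn R n -> \bar R) :
  measurable_fun [set: Rn R n] F -> (forall x, 0 <= F x)%E ->
  (\int[lebesgue_Rn R n]_x F (oppV x) = \int[lebesgue_Rn R n]_x F x)%E.
Proof.
elim: n F => [|n IH] F mF F0.
  rewrite !integral_Rn0//; last exact: (measurableT_comp mF (@measurable_oppV 0)).
  by congr F; apply: eq_from_tnth => -[].
rewrite (@integral_consRn _ _ (F \o @oppV R n.+1)); [|exact: (measurableT_comp mF (@measurable_oppV n.+1))|by move=> x; exact: F0].
rewrite [RHS]integral_consRn; [|exact: mF|exact: F0].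
have mG : measurable_fun [set: mR] (fun a : mR => \int[lebesgue_Rn R n]_y F (consRn (a, y)))%E.
  apply: (measurable_integral_consRn (F := fun p => F (consRn p))) => //.
  exact: (measurableT_comp mF (@measurable_consRn R n)).
have := @ge0_integral_affine R (-1) 0 (fun a => \int[lebesgue_Rn R n]_y F (consRn (a, y)))%E.
rewrite normrN normr1 invr1 mul1e => <-; [|by rewrite oppr_eq0 oner_eq0|exact: mG|].
- apply: eq_integral => a _; rewrite mulN1r addr0 -(IH (fun y => F (consRn (- (a : R), y)))).
  + by apply: eq_integral => y _; rewrite /= oppV_cons.
  + exact: (measurableT_comp mF (measurableT_comp (@measurable_consRn R n) (measurable_pair1 _))).
  + by move=> y; exact: F0.
- by move=> a; apply: integral_ge0 => y _; exact: F0.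
Qed.

Lemma integral_oppV n (F : Rn R n -> \bar R) : measurable_fun [set: Rn R n] F ->
  (\int[lebesgue_Rn R n]_x F (oppV x) = \int[lebesgue_Rn R n]_x F x)%E.
Proof.
move=> mF; rewrite integralE [RHS]integralE.
rewrite -(ge0_integral_oppV (measurable_funepos mF) (funepos_ge0 F)).
rewrite -(ge0_integral_oppV (measurable_funeneg mF) (funeneg_ge0 F)).
congr (_ - _)%E; apply: eq_integral => x _; first by rewrite !funeposE.
by rewrite !funenegE.
Qed.

Lemma Rintegral_odd n (f : Rn R n -> R) : (lebesgue_Rn R n).-integrable setT (EFin \o f) ->
  (forall x, f (oppV x) = - f x) -> (\int[lebesgue_Rn R n]_x f x)%R = 0.
Proof.
move=> fi fodd; have mf := measurable_int _ fi.
have := congr1 fine (integral_oppV mf).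
under eq_integral do rewrite /= fodd -mulN1r.
rewrite -/(Rintegral _ _ (fun x => -1 * f x)) -/(Rintegral _ _ f) RintegralZl// => e.
by move: e; move: (Rintegral _ _ _) => a; lra.
Qed.

End reflection.

Section sphere_null.
Context {R : realType} (n : nat) (t : R).

(** Polar coordinates reduce the claim to a single point of the line being null. *)
Lemma ae_normV_neq : {ae lebesgue_Rn R n.+1, forall x, normV x != t}.
Proof.
have mS : measurable [set x : Rn R n.+1 | normV x = t].
  rewrite (_ : [set _ | _] = @normV R n.+1 @^-1` [set t]) //.
  by rewrite -[X in measurable X]setTI; exact: measurable_normV.
exists [set x | normV x = t]; split=> //; last by move=> x /= /negP; rewrite negbK => /eqP.
have -> : lebesgue_Rn R n.+1 [set x | normV x = t] =
    (\int[lebesgue_Rn R n.+1]_x (\1_[set t] (normV x))%:E)%E.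
  by rewrite -(setIT [set x | _]) -integral_indic//.
rewrite (@ge0_integral_polar R n (fun s => (\1_[set t] s)%:E))//; last first.
  by apply/measurable_EFinP; exact: measurable_indic.
rewrite (@ge0_ae_eq_integral _ _ _ _ _ _ (cst 0%E)) ?integral0//.
- apply: emeasurable_funM; apply/measurable_EFinP; first by apply: measurable_indic; exact: measurable_set1.
  by apply: measurable_funM => //; exact: measurable_funX.
- by move=> s /=; rewrite in_itv/= andbT => s0; rewrite -EFinM lee_fin !mulr_ge0 ?exprn_ge0 ?(ltW s0)// ltW// wprod_gt0.
- exists [set t]; split=> //; first exact: lebesgue_measure_set1.
  move=> s /=; apply: contra_notP => st _; rewrite indicE memNset ?mul0e// => st'.
Qed.

End sphere_null.

(** * Integrals of phi against even functions of a linear form *)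

Section phi_integral.
Context {R : realType} (n : nat) (t : R) (t0 : 0 < t).
Local Notation mu := (@lebesgue_measure R).
Local Notation J := (`]0%R, ((pi : R) / 2)%R[%classic : set R).
Local Notation mR := (measurableTypeR R).
Local Notation phit := (@phi R n.+1 t).
Let mJ : measurable (J : set mR). Proof. exact: measurable_itv. Qed.
Let c : R := 2 / pi / (wprod 0 n.+1 * t ^+ n.+1).
Let c_gt0 : 0 < c.
Proof. by rewrite /c !divr_gt0 ?pi_gt0// mulr_gt0 ?wprod_gt0// exprn_gt0. Qed.

(** The absolute value makes [F] nonnegative on the whole plane, as the Tonelli lemmas ask; for
    angles in []0, pi/2[] the sine is positive. *)
Let F (p : R * R) : \bar R := (`|sin p.2| ^+ n.+1 * hp 0 (1 - p.1 * sin p.2 ^+ 2))%:E.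

Let mF : measurable_fun [set: R * R] F.
Proof.
apply/measurable_EFinP.
have ms : measurable_fun [set: R * R] (fun p : R * R => sin p.2).
  by apply: (measurableT_comp (continuous_measurable_fun (@continuous_sin R))).
apply: measurable_funM.
  by apply: measurable_funX; exact: (measurableT_comp (@normr_measurable R setT)).
apply: (measurableT_comp (measurable_hp 0)); apply: measurable_funB => //.
by apply: measurable_funM => //; exact: measurable_funX.
Qed.

Let F0 p : (0 <= F p)%E. Proof. by rewrite lee_fin mulr_ge0 ?exprn_ge0 ?hp_ge0. Qed.

Let sphere_avgE z : sphere_avg n z = (\int[mu]_(x in J) F (z, x))%E.
Proof.
by apply: eq_integral => x; rewrite inE => Jx; rewrite /F/= (gtr0_norm (sinJ_gt0 Jx)).
Qed.

Lemma measurable_sphere_avg : measurable_fun [set: R] (@sphere_avg R n).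
Proof.
rewrite (_ : @sphere_avg R n = fun z => \int[mu]_(x in J) F (z, x))%E; last first.
  by apply/funext => z; exact: sphere_avgE.
exact: (measurable_integral_restrict (T := mR) mJ mF F0).
Qed.

Lemma sphere_avg_ge0 z : (0 <= @sphere_avg R n z)%E.
Proof. by rewrite sphere_avgE; apply: integral_ge0. Qed.

Lemma phi_normV (x : Rn R n.+1) : phit x =
  (fun s : R => if s == t then 0 else fine (c%:E * sphere_avg n (s ^+ 2 / t ^+ 2))%E) (normV x).
Proof.
rewrite /=; case: ifPn => xt; last by rewrite /c -phi_sphere_avg.
by rewrite /phi (eqP xt) ltxx.
Qed.

Lemma measurable_phi : measurable_fun [set: Rn R n.+1] phit.
Proof.
rewrite (_ : phit = (fun s : R => if s == t then 0 else
  fine (c%:E * sphere_avg n (s ^+ 2 / t ^+ 2))%E) \o @normV R n.+1); last first.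
  by apply/funext => x; exact: phi_normV.
apply: measurableT_comp; last exact: measurable_normV.
apply: measurable_fun_ifT => //; first exact: measurable_fun_eqr.
apply: measurableT_comp => //; apply: emeasurable_funM => //.
apply: (measurableT_comp measurable_sphere_avg).
by apply: measurable_funM => //; exact: measurable_funX.
Qed.

Lemma phi_ge0 (x : Rn R n.+1) : 0 <= phit x.
Proof.
rewrite phi_normV; case: ifPn => // _; rewrite fine_ge0// mule_ge0 ?sphere_avg_ge0//.
by rewrite lee_fin ltW.
Qed.

Lemma phi_oppV (x : Rn R n.+1) : phit (oppV x) = phit x.
Proof. by rewrite !phi_normV normV_oppV. Qed.

(** Rotation invariance replaces the linear form by [|w|] times the first coordinate, and Tonelli
    puts the angle of [sphere_avg] outside. At each angle the density is a multiple of
    [(r^2 - |z|^2)_+^(-1/2)] with [r = t / sin x]; its marginal on the first axis is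
    [(r^2 - y^2)_+^((n-1)/2)] up to a constant, and setting [y] equal to [r] times a sine produces
    the weight [cos^n]. *)
Lemma integral_phi_even (w : Rn R n.+1) (K : R -> \bar R) :
  measurable_fun [set: R] K -> (forall x, 0 <= K x)%E -> (forall x, K (- x) = K x) ->
  (\int[lebesgue_Rn R n.+1]_x ((phit x)%:E * K (dotV x w)) =
   (2 / pi / wc n)%:E * \int[mu]_(x in J) \int[mu]_(y in J)
     ((cos y ^+ n)%:E * K (normV w * t / sin x * sin y)%R))%E.
Proof.
move=> mK K0 Keven; have t2 : 0 < t ^+ 2 by rewrite exprn_gt0.
pose H (p : R * R) : \bar R := (c%:E * sphere_avg n (p.1 / t ^+ 2) * K p.2)%E.
have mH : measurable_fun [set: R * R] H.
  apply: emeasurable_funM; last exact: (measurableT_comp mK).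
  apply: emeasurable_funM => //; apply: (measurableT_comp measurable_sphere_avg).
  by apply: measurable_funM.
have H0 p : (0 <= H p)%E by rewrite !mule_ge0 ?sphere_avg_ge0// lee_fin ltW.
transitivity (\int[lebesgue_Rn R n.+1]_x H (dotV x x, dotV x w))%E.
  apply: ge0_ae_eq_integral.
  - exact: measurableT.
  - apply: emeasurable_funM; first by apply/measurable_EFinP; exact: measurable_phi.
    exact: (measurableT_comp mK (@measurable_dotVl R _ w)).
  - exact: (measurable_dotV_dotV w mH).
  - by move=> x _; rewrite mule_ge0// lee_fin phi_ge0.
  - by move=> x _; exact: H0.
  - apply: filterS (@ae_normV_neq R n t) => x xt _.
    by rewrite /H (phi_sphere_avg t0 xt) normV_sqr.
rewrite rotation_invariant//.
pose L (p : Rn R n.+1 * mR) : \bar R := (F ((dotV p.1 p.1 / t ^+ 2)%R, p.2) * K (normV w * fstRn p.1)%R)%E.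
have mL : measurable_fun [set: Rn R n.+1 * mR] L.
  apply: emeasurable_funM.
    apply: (measurableT_comp mF); apply: measurable_fun_pair; last exact: measurable_snd.
    apply: measurable_funM; last exact: measurable_cst.
    exact: (measurableT_comp (@measurable_dotVV R n.+1) measurable_fst).
  apply: (measurableT_comp mK); apply: measurable_funM; first exact: measurable_cst.
  exact: (measurableT_comp (@measurable_fstRn R n) measurable_fst).
have L0 p : (0 <= L p)%E by rewrite mule_ge0.
transitivity (c%:E * \int[lebesgue_Rn R n.+1]_x \int[mu]_(y in J) L (x, y))%E.
  rewrite -ge0_integralZl; [|exact: measurableT|exact: (measurable_integral_restrict mJ mL L0)
    |by move=> x _; apply: integral_ge0|by rewrite lee_fin ltW].
  apply: eq_integral => x _; rewrite /H/= -muleA; congr (_ * _)%E.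
  rewrite sphere_avgE /L/= ge0_integralZr//.
  by apply: measurable_funTS; exact: (measurableT_comp mF (measurable_pair1 _)).
rewrite (tonelli_restrict_right (lebesgue_Rn R n.+1) mJ mL L0).
have W0 : 0 < wprod 0 n :> R by exact: wprod_gt0.
(* The factor [sin^(n+1)] is compensated by the powers of [r = t / sin x], so the constant [k] is
   the same at all angles: this is why [phi] mixes the probability densities with equal weights. *)
pose k : R := c^-1 * (2 / pi / wc n).
have inner (x : mR) : J x -> (\int[lebesgue_Rn R n.+1]_z L (z, x) =
    k%:E * \int[mu]_(y in J) ((`|cos y| ^+ n)%:E * K (normV w * t / sin x * sin y)%R))%E.
  move=> Jx; have s0 := sinJ_gt0 Jx; have sn : sin x != 0 by rewrite gt_eqF.
  pose r : R := t / sin x; have r0 : 0 < r by rewrite divr_gt0.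
  have LE z : L (z, x) = ((sin x ^+ n.+1 * r)%:E *
      ((hp 0 (r ^+ 2 - dotV z z))%:E * K (normV w * fstRn z)%R))%E.
    rewrite /L /F/= muleA -EFinM (gtr0_norm s0); congr (_%:E * _)%E.
    rewrite -[RHS]mulrA; congr (_ * _).
    have -> : 1 - dotV z z / t ^+ 2 * sin x ^+ 2 = (r ^+ 2)^-1 * (r ^+ 2 - dotV z z).
      by rewrite /r; move: t0 s0 => /gt_eqF/negbT h1 /gt_eqF/negbT h2; field; rewrite h1 h2.
    rewrite hpM ?invr_gt0 ?exprn_gt0// hp0E ?invr_gt0 ?exprn_gt0//.
    by rewrite sqrtrV ?sqr_ge0// invrK sqrtr_sqr (gtr0_norm r0).
  under eq_integral do rewrite LE.
  have mKw : measurable_fun [set: R] (fun y : R => K (normV w * y)%R).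
    by apply: (measurableT_comp mK); apply: measurable_funM.
  rewrite ge0_integralZl; [|exact: measurableT| | |by rewrite lee_fin mulr_ge0 ?exprn_ge0 ?(ltW s0) ?(ltW r0)]; last 2 first.
  - apply: emeasurable_funM; first exact: measurable_hp_Rn.
    exact: (measurableT_comp mKw (@measurable_fstRn R n)).
  - by move=> z _; rewrite mule_ge0// lee_fin hp_ge0.
  rewrite (integral_hp0_fst n (r ^+ 2) mKw)// (integral_hp_scale n r0 mKw)//.
  have mKr : measurable_fun [set: R] (fun y : R => K (normV w * (r * y))%R).
    by apply: (measurableT_comp mKw); apply: measurable_funM.
  rewrite (integral_hp_weight n mKr)//; last by move=> y; rewrite !mulrN.
  rewrite !muleA -!EFinM; congr (_%:E * _)%E.
    rewrite /k /c [wprod 0 n.+1]big_ord_recr/= -/(wprod 0 n) add0n /r expr_div_n.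
    have p0 : pi != 0 :> R by rewrite gt_eqF// pi_gt0.
    have w0 : wc n != 0 :> R by rewrite gt_eqF// wc_gt0.
    rewrite !exprS; move: (gt_eqF t0) => /negbT tn.
    have T0 := expf_neq0 n tn; have S0 := expf_neq0 n sn.
    move: (t ^+ n) (sin x ^+ n) (sin x) sn T0 S0 => T S s1 s10 T0 S0.
    move: (wprod 0 n) (gt_eqF W0) => W /negbT W1.
    by move: (pi : R) p0 => q q0; field; rewrite ?s10 ?T0 ?S0 ?W1 ?q0 ?w0 ?tn.
  apply: eq_integral => y; rewrite inE => Jy; rewrite (gtr0_norm (cosJ_gt0 Jy)).
  by congr (_ * K _)%E; rewrite /r; ring.
pose M (p : mR * mR) : \bar R := ((`|cos p.2| ^+ n)%:E * K (normV w * t / sin p.1 * sin p.2)%R)%E.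
have mM : measurable_fun [set: mR * mR] M.
  have msin := continuous_measurable_fun (@continuous_sin R).
  apply: emeasurable_funM.
    apply/measurable_EFinP; apply: measurable_funX; apply: (measurableT_comp (@normr_measurable R setT)).
    exact: (measurableT_comp (continuous_measurable_fun (@continuous_cos R)) measurable_snd).
  apply: (measurableT_comp mK); apply: measurable_funM; last exact: (measurableT_comp msin measurable_snd).
  apply: measurable_funM => //; apply: (measurableT_comp (@measurable_invr R)).
  exact: (measurableT_comp msin measurable_fst).
have M0 p : (0 <= M p)%E by rewrite mule_ge0// lee_fin exprn_ge0.
have k0 : (0 <= k%:E)%E.
  by rewrite lee_fin /k mulr_ge0 ?divr_ge0 ?invr_ge0 ?pi_ge0 ?(ltW c_gt0) ?(ltW (wc_gt0 _)).
transitivity (c%:E * \int[mu]_(x in J) (k%:E * \int[mu]_(y in J) M (x, y)))%E.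
  by congr (_ * _)%E; apply: eq_integral => x; rewrite inE; exact: inner.
rewrite ge0_integralZl; [|exact: mJ| |by move=> x _; apply: integral_ge0|exact: k0]; last first.
  by apply: measurable_funTS; exact: (measurable_integral_restrict mJ mM M0).
have ck : c * k = 2 / pi / wc n by rewrite /k mulVKf ?gt_eqF.
have -> : (\int[mu]_(x in J) \int[mu]_(y in J) M (x, y) = \int[mu]_(x in J) \int[mu]_(y in J)
    ((cos y ^+ n)%:E * K (normV w * t / sin x * sin y)%R))%E.
  apply: eq_integral => x _; apply: eq_integral => y; rewrite inE => Jy.
  by rewrite /M/= (gtr0_norm (cosJ_gt0 Jy)).
by rewrite muleA -EFinM ck.
Qed.

Lemma integral_phi : (\int[lebesgue_Rn R n.+1]_x (phit x)%:E = 1)%E.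
Proof.
pose w : Rn R n.+1 := [tuple of nseq n.+1 (0 : R)].
have := @integral_phi_even w (cst 1%E) (measurable_cst _).
under eq_integral do rewrite mule1.
move=> -> //.
have E : (\int[mu]_(y in J) ((cos y ^+ n)%:E * 1) = (wc n)%:E)%E.
  under eq_integral do rewrite mule1.
  rewrite -sin_cos_moment0 /sin_cos_moment /Rintegral fineK.
    by apply: eq_integral => y _; rewrite expr0 mul1r.
  by apply: integrable_fin_num => //; exact: integrable_sin_cos.
rewrite /= E integral_cst// [X in (_ * (_ * X))%E](_ : _ = (pi / 2)%:E); last exact: lebesgue_J.
rewrite -!EFinM; congr EFin.
have p0 : pi != 0 :> R by rewrite gt_eqF// pi_gt0.
have w0 : wc n != 0 :> R by rewrite gt_eqF// wc_gt0.
by move: (pi : R) p0 => q q0; field; rewrite q0 w0.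
Qed.

Lemma integrable_phi : (lebesgue_Rn R n.+1).-integrable setT (EFin \o phit).
Proof.
apply/integrableP; split; first by apply/measurable_EFinP; exact: measurable_phi.
under eq_integral do rewrite /= ger0_norm ?phi_ge0//.
by rewrite integral_phi ltry.
Qed.

Lemma integrable_phi_bounded (g : Rn R n.+1 -> R) (C : R) : measurable_fun [set: Rn R n.+1] g ->
  (forall x, `|g x| <= C) -> (lebesgue_Rn R n.+1).-integrable setT (EFin \o (fun x => phit x * g x)).
Proof. by move=> mg gC; apply: (integrable_realM measurableT integrable_phi mg (C := C)). Qed.

Lemma measurable_cos_dotV (k : R) (w : Rn R n.+1) :
  measurable_fun [set: Rn R n.+1] (fun x => cos (k * dotV x w)).
Proof.
apply: (measurableT_comp (continuous_measurable_fun (@continuous_cos R))).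
by apply: measurable_funM; [exact: measurable_cst|exact: measurable_dotVl].
Qed.

(** [integral_phi_even] takes nonnegative functions, so it is applied to [1 + cos], and the mass 1
    of [phi] is subtracted at the end. Exchanging the two angles makes the inner integral a
    [cosec_average]. *)
Lemma fourier_phi (w : Rn R n.+1) :
  (\int[lebesgue_Rn R n.+1]_x (phit x * cos (2 * pi * dotV x w)))%R =
  sphere_multiplier n (2 * pi * (t * normV w)).
Proof.
have p0 : 0 < pi :> R by exact: pi_gt0.
have w0 : 0 < wc n :> R by exact: wc_gt0.
set u : R := 2 * pi * (t * normV w); have u0 : 0 <= u by rewrite !mulr_ge0 ?(ltW p0) ?(ltW t0) ?normV_ge0.
pose K (y : R) : \bar R := (1 + cos (2 * pi * y))%:E.
have mK : measurable_fun [set: R] K.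
  apply/measurable_EFinP; apply: measurable_funD => //.
  apply: (measurableT_comp (continuous_measurable_fun (@continuous_cos R))).
  by apply: measurable_funM.
have cosB (x : R) : -1 <= cos x <= 1 by rewrite cos_geN1 cos_le1.
have K0 y : (0 <= K y)%E by rewrite lee_fin -lerBlDl sub0r; have /andP[] := cosB (2 * pi * y).
have Ke y : K (- y) = K y by rewrite /K mulrN cosN.
have := integral_phi_even w mK K0 Ke.
pose M (p : R * R) : \bar R := (`|cos p.2| ^+ n * (1 + cos (u * sin p.2 / sin p.1)))%:E.
have cos1 (x : R) : 0 <= 1 + cos x by rewrite -lerBlDl sub0r; have /andP[] := cosB x.
have mM : measurable_fun [set: R * R] M.
  have msin := continuous_measurable_fun (@continuous_sin R).
  have mcos := continuous_measurable_fun (@continuous_cos R).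
  apply/measurable_EFinP; apply: measurable_funM.
    apply: measurable_funX; apply: (measurableT_comp (@normr_measurable R setT)).
    exact: (measurableT_comp mcos measurable_snd).
  apply: measurable_funD => //; apply: (measurableT_comp mcos); apply: measurable_funM.
    by apply: measurable_funM => //; exact: (measurableT_comp msin measurable_snd).
  apply: (measurableT_comp (@measurable_invr R)).
  exact: (measurableT_comp msin measurable_fst).
have M0 p : (0 <= M p)%E by rewrite lee_fin mulr_ge0 ?exprn_ge0.
have EM : (\int[mu]_(x in J) \int[mu]_(y in J) ((cos y ^+ n)%:E * K (normV w * t / sin x * sin y)%R) =
    \int[mu]_(x in J) \int[mu]_(y in J) M (x, y))%E.
  apply: eq_integral => x _; apply: eq_integral => y; rewrite inE => Jy.
  rewrite /M/= (gtr0_norm (cosJ_gt0 Jy)) /K -EFinM; congr (_ * (1 + cos _))%:E.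
  by rewrite /u; ring.
rewrite EM (tonelli_restrict mJ mJ mM M0).
have Joo : (mu (J : set mR) < +oo)%E by rewrite [X in (X < _)%E]lebesgue_J ltry.
have i1 : mu.-integrable J (EFin \o (fun _ : R => 1 : R)).
  by apply: (integrable_bounded mJ Joo _ (C := 1)) => [|x _]; [exact: measurable_cst|rewrite normr1].
have c1 : (\int[mu]_(x in J) (1 : R))%R = pi / 2.
  by rewrite (Rintegral_cst _ mJ) mul1r [X in fine X](_ : _ = (pi / 2)%:E); last exact: lebesgue_J.
have inner (y : R) : J y -> (\int[mu]_(x in J) M (x, y) =
    (pi / 2 * (sin y ^+ 0 * cos y ^+ n + cos y ^+ n * cosec_average (u * sin y)))%:E)%E.
  move=> Jy; have ic := integrable_cos_cosec (u * sin y).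
  have -> : (\int[mu]_(x in J) M (x, y) =
      \int[mu]_(x in J) (cos y ^+ n * (1 + cos (u * sin y / sin x)))%:E)%E.
    by apply: eq_integral => x _; rewrite /M/= (gtr0_norm (cosJ_gt0 Jy)).
  have i1c := integrable_realD mJ i1 ic.
  have fi := integrable_realZ mJ (cos y ^+ n) i1c.
  rewrite -[LHS]fineK; last by exact: integrable_fin_num.
  congr EFin; rewrite -/(Rintegral _ _ _) (RintegralZl _ mJ i1c) (RintegralD mJ i1 ic) c1 /cosec_average.
  by rewrite expr0; move: (pi : R) p0 (Rintegral _ _ _) => q q0 A; field; rewrite gt_eqF.
have -> : (\int[mu]_(y in J) \int[mu]_(x in J) M (x, y) = \int[mu]_(y in J)
    (pi / 2 * (sin y ^+ 0 * cos y ^+ n + cos y ^+ n * cosec_average (u * sin y)))%:E)%E.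
  by apply: eq_integral => y; rewrite inE; exact: inner.
have ib := integrable_sphere_integrand n u0.
have is0 := @integrable_sin_cos R 0 n.
have isum := integrable_realD mJ is0 ib.
have -> : (\int[mu]_(y in J)
    (pi / 2 * (sin y ^+ 0 * cos y ^+ n + cos y ^+ n * cosec_average (u * sin y)))%:E =
    (pi / 2 * (wc n + (\int[mu]_(y in J) (cos y ^+ n * cosec_average (u * sin y)))%R))%:E)%E.
  have fi := integrable_realZ mJ (pi / 2) isum.
  rewrite -[LHS]fineK; last exact: (integrable_fin_num mJ fi).
  congr EFin; rewrite -/(Rintegral _ _ _) (RintegralZl _ mJ isum) (RintegralD mJ is0 ib).
  by rewrite -/(sin_cos_moment _ _) sin_cos_moment0.
have EL : (\int[lebesgue_Rn R n.+1]_x ((phit x)%:E * K (dotV x w)) =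
    (1 + (\int[lebesgue_Rn R n.+1]_x (phit x * cos (2 * pi * dotV x w)))%R)%:E)%E.
  have ip := integrable_phi.
  have ipc := integrable_phi_bounded (measurable_cos_dotV (2 * pi) w) (fun x => cos_max _).
  have e1 : (\int[lebesgue_Rn R n.+1]_x phit x)%R = 1 by rewrite /Rintegral integral_phi.
  have isum' := integrable_realD measurableT ip ipc.
  rewrite -[X in (X + _)%:E]e1 -(RintegralD measurableT ip ipc) /Rintegral fineK; last first.
    exact: (integrable_fin_num measurableT isum').
  by apply: eq_integral => x _; rewrite /K -EFinM mulrDr mulr1.
rewrite EL -EFinM => e0; have e := EFin_inj e0.
apply: (addrI 1); rewrite e /sphere_multiplier.
set A := (\int[mu]_(y in J) (cos y ^+ n * cosec_average (u * sin y)))%R.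
clearbody A; move: (pi : R) p0 (wc n) w0 => q /gt_eqF/negbT q0 W /gt_eqF/negbT W1.
by field; rewrite W1 q0.
Qed.

End phi_integral.

(** * Fourier inversion by Gaussian summation *)

Section gauss_fourier.
Context {R : realType}.
Local Notation mu := (@lebesgue_measure R).
Local Notation mR := (measurableTypeR R).

(** Serves to dominate the partial sums of the cosine series in [integral_gauss_cos]. *)
Lemma even_exp_partial_le (y : R) m : 0 <= y ->
  \sum_(0 <= k < m) y ^+ k.*2 / (k.*2)`!%:R <= expR y.
Proof.
move=> y0; apply: (@le_trans _ _ (series (exp_coeff y) m.*2)); last first.
  apply: nondecreasing_cvgn_le; last exact: is_cvg_series_exp_coeff.
  by apply: nondecreasing_series => k _ _; rewrite /exp_coeff/= divr_ge0// exprn_ge0.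
elim: m => [|m IH]; first by rewrite /series/= !big_geq.
rewrite big_nat_recr//= doubleS /series/= big_nat_recr//= big_nat_recr//= -addrA lerD//.
by rewrite lerDl divr_ge0// exprn_ge0.
Qed.

Let measurable_gauss_pow k : measurable_fun [set: R] (fun s : R => expR (- s ^+ 2) * s ^+ k).
Proof.
apply: measurable_funM; last exact: measurable_funX.
by apply: measurableT_comp => //; apply: measurable_funN; exact: measurable_funX.
Qed.

Lemma integral_gauss_even_moment k :
  (\int[mu]_s (expR (- s ^+ 2) * s ^+ k.*2)%:E = (Gamma (k.*2.+1%:R / 2))%:E)%E.
Proof.
rewrite ge0_integral_even.
- by rewrite integral_gauss_moment GammaE -EFinM mulrA.
- exact/measurable_EFinP.
- by move=> s; rewrite lee_fin mulr_ge0 ?expR_ge0// -mul2n exprM exprn_ge0// sqr_ge0.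
- by move=> s; rewrite sqrrN -mul2n !exprM sqrrN.
Qed.

Lemma Gamma_half_fact k : Gamma (k.*2.+1%:R / 2) / (k.*2)`!%:R = Num.sqrt pi / (4 ^+ k * k`!%:R) :> R.
Proof.
elim: k => [|k IH].
  rewrite GammaE expr1 /wprod big_ord1 addn0 wc1 fact0 expr0 !divr1 !mulr1.
  rewrite (_ : 0.*2.+1%:R = 1 :> R)//; by field.
have f0 : (k.*2)`!%:R != 0 :> R by rewrite pnatr_eq0 -lt0n fact_gt0.
have f1 : k`!%:R != 0 :> R by rewrite pnatr_eq0 -lt0n fact_gt0.
have q0 : 4 ^+ k != 0 :> R by rewrite expf_neq0.
have a0 : k.*2.+1%:R != 0 :> R by rewrite pnatr_eq0.
have b0 : k.+1%:R != 0 :> R by rewrite pnatr_eq0.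
rewrite doubleS (@Gamma_rec R k.*2) !factS !natrM exprS.
have -> : k.*2.+2%:R = 2 * k.+1%:R :> R by rewrite -doubleS -mul2n natrM.
transitivity (Gamma (k.*2.+1%:R / 2) / (k.*2)`!%:R / (4 * k.+1%:R) : R).
  move: (Gamma (k.*2.+1%:R / 2) : R) (k.*2.+1%:R : R) (k.+1%:R : R) a0 b0 ((k.*2)`!%:R : R) f0 => G a b a0 b0 f f0'.
  by field; rewrite a0 b0 f0'.
rewrite IH; move: (Num.sqrt _) (k.+1%:R : R) b0 (4 ^+ k : R) q0 (k`!%:R : R) f1 => S b b0 q q0 f f0'.
by field; rewrite b0 q0 f0'.
Qed.

(** The cosine series is integrated termwise: the even Gaussian moments are Gamma values, and
    [Gamma_half_fact] turns the result into the exponential series of [- w^2 / 4]. The dominating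
    function is [exp (- s^2) (exp (w s) + exp (- w s))], integrable by completing the square. *)
Lemma integral_gauss_cos (w : R) :
  (\int[mu]_s (expR (- s ^+ 2) * cos (w * s)))%R = Num.sqrt pi * expR (- (w ^+ 2 / 4)).
Proof.
pose c k : R := (-1) ^+ k * w ^+ k.*2 / (k.*2)`!%:R.
pose h k (s : R) := c k * (expR (- s ^+ 2) * s ^+ k.*2).
pose g (s : R) := expR (- s ^+ 2) * (expR (w * s) + expR (- (w * s))).
have ih k : mu.-integrable setT (EFin \o (fun s : R => expR (- s ^+ 2) * s ^+ k.*2)).
  apply/integrableP; split; first by apply/measurable_EFinP; exact: measurable_gauss_pow.
  under eq_integral => s _.
    rewrite /= ger0_norm; last by rewrite mulr_ge0 ?expR_ge0// -mul2n exprM exprn_ge0// sqr_ge0.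
    over.
  by rewrite integral_gauss_even_moment ltry.
have ihc k : mu.-integrable setT (EFin \o h k) by exact: integrable_realZ.
have ge (e : R) : `|e| = 1 -> (\int[mu]_s (expR (- s ^+ 2) * expR (e * (w * s)))%:E =
    (expR (w ^+ 2 / 4) * Num.sqrt pi)%:E)%E.
  move=> e1; have e2 : e ^+ 2 = 1 by rewrite -[e ^+ 2]real_normK ?num_real// e1 expr1n.
  have one : (0 : R) < 1 by [].
  have := @integral_gauss_affine R 1 (- (e * w / 2)) one; rewrite divr1 EFinM => <-.
  rewrite -ge0_integralZl; [|exact: measurableT| | |]; last 3 first.
  - apply/measurable_EFinP; apply: measurableT_comp => //; apply: measurable_funN.
    by apply: measurable_funX; apply: measurable_funD => //; exact: measurable_funM.
  - by move=> s _; rewrite lee_fin expR_ge0.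
  - by rewrite lee_fin expR_ge0.
  apply: eq_integral => s _; rewrite -EFinM -!expRD; congr (EFin (expR _)).
  transitivity (w ^+ 2 / 4 * e ^+ 2 - (1 * (s : R) + - (e * w / 2)) ^+ 2); last by rewrite e2 mulr1.
  by field.
have mge (e : R) : measurable_fun [set: R] (fun s : R => expR (- s ^+ 2) * expR (e * (w * s))).
  apply: measurable_funM; apply: measurableT_comp => //; first by apply: measurable_funN; exact: measurable_funX.
  by apply: measurable_funM => //; exact: measurable_funM.
have ige (e : R) : `|e| = 1 -> mu.-integrable setT (EFin \o (fun s : R => expR (- s ^+ 2) * expR (e * (w * s)))).
  move=> e1; apply/integrableP; split; first by apply/measurable_EFinP; exact: mge.
  under eq_integral do rewrite /= ger0_norm ?mulr_ge0 ?expR_ge0//.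
  by rewrite (ge _ e1) ltry.
have ig : mu.-integrable setT (EFin \o g).
  rewrite (_ : g = fun s => expR (- s ^+ 2) * expR (1 * (w * s)) + expR (- s ^+ 2) * expR (-1 * (w * s))).
    by apply: integrable_realD => //; apply: ige; rewrite ?normrN normr1.
  by apply/funext => s; rewrite /g mul1r mulN1r mulrDr.
have hg m (s : R) : `|\sum_(0 <= k < m) h k s| <= g s.
  rewrite (le_trans (ler_norm_sum _ _ _))//.
  apply: (@le_trans _ _ (expR (- s ^+ 2) * expR `|w * s|)); last first.
    rewrite ler_wpM2l ?expR_ge0//; have [ws|ws] := ler0P (w * s).
      by rewrite lerDr expR_ge0.
    by rewrite lerDl expR_ge0.
  apply: (@le_trans _ _ (expR (- s ^+ 2) * \sum_(0 <= k < m) `|w * s| ^+ k.*2 / (k.*2)`!%:R)); last first.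
    by rewrite ler_wpM2l ?expR_ge0// even_exp_partial_le.
  rewrite big_distrr/= le_eqVlt; apply/orP; left; apply/eqP; apply: eq_bigr => k _.
  rewrite /h /c !normrM normrX normrN1 expr1n mul1r (ger0_norm (expR_ge0 _)) !normrX exprMn.
  by rewrite normfV normr_nat; ring.
have hcos (s : R) : series (h ^~ s) @ \oo --> expR (- s ^+ 2) * cos (w * s).
  rewrite (_ : series _ = fun m => expR (- s ^+ 2) * series (cos_coeff' (w * s)) m).
    by apply: cvgM; [exact: cvg_cst|exact: cvg_cos_coeff'].
  apply/funext => m; rewrite /series/= big_distrr/=; apply: eq_bigr => k _.
  by rewrite /h /c /cos_coeff' exprMn -exprnP; ring.
have mh k : measurable_fun [set: R] (h k) by apply: measurable_funM.
have [] := @dominated_convergence _ _ _ mu setT measurableT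
  (fun m => EFin \o (fun s => \sum_(0 <= k < m) h k s)) (EFin \o (fun s => expR (- s ^+ 2) * cos (w * s)))
  (EFin \o g).
- by move=> m; apply/measurable_EFinP; apply: measurable_sum.
- apply/measurable_EFinP; apply: measurable_funM.
    by apply: measurableT_comp => //; apply: measurable_funN; exact: measurable_funX.
  apply: (measurableT_comp (continuous_measurable_fun (@continuous_cos R))).
  exact: measurable_funM.
- by apply: aeW => s _; apply: cvg_EFin; [exact: nearW|exact: hcos].
- exact: ig.
- by apply: aeW => s m _; rewrite /= lee_fin hg.
move=> ilim _ lim1.
have lim2 : (\int[mu]_s (\sum_(0 <= k < m) h k s))%R @[m --> \oo] -->
    (\int[mu]_s (expR (- s ^+ 2) * cos (w * s)))%R.
  by apply: fine_cvg; rewrite fineK; [exact: lim1|exact: integrable_fin_num].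
apply: (cvg_unique _ lim2) => //=.
rewrite (_ : (fun m => _) = fun m => Num.sqrt pi * series (exp_coeff (- (w ^+ 2 / 4))) m).
  by apply: cvgM; [exact: cvg_cst|exact: is_cvg_series_exp_coeff].
apply/funext => m; rewrite (Rintegral_sum measurableT m ihc).2 /series/= big_distrr/=.
apply: eq_bigr => k _; rewrite /h RintegralZl// /Rintegral integral_gauss_even_moment/=.
rewrite /c /exp_coeff/=; have := Gamma_half_fact k.
have f0 : (k.*2)`!%:R != 0 :> R by rewrite pnatr_eq0 -lt0n fact_gt0.
have f1 : k`!%:R != 0 :> R by rewrite pnatr_eq0 -lt0n fact_gt0.
have q0 : 4 ^+ k != 0 :> R by rewrite expf_neq0.
move=> /(congr1 (fun x => (-1) ^+ k * w ^+ k.*2 * x)) e.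
transitivity ((-1) ^+ k * w ^+ k.*2 * (Gamma (k.*2.+1%:R / 2) / (k.*2)`!%:R)); first by ring.
have -> : (- (w ^+ 2 / 4)) ^+ k = (-1) ^+ k * (w ^+ k.*2 / 4 ^+ k).
  by rewrite -[- (w ^+ 2 / 4)]mulN1r exprMn expr_div_n -exprM mul2n.
rewrite e; move: (w ^+ k.*2) ((-1) ^+ k) => A B.
by move: (4 ^+ k : R) q0 (k`!%:R : R) f1 => q q0 f f1; field; rewrite q0 f1.
Qed.

Lemma ge0_integral_gauss_oneD_cos (w : R) :
  (\int[mu]_s (expR (- s ^+ 2) * (1 + cos (w * s)))%:E =
   (Num.sqrt pi * (1 + expR (- (w ^+ 2 / 4))))%:E)%E.
Proof.
have mg : measurable_fun [set: R] (fun s : R => expR (- s ^+ 2)).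
  by apply: measurableT_comp => //; apply: measurable_funN; exact: measurable_funX.
have ig : mu.-integrable setT (EFin \o (fun s : R => expR (- s ^+ 2))).
  apply/integrableP; split; first exact/measurable_EFinP.
  under eq_integral do rewrite /= ger0_norm ?expR_ge0//.
  rewrite [X in (X < _)%E](_ : _ = (Num.sqrt pi)%:E) ?ltry//.
  by rewrite -integralT_gauss.
have mc : measurable_fun [set: R] (fun s : R => cos (w * s)).
  apply: (measurableT_comp (continuous_measurable_fun (@continuous_cos R))).
  exact: measurable_funM.
have igc : mu.-integrable setT (EFin \o (fun s : R => expR (- s ^+ 2) * cos (w * s))).
  by apply: (integrable_realM measurableT ig mc (C := 1)) => s _; exact: cos_max.
have isum := integrable_realD measurableT ig igc.
have E s : expR (- s ^+ 2) * (1 + cos (w * s)) = expR (- s ^+ 2) + expR (- s ^+ 2) * cos (w * s).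
  by rewrite mulrDr mulr1.
under eq_integral do rewrite E.
rewrite -[LHS]fineK; last exact: (integrable_fin_num measurableT isum).
congr EFin; rewrite -/(Rintegral _ _ _) (RintegralD measurableT ig igc) integral_gauss_cos.
rewrite mulrDr mulr1; congr (_ + _).
by rewrite /Rintegral -[RHS]/(fine (Num.sqrt pi)%:E) -integralT_gauss.
Qed.

Lemma measurable_cos_dotV1 n (w : Rn R n) : measurable_fun [set: Rn R n] (fun x => cos (dotV x w)).
Proof.
apply: (measurableT_comp (continuous_measurable_fun (@continuous_cos R))).
exact: measurable_dotVl.
Qed.

Lemma measurable_gauss_Rn n (k : R) :
  measurable_fun [set: Rn R n] (fun x => expR (- (k ^+ 2 * dotV x x))).
Proof.
apply: (measurableT_comp (@measurable_expR R)); apply: measurable_funN.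
apply: measurable_funM; [exact: measurable_cst|exact: measurable_dotVV].
Qed.

Lemma integrable_gauss_Rn n (k : R) : 0 < k ->
  (lebesgue_Rn R n).-integrable setT (EFin \o (fun x => expR (- (k ^+ 2 * dotV x x)))).
Proof.
move=> k0; apply/integrableP; split.
  by apply/measurable_EFinP; exact: measurable_gauss_Rn.
under eq_integral do rewrite /= ger0_norm ?expR_ge0//.
by rewrite integral_gauss_Rn// ltry.
Qed.

(** Rotation invariance turns [w] onto the first axis, where the integral splits into a
    one-dimensional cosine transform and [n] plain Gaussians. Again [1 + cos] keeps the integrand
    nonnegative. *)
Lemma integral_gauss_cos_Rn n (k : R) (w : Rn R n.+1) : 0 < k ->
  (\int[lebesgue_Rn R n.+1]_x (expR (- (k ^+ 2 * dotV x x)) * cos (dotV x w)))%R =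
  (Num.sqrt pi / k) ^+ n.+1 * expR (- (dotV w w / (4 * k ^+ 2))).
Proof.
move=> k0; have kn : k != 0 by rewrite gt_eqF.
pose H (p : R * R) : \bar R := (expR (- (k ^+ 2 * p.1)) * (1 + cos p.2))%:E.
have cos1 (x : R) : 0 <= 1 + cos x by rewrite -lerBlDl sub0r; exact: cos_geN1.
have mcos := continuous_measurable_fun (@continuous_cos R).
have mH : measurable_fun [set: R * R] H.
  apply/measurable_EFinP; apply: measurable_funM.
    apply: (measurableT_comp (@measurable_expR R)); apply: measurable_funN.
    exact: measurable_funM.
  by apply: measurable_funD => //; exact: (measurableT_comp mcos measurable_snd).
have H0 p : (0 <= H p)%E by rewrite lee_fin mulr_ge0 ?expR_ge0.
have ig := @integrable_gauss_Rn n.+1 k k0.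
have igc : (lebesgue_Rn R n.+1).-integrable setT
    (EFin \o (fun x => expR (- (k ^+ 2 * dotV x x)) * cos (dotV x w))).
  apply: (integrable_realM measurableT ig (measurable_cos_dotV1 w) (C := 1)) => s _.
  exact: cos_max.
have eL : (\int[lebesgue_Rn R n.+1]_x H (dotV x x, dotV x w) = ((Num.sqrt pi / k) ^+ n.+1 +
    (\int[lebesgue_Rn R n.+1]_x (expR (- (k ^+ 2 * dotV x x)) * cos (dotV x w)))%R)%:E)%E.
  have isum := integrable_realD measurableT ig igc.
  have -> : (Num.sqrt pi / k) ^+ n.+1 = (\int[lebesgue_Rn R n.+1]_x expR (- (k ^+ 2 * dotV x x)))%R.
    by rewrite /Rintegral integral_gauss_Rn.
  rewrite -(RintegralD measurableT ig igc) /Rintegral fineK; last first.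
    exact: (integrable_fin_num measurableT isum).
  by apply: eq_integral => x _; rewrite /H/= mulrDr mulr1.
have mHr : measurable_fun [set: Rn R n.+1] (fun x => H (dotV x x, normV w * fstRn x)).
  have := measurable_dotV_fst (n := n) (normV w) 0 0 mH.
  by under eq_fun do rewrite !add0r.
have eR : (\int[lebesgue_Rn R n.+1]_x H (dotV x x, normV w * fstRn x)%R =
    ((Num.sqrt pi / k) ^+ n * (k^-1 * (Num.sqrt pi * (1 + expR (- ((normV w / k) ^+ 2 / 4))))))%:E)%E.
  rewrite integral_consRn; [|exact: mHr|by move=> x; exact: H0].
  pose f (s : R) := (expR (- s ^+ 2) * (1 + cos (normV w / k * s)))%:E.
  have mf : measurable_fun [set: R] f.
    apply/measurable_EFinP; apply: measurable_funM.
      by apply: measurableT_comp => //; apply: measurable_funN; exact: measurable_funX.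
    apply: measurable_funD => //; apply: (measurableT_comp mcos).
    exact: measurable_funM.
  have f0 s : (0 <= f s)%E by rewrite lee_fin mulr_ge0 ?expR_ge0.
  have := @ge0_integral_affine R k 0 f kn mf f0.
  rewrite ge0_integral_gauss_oneD_cos (gtr0_norm k0) -EFinM => eA.
  rewrite EFinM -eA -ge0_integralZl; [|exact: measurableT| |by move=> s _; exact: f0
    |by rewrite lee_fin exprn_ge0// divr_ge0 ?sqrtr_ge0 ?ltW]; last first.
    by apply: (measurableT_comp mf); apply: measurable_funD => //; exact: measurable_funM.
  have aux (S D : R) : expR (- (k ^+ 2 * (S * S + D))) * (1 + cos (normV w * S)) =
      expR (- (k * S + 0) ^+ 2) * (1 + cos (normV w / k * (k * S + 0))) * expR (- (k ^+ 2 * D)).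
    rewrite addr0 (_ : normV w / k * (k * S) = normV w * S); last by rewrite mulrA divfK.
    rewrite (_ : - (k ^+ 2 * (S * S + D)) = - (k * S) ^+ 2 + - (k ^+ 2 * D)); last by ring.
    by rewrite expRD; ring.
  apply: eq_integral => s _.
  transitivity (\int[lebesgue_Rn R n]_y (f (k * s + 0)%R * (expR (- (k ^+ 2 * dotV y y)))%:E))%E.
    apply: eq_integral => y _; rewrite /H/= dotV_cons fstRn_cons /f -EFinM; congr EFin.
    exact: aux.
  rewrite ge0_integralZl; [|exact: measurableT| |by move=> y _; rewrite lee_fin expR_ge0|exact: f0]; last first.
    by apply/measurable_EFinP; exact: measurable_gauss_Rn.
  by rewrite integral_gauss_Rn// muleC.
move: (rotation_invariant w mH H0); rewrite eL eR => e0.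
have {e0} e := EFin_inj e0.
apply: (addrI ((Num.sqrt pi / k) ^+ n.+1)); rewrite e.
have -> : (normV w / k) ^+ 2 / 4 = dotV w w / (4 * k ^+ 2).
  by rewrite expr_div_n normV_sqr; field.
move: (Num.sqrt pi) (expR _) => S X; rewrite [(S / k) ^+ n.+1]exprSr.
by move: ((S / k) ^+ n) => Q; field.
Qed.

End gauss_fourier.

Section fubini_bounded.
Context {R : realType} d1 d2 (T1 : measurableType d1) (T2 : measurableType d2).
Variables (m1 : {sigma_finite_measure set T1 -> \bar R}) (m2 : {sigma_finite_measure set T2 -> \bar R}).
Variables (F : T1 * T2 -> R) (A : T1 -> R) (B : T2 -> R).
Hypotheses (mF : measurable_fun [set: T1 * T2] F).
Hypotheses (iA : m1.-integrable setT (EFin \o A)) (iB : m2.-integrable setT (EFin \o B)).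
Hypotheses (A0 : forall x, 0 <= A x) (B0 : forall y, 0 <= B y).
Hypothesis FAB : forall x y, `|F (x, y)| <= A x * B y.

Let iF1 x : m2.-integrable setT (EFin \o (fun y => F (x, y))).
Proof.
apply: (le_integrable measurableT _ _ (integrable_realZ measurableT (A x) iB)).
  by apply/measurable_EFinP; exact: (measurableT_comp mF (measurable_pair1 x)).
by move=> y _; rewrite /= lee_fin (ger0_norm (mulr_ge0 (A0 x) (B0 y))) FAB.
Qed.

Let iF2 y : m1.-integrable setT (EFin \o (fun x => F (x, y))).
Proof.
apply: (le_integrable measurableT _ _ (integrable_realZ measurableT (B y) iA)).
  by apply/measurable_EFinP; exact: (measurableT_comp mF (measurable_pair2 y)).
by move=> x _; rewrite /= lee_fin (ger0_norm (mulr_ge0 (B0 y) (A0 x))) mulrC FAB.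
Qed.

Let iF : (m1 \x m2)%E.-integrable setT (EFin \o F).
Proof.
have mFE : measurable_fun setT (EFin \o F) by exact/measurable_EFinP.
apply/(integrable12ltyP m1 m2 mFE).
apply: (@le_lt_trans _ _ (\int[m1]_x ((A x)%:E * \int[m2]_y (B y)%:E))%E).
  apply: ge0_le_integral.
  - exact: measurableT.
  - by move=> x _; apply: integral_ge0.
  - apply: (measurable_fun_fubini_tonelli_F (m2 := m2) (fun p => `|(EFin \o F) p|%E)) => //.
    exact: (measurableT_comp (@abse_measurable R setT) mFE).
  - by apply: emeasurable_funM; [exact: (measurable_int _ iA)|exact: measurable_cst].
  - move=> x _; rewrite -ge0_integralZl; [|exact: measurableT|exact: (measurable_int _ iB)
      |by move=> y _; rewrite lee_fin|by rewrite lee_fin].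
    apply: ge0_le_integral.
    + exact: measurableT.
    + by move=> y _; exact: abse_ge0.
    + apply: (measurableT_comp (@abse_measurable R setT)).
      exact: (measurable_int _ (iF1 x)).
    + by apply: emeasurable_funM; [exact: measurable_cst|exact: (measurable_int _ iB)].
    + by move=> y _; rewrite -EFinM /= lee_fin FAB.
have fB : (\int[m2]_y (B y)%:E)%E \is a fin_num by exact: (integrable_fin_num measurableT iB).
have fA : (\int[m1]_y (A y)%:E)%E \is a fin_num by exact: (integrable_fin_num measurableT iA).
rewrite ge0_integralZr; [|exact: measurableT|exact: (measurable_int _ iA)|by move=> x _; rewrite lee_fin
  |by apply: integral_ge0 => y _; rewrite lee_fin].
by rewrite -(fineK fA) -(fineK fB) -EFinM ltry.
Qed.

(** The product bound gives integrability on the product space and of every section, so the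
    real-valued inner integrals agree with the extended ones. *)
Lemma Rintegral_fubini :
  (\int[m1]_x \int[m2]_y F (x, y))%R = (\int[m2]_y \int[m1]_x F (x, y))%R.
Proof.
have E1 x : ((\int[m2]_y F (x, y))%R)%:E = (\int[m2]_y (F (x, y))%:E)%E.
  by rewrite fineK//; exact: (integrable_fin_num measurableT (iF1 x)).
have E2 y : ((\int[m1]_x F (x, y))%R)%:E = (\int[m1]_x (F (x, y))%:E)%E.
  by rewrite fineK//; exact: (integrable_fin_num measurableT (iF2 y)).
rewrite /Rintegral; under eq_integral do rewrite -/(Rintegral _ _ _) E1.
under [in RHS]eq_integral do rewrite -/(Rintegral _ _ _) E2.
by congr fine; exact: (Fubini iF).
Qed.

Lemma measurable_Rintegral_fubini : measurable_fun [set: T1] (fun x => \int[m2]_y F (x, y))%R.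
Proof.
apply/measurable_EFinP.
rewrite (_ : _ \o _ = fubini_F m2 (EFin \o F)); last first.
  apply/funext => x; rewrite /= fineK//.
  exact: (integrable_fin_num measurableT (iF1 x)).
exact: (measurable_int _ (integrable_fubini_F iF)).
Qed.

End fubini_bounded.

Section gauss_kernel.
Context {R : realType} (n : nat).
Local Notation V := (Rn R n.+1).
Local Notation L := (lebesgue_Rn R n.+1).

Lemma dotVC (x y : V) : dotV x y = dotV y x.
Proof. by rewrite /dotV; apply: eq_bigr => i _; rewrite mulrC. Qed.

Lemma sqdistC (e : R) (x y : V) : sqdist e x y = sqdist e y x.
Proof. by rewrite /sqdist dotVC addrC -addrA [_ + dotV x x]addrC addrA. Qed.

Lemma sqdist_oppV (e : R) (x y : V) : sqdist e x (oppV y) = sqdist (- e) x y.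
Proof. by rewrite /sqdist !dotV_oppVr dotV_oppVl opprK; ring. Qed.

Lemma sqdist_ge0 (e : R) (x y : V) : e ^+ 2 = 1 -> 0 <= sqdist e x y.
Proof.
move=> e1; have -> : sqdist e x y = \sum_(i < n.+1) ((tnth x i : R) + e * (tnth y i : R)) ^+ 2.
  rewrite /sqdist /dotV mulr_sumr -!big_split/=; apply: eq_bigr => i _.
  have aux (a b : R) : a * a + 2 * e * (a * b) + b * b = (a + e * b) ^+ 2.
    by rewrite sqrrD exprMn e1; ring.
  exact: aux.
by apply: sumr_ge0 => i _; exact: sqr_ge0.
Qed.

Lemma measurable_sqdist_pair (e : R) : measurable_fun [set: V * V] (fun p => sqdist e p.1 p.2).
Proof.
apply: measurable_funD; last exact: (measurableT_comp (@measurable_dotVV R n.+1) measurable_snd).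
apply: measurable_funD; first exact: (measurableT_comp (@measurable_dotVV R n.+1) measurable_fst).
by apply: measurable_funM; [exact: measurable_cst|exact: measurable_dotV].
Qed.

(** The Gaussian probability density in dimension [n + 1] as a function of the squared distance [s];
    it concentrates as [b] grows. *)
Definition gauss_kernel (b s : R) : R := (b / Num.sqrt pi) ^+ n.+1 * expR (- (b ^+ 2 * s)).

Lemma gauss_kernel_ge0 (b s : R) : 0 <= b -> 0 <= gauss_kernel b s.
Proof. by move=> b0; rewrite mulr_ge0 ?expR_ge0// exprn_ge0// divr_ge0// sqrtr_ge0. Qed.

Lemma gauss_kernel_le (b s s' : R) : 0 <= b -> s' <= s -> gauss_kernel b s <= gauss_kernel b s'.
Proof.
move=> b0 ss; rewrite ler_wpM2l//; first by rewrite exprn_ge0// divr_ge0// sqrtr_ge0.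
by rewrite ler_expR lerN2 ler_wpM2l// sqr_ge0.
Qed.

Lemma measurable_gauss_kernel (b : R) : measurable_fun [set: R] (gauss_kernel b).
Proof.
apply: measurable_funM; first exact: measurable_cst.
apply: (measurableT_comp (@measurable_expR R)); apply: measurable_funN.
exact: measurable_funM.
Qed.

(** [c = 1] is the normalization, and [c^2 = 1/2] is the widened kernel by which tails are
    estimated. *)
Lemma integral_gauss_kernel (b c : R) (y : V) : 0 < b -> 0 < c ->
  (\int[L]_x (gauss_kernel b (c ^+ 2 * sqdist (-1) x y))%:E = (c^-1 ^+ n.+1)%:E)%E.
Proof.
move=> b0 c0; have bc : 0 < b * c by rewrite mulr_gt0.
have e1 : (-1) ^+ 2 = 1 :> R by rewrite sqrrN expr1n.
have s0 : 0 < Num.sqrt pi :> R by rewrite sqrtr_gt0 pi_gt0.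
have := integral_gauss_sqdist y bc e1.
have -> : (c^-1 ^+ n.+1)%:E = (((b / Num.sqrt pi) ^+ n.+1)%:E * ((Num.sqrt pi / (b * c)) ^+ n.+1)%:E)%E.
  rewrite -EFinM -exprMn; congr (EFin (_ ^+ _)).
  by move: (Num.sqrt pi) s0 => s s0; field; rewrite !gt_eqF.
move=> <-; rewrite -ge0_integralZl; [|exact: measurableT|exact: measurable_expR_sqdist
  |by move=> x _; rewrite lee_fin expR_ge0|by rewrite lee_fin exprn_ge0// divr_ge0 ?ltW].
apply: eq_integral => x _; rewrite -EFinM; congr (EFin (_ * expR (- _))).
by rewrite [(b * c) ^+ 2]exprMn mulrA.
Qed.

Lemma expR_ge_pow (y : R) k : 0 <= y -> y ^+ k / k`!%:R <= expR y.
Proof.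
move=> y0; apply: (@le_trans _ _ (series (exp_coeff y) k.+1)).
  rewrite /series/= big_nat_recr//= lerDr sumr_ge0// => i _.
  by rewrite /exp_coeff/= divr_ge0// exprn_ge0.
apply: nondecreasing_cvgn_le; last exact: is_cvg_series_exp_coeff.
by apply: nondecreasing_series => i _ _; rewrite /exp_coeff/= divr_ge0// exprn_ge0.
Qed.

(* [b >= 1] only serves to bound [b ^- n.+1] by [b^-1]. *)
Lemma gauss_kernel_decay (dl : R) : 0 < dl ->
  exists2 C, 0 <= C & forall b, 1 <= b -> gauss_kernel b dl <= C / b.
Proof.
move=> dl0; have s0 : 0 < Num.sqrt pi :> R by rewrite sqrtr_gt0 pi_gt0.
pose C : R := (n.+1)`!%:R / (Num.sqrt pi * dl) ^+ n.+1.
have C0 : 0 <= C by rewrite divr_ge0// exprn_ge0// mulr_ge0 ?ltW.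
exists C => // b b1; have b0 : 0 < b by exact: lt_le_trans b1.
have y0 : 0 < b ^+ 2 * dl by rewrite mulr_gt0// exprn_gt0.
have f0 : 0 < (n.+1)`!%:R :> R by rewrite ltr0n fact_gt0.
have h : expR (- (b ^+ 2 * dl)) <= (n.+1)`!%:R / (b ^+ 2 * dl) ^+ n.+1.
  rewrite expRN -[leRHS]invf_div lef_pV2 ?posrE ?expR_gt0 ?divr_gt0 ?exprn_gt0//.
  exact: (expR_ge_pow _ (ltW y0)).
rewrite /gauss_kernel (le_trans (ler_wpM2l _ h)) ?exprn_ge0 ?divr_ge0 ?(ltW b0) ?(ltW s0)//.
have -> : (b / Num.sqrt pi) ^+ n.+1 * ((n.+1)`!%:R / (b ^+ 2 * dl) ^+ n.+1) = C * b^-1 ^+ n.+1.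
  have -> : (b / Num.sqrt pi) ^+ n.+1 =
      (b ^+ 2 * dl) ^+ n.+1 * ((Num.sqrt pi * dl) ^+ n.+1)^-1 * b^-1 ^+ n.+1.
    rewrite -exprVn -!exprMn; congr (_ ^+ _).
    by move: (Num.sqrt pi) s0 => s s0; field; rewrite !gt_eqF.
  rewrite /C; have := expf_neq0 n.+1 (lt0r_neq0 y0).
  move: ((b ^+ 2 * dl) ^+ n.+1) ((_ ^+ n.+1)^-1) (b^-1 ^+ n.+1) => B D E B0.
  by field.
rewrite ler_wpM2l// exprS ler_piMr ?invr_ge0 ?(ltW b0)//.
by rewrite exprn_ile1 ?invr_ge0 ?(ltW b0)// invf_le1.
Qed.

End gauss_kernel.

(** * Complex norms and Fourier transforms of real-valued functions *)

Section real_valued.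
Context {R : realType} (n : nat).
Local Notation V := (Rn R n).
Local Notation L := (lebesgue_Rn R n).
Implicit Types g : V -> R.

Lemma normc_real (x : R) : ComplexField.Normc.normc x%:C%C = `|x|.
Proof. by rewrite /= expr0n addr0 sqrtr_sqr. Qed.

Lemma cLnorm2_real g : L.-integrable setT (EFin \o (fun x => g x ^+ 2)) ->
  cLnorm 2%:E (fun x => (g x)%:C%C) = (Num.sqrt (\int[L]_x (g x ^+ 2))%R)%:E.
Proof.
move=> ig; rewrite /cLnorm unlock -powR12_sqrt; last first.
  by apply: Rintegral_ge0 => x _; exact: sqr_ge0.
rewrite -poweR_EFin fineK; last exact: (integrable_fin_num measurableT ig).
congr (_ `^ _)%E; apply: eq_integral => x _.
by rewrite normc_real /= normr_id powR_mulrn// real_normK// num_real.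
Qed.

Lemma cLnorm1_real g : cLnorm 1%:E (fun x => (g x)%:C%C) = (\int[L]_x `|(g x)%:E|)%E.
Proof.
rewrite /cLnorm Lnorm1; apply: eq_integral => x _.
by rewrite normc_real /= normr_id.
Qed.

Lemma cLp2_real g : measurable_fun [set: V] g ->
  L.-integrable setT (EFin \o (fun x => g x ^+ 2)) -> cLp 2%:E (fun x => (g x)%:C%C).
Proof.
move=> mg ig; split; [exact: mg|exact: measurable_cst|].
by rewrite (cLnorm2_real ig) ltry.
Qed.

Lemma cLp1_real g : L.-integrable setT (EFin \o g) -> cLp 1%:E (fun x => (g x)%:C%C).
Proof.
move=> /integrableP[mg ig]; split; [exact/measurable_EFinP|exact: measurable_cst|].
by rewrite cLnorm1_real.
Qed.

Lemma cLnorm2_real_cvg0 (g : nat -> V -> R) :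
  (forall j, L.-integrable setT (EFin \o (fun x => g j x ^+ 2))) ->
  (fun j => (\int[L]_x (g j x ^+ 2))%R) @ \oo --> (0 : R) ->
  cLnorm 2%:E (fun x => (g j x)%:C%C) @[j --> \oo] --> 0%E.
Proof.
move=> ig g0; rewrite (_ : (fun j => _) = fun j => (Num.sqrt (\int[L]_x (g j x ^+ 2))%R)%:E); last first.
  by apply/funext => j; rewrite cLnorm2_real.
apply: cvg_EFin; first exact: nearW.
have := cvg_comp _ (@Num.sqrt R) g0 (@sqrt_continuous R _).
by rewrite sqrtr0.
Qed.

(** The imaginary part is the integral of an odd function. *)
Lemma fourier_real_even g : L.-integrable setT (EFin \o g) -> (forall x, g (oppV x) = g x) ->
  forall xi, fourier (fun x => (g x)%:C%C) xi =
    ((\int[L]_x (g x * cos (2 * pi * dotV xi x)))%R)%:C%C.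
Proof.
move=> ig geven xi; rewrite /fourier /cintegral.
have mg : measurable_fun [set: V] g by apply/measurable_EFinP; exact: (measurable_int _ ig).
have dC (x : V) : dotV x xi = dotV xi x by rewrite /dotV; apply: eq_bigr => i _; rewrite mulrC.
congr (_ +i* _)%C.
  by apply: eq_Rintegral => x _; rewrite /= mul0r subr0 cosN dC.
have ms : measurable_fun [set: V] (fun x => sin (- (2 * pi * dotV x xi))).
  apply: (measurableT_comp (continuous_measurable_fun (@continuous_sin R))).
  apply: measurable_funN; apply: measurable_funM; first exact: measurable_cst.
  exact: measurable_dotVl.
have isn := integrable_realM measurableT ig ms (C := 1) (fun x _ => sin_max _).
rewrite -[RHS](Rintegral_odd isn); last first.
  by move=> x; rewrite geven dotV_oppVl mulrN opprK sinN mulrN opprK.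
by apply: eq_Rintegral => x _; rewrite /= mul0r addr0.
Qed.

End real_valued.

(** * Inversion for an even nonnegative function, continuous almost everywhere *)

Section inversion.
Context {R : realType} (n : nat).
Local Notation V := (Rn R n.+1).
Local Notation L := (lebesgue_Rn R n.+1).
Variable p : V -> R.
Hypotheses (p0 : forall x, 0 <= p x) (mp : measurable_fun [set: V] p).
Hypothesis ip : L.-integrable setT (EFin \o p).
Hypothesis ip2 : L.-integrable setT (EFin \o (fun x => p x ^+ 2)).
Hypothesis peven : forall x, p (oppV x) = p x.
(** Continuity at almost every point, phrased through the squared distance in which the Gaussian
    kernel is expressed. *)
Hypothesis pcont : {ae L, forall x, forall e : R, 0 < e ->
  exists2 dl : R, 0 < dl & forall y, sqdist (-1) x y < dl -> `|p y - p x| <= e}.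

Let e1 : (-1) ^+ 2 = 1 :> R. Proof. by rewrite sqrrN expr1n. Qed.
Let M := (\int[L]_x p x)%R.
Let S := (\int[L]_x (p x ^+ 2))%R.
Let gk (b : R) (x y : V) := gauss_kernel n b (sqdist (-1) x y).

Let M0 : 0 <= M. Proof. by apply: Rintegral_ge0 => x _; exact: p0. Qed.
Let S0 : 0 <= S. Proof. by apply: Rintegral_ge0 => x _; exact: sqr_ge0. Qed.

Let gk_ge0 b x y : 0 <= b -> 0 <= gk b x y. Proof. exact: gauss_kernel_ge0. Qed.

Let gkC b x y : gk b x y = gk b y x. Proof. by rewrite /gk sqdistC. Qed.

Let measurable_gk b : measurable_fun [set: V * V] (fun q => gk b q.1 q.2).
Proof. exact: (measurableT_comp (measurable_gauss_kernel n b) (@measurable_sqdist_pair R n (-1))). Qed.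

Let measurable_gk1 b x : measurable_fun [set: V] (gk b x).
Proof. exact: (measurableT_comp (measurable_gk b) (measurable_pair1 x)). Qed.

Let integral_gk b x : 0 < b -> (\int[L]_y (gk b x y)%:E = 1)%E.
Proof.
move=> b0; have := integral_gauss_kernel x b0 (@ltr01 R).
rewrite invr1 expr1n => <-; apply: eq_integral => y _.
by rewrite gkC expr1n mul1r.
Qed.

Let integrable_gk b x : 0 < b -> L.-integrable setT (EFin \o gk b x).
Proof.
move=> b0; apply/integrableP; split; first by apply/measurable_EFinP; exact: measurable_gk1.
under eq_integral do rewrite /= ger0_norm ?gk_ge0 ?(ltW b0)//.
by rewrite integral_gk// ltry.
Qed.

Let Rintegral_gk b x : 0 < b -> (\int[L]_y gk b x y)%R = 1.
Proof. by move=> b0; rewrite /Rintegral integral_gk. Qed.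

Let gk_le b x y : 0 < b -> `|gk b x y| <= gauss_kernel n b 0.
Proof.
by move=> b0; rewrite ger0_norm ?gk_ge0 ?(ltW b0)// gauss_kernel_le ?sqdist_ge0 ?(ltW b0).
Qed.

Let integrable_mul_gk f b x : 0 < b -> L.-integrable setT (EFin \o f) ->
  L.-integrable setT (EFin \o (fun y => f y * gk b x y)).
Proof.
move=> b0 fi; apply: (integrable_realM measurableT fi (measurable_gk1 b x) (C := gauss_kernel n b 0)).
by move=> y _; exact: gk_le.
Qed.

Definition gauss_mollifier (b : R) (x : V) : R := (\int[L]_y (p y * gk b x y))%R.
Local Notation u := gauss_mollifier.

Let u_ge0 b x : 0 < b -> 0 <= u b x.
Proof. by move=> b0; apply: Rintegral_ge0 => y _; rewrite mulr_ge0 ?gk_ge0 ?(ltW b0). Qed.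

Let uE b x : 0 < b -> ((u b x)%:E = \int[L]_y (p y * gk b x y)%:E)%E.
Proof.
by move=> b0; rewrite fineK//; apply: (integrable_fin_num measurableT); exact: integrable_mul_gk.
Qed.

Let measurable_u b : 0 < b -> measurable_fun [set: V] (u b).
Proof.
move=> b0; apply/measurable_EFinP.
rewrite (_ : _ \o _ = fun x => (\int[L]_y (p y * gk b x y)%:E)%E); last first.
  by apply/funext => x; rewrite /= uE.
apply: (measurable_fun_fubini_tonelli_F (m2 := L) (fun q : V * V => (p q.2 * gk b q.1 q.2)%:E)).
  apply/measurable_EFinP; apply: measurable_funM; last exact: measurable_gk.
  exact: (measurableT_comp mp measurable_snd).
by move=> q; rewrite lee_fin mulr_ge0 ?gk_ge0 ?(ltW b0).
Qed.

(* Jensen's inequality for the probability density [gk b x]. *)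
Let u_sqr_le b x : 0 < b -> u b x ^+ 2 <= (\int[L]_y (p y ^+ 2 * gk b x y))%R.
Proof.
move=> b0; have i1 := integrable_mul_gk x b0 ip.
have i2 := integrable_mul_gk x b0 ip2.
have i3 := integrable_realZ measurableT (u b x ^+ 2) (integrable_gk x b0).
have h : (\int[L]_y (2 * u b x * (p y * gk b x y)) <=
    \int[L]_y (p y ^+ 2 * gk b x y + u b x ^+ 2 * gk b x y))%R.
  apply: le_Rintegral.
  - exact: measurableT.
  - exact: integrable_realZ.
  - exact: integrable_realD.
  - move=> y _; rewrite mulrA -mulrDl ler_wpM2r ?gk_ge0 ?(ltW b0)//.
    rewrite -subr_ge0 (_ : _ - _ = (p y - u b x) ^+ 2) ?sqr_ge0//.
    by rewrite sqrrB; ring.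
move: h; rewrite (RintegralZl _ measurableT i1) (RintegralD measurableT i2 i3).
rewrite (RintegralZl _ measurableT (integrable_gk x b0)) Rintegral_gk// -/(u b x).
by move: (Rintegral _ _ _) (u b x) => A U; nra.
Qed.

(** Integrates the pointwise Jensen inequality and exchanges the integrals: by symmetry the kernel
    has mass 1 in [x] as well. *)
Let integral_u_sqr_le b : 0 < b -> (\int[L]_x (u b x ^+ 2)%:E <= S%:E)%E.
Proof.
move=> b0.
have mF : measurable_fun [set: V * V] (fun q : V * V => (p q.2 ^+ 2 * gk b q.1 q.2)%:E).
  apply/measurable_EFinP; apply: measurable_funM; last exact: measurable_gk.
  by apply: measurable_funX; exact: (measurableT_comp mp measurable_snd).
have F0 q : (0 <= (p q.2 ^+ 2 * gk b q.1 q.2)%:E)%E.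
  by rewrite lee_fin mulr_ge0 ?sqr_ge0 ?gk_ge0 ?(ltW b0).
apply: (@le_trans _ _ (\int[L]_x \int[L]_y (p y ^+ 2 * gk b x y)%:E)%E).
  apply: ge0_le_integral.
  - exact: measurableT.
  - by move=> x _; rewrite lee_fin sqr_ge0.
  - by apply/measurable_EFinP; apply: measurable_funX; exact: measurable_u.
  - exact: (measurable_fun_fubini_tonelli_F (m2 := L) _ mF F0).
  - move=> x _; have := u_sqr_le x b0; rewrite -lee_fin => h; rewrite (le_trans h)//.
    by rewrite fineK//; apply: (integrable_fin_num measurableT); exact: integrable_mul_gk.
rewrite (fubini_tonelli (m1 := L) (m2 := L) _ mF F0)/=.
rewrite (_ : (\int[L]_y _)%E = (\int[L]_y (p y ^+ 2)%:E)%E); last first.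
  apply: eq_integral => y _; under eq_integral do rewrite EFinM gkC.
  rewrite ge0_integralZl; [|exact: measurableT|by apply/measurable_EFinP; exact: measurable_gk1
    |by move=> x _; rewrite lee_fin gk_ge0 ?(ltW b0)|by rewrite lee_fin sqr_ge0].
  by rewrite integral_gk// mule1.
by rewrite /S fineK//; exact: (integrable_fin_num measurableT ip2).
Qed.

(** Approximate identity at a point of continuity, for a [p] that may be unbounded. Near [x] the
    difference is at most [e / 2] and the kernel has mass 1. Far away, [p y] meets a kernel of size
    at most [C1 / b], and [p x] is multiplied by the tail of the kernel, which is of order [1 / b]
    too. *)
Let u_cvg : {ae L, forall x, (fun j : nat => u (j.+1%:R * pi) x) @ \oo --> p x}.
Proof.
apply: filterS pcont => x xcont; apply/cvgrPdist_le => /= e e0.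
have [dl dl0 hdl] := xcont (e / 2) ltac:(by rewrite divr_gt0).
have [C1 C10 hC1] := @gauss_kernel_decay R n dl dl0.
(* The factors are [p x], the mass of the widened kernel [k] below, and the constant in
   [exp (- b^2 dl / 2) <= (2 / dl) / b], valid for [b >= 1]. *)
pose C2 := p x * (Num.sqrt 2 ^+ n.+1 * (2 / dl)).
have C20 : 0 <= C2 by rewrite !mulr_ge0 ?exprn_ge0 ?invr_ge0 ?(ltW dl0).
have bound b : 1 <= b -> `|p x - u b x| <= e / 2 + (C1 * M + C2) / b.
  move=> b1; have b0 : 0 < b by exact: lt_le_trans b1.
  pose c : R := (Num.sqrt 2)^-1.
  have c0 : 0 < c by rewrite invr_gt0 sqrtr_gt0.
  have c2 : c ^+ 2 = 2^-1 by rewrite exprVn sqr_sqrtr.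
  (* Far from [x] half of the exponent is given up: the kernel is at most [exp (- b^2 dl / 2)] times
     the kernel at half the squared distance, whose mass is [(sqrt 2)^(n+1)]. *)
  pose k y := gauss_kernel n b (c ^+ 2 * sqdist (-1) y x).
  have k0 y : 0 <= k y by apply: gauss_kernel_ge0; exact: ltW.
  have ik : L.-integrable setT (EFin \o k).
    apply/integrableP; split.
      apply/measurable_EFinP; apply: (measurableT_comp (measurable_gauss_kernel n b)).
      by apply: measurable_funM; [exact: measurable_cst|exact: measurable_sqdist].
    under eq_integral do rewrite /= ger0_norm ?gauss_kernel_ge0 ?(ltW b0)//.
    by rewrite integral_gauss_kernel// ltry.
  have i1 := integrable_realZ measurableT (e / 2) (integrable_gk x b0).
  have i2 := integrable_realZ measurableT (C1 / b) ip.
  pose E := expR (- (b ^+ 2 * (dl / 2))).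
  have i3 := integrable_realZ measurableT (p x * E) ik.
  have ipg := integrable_mul_gk x b0 ip.
  have igx := integrable_realZ measurableT (p x) (integrable_gk x b0).
  have -> : p x - u b x = (\int[L]_y (p x * gk b x y - p y * gk b x y))%R.
    rewrite (RintegralB measurableT igx ipg) (RintegralZl _ measurableT (integrable_gk x b0)).
    by rewrite Rintegral_gk// mulr1.
  have iB := integrable_realB measurableT igx ipg.
  rewrite (le_trans (le_normr_Rintegral measurableT iB))//.
  have i12 := integrable_realD measurableT i1 i2.
  have i123 := integrable_realD measurableT i12 i3.
  apply: (@le_trans _ _ (\int[L]_y (e / 2 * gk b x y + C1 / b * p y + p x * E * k y))%R).
    apply: le_Rintegral.
    - exact: measurableT.
    - have := integrable_norm iB; exact: eq_integrable.
    - exact: i123.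
    - move=> y _; rewrite -mulrBl normrM (ger0_norm (gk_ge0 x y (ltW b0))) distrC.
      have g0 := gk_ge0 x y (ltW b0).
      have [near|far] := ltP (sqdist (-1) x y) dl.
        apply: (@le_trans _ _ (e / 2 * gk b x y)); first by rewrite ler_wpM2r// hdl.
        rewrite -addrA lerDl addr_ge0//; first by rewrite mulr_ge0// divr_ge0// ltW.
        by rewrite mulr_ge0// mulr_ge0// expR_ge0.
      apply: (@le_trans _ _ (p y * gk b x y + p x * gk b x y)).
        by rewrite -mulrDl ler_wpM2r// (le_trans (ler_normB _ _))// !ger0_norm.
      rewrite lerD//.
        apply: (@le_trans _ _ (C1 / b * p y)); last by rewrite lerDr mulr_ge0// divr_ge0// ltW.
        by rewrite mulrC ler_wpM2r// (le_trans (gauss_kernel_le n (ltW b0) far))// hC1.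
      rewrite -mulrA ler_wpM2l// /k /gk /E sqdistC c2 /gauss_kernel mulrCA ler_wpM2l//.
        by rewrite exprn_ge0// divr_ge0 ?sqrtr_ge0 ?ltW.
      rewrite -expRD ler_expR -opprD lerN2 -mulrDr ler_wpM2l ?sqr_ge0//.
      by move: far; rewrite sqdistC; move: (sqdist _ _ _) => s; lra.
  rewrite (RintegralD measurableT i12 i3) (RintegralD measurableT i1 i2).
  rewrite (RintegralZl _ measurableT (integrable_gk x b0)) (RintegralZl _ measurableT ip).
  rewrite (RintegralZl _ measurableT ik) Rintegral_gk// mulr1 -addrA lerD2l mulrDl.
  rewrite -/M mulrAC lerD2l /Rintegral integral_gauss_kernel//= /c invrK /C2.
  rewrite -mulrA -[leRHS]mulrA ler_wpM2l// mulrC -mulrA ler_wpM2l ?exprn_ge0 ?sqrtr_ge0//.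
  have y0 : 0 <= b ^+ 2 * (dl / 2) by rewrite mulr_ge0 ?sqr_ge0 ?divr_ge0 ?(ltW dl0).
  have y1 : 0 < b * (dl / 2) by rewrite mulr_gt0// divr_gt0.
  rewrite /E expRN (_ : 2 / dl / b = (b * (dl / 2))^-1); last by field; rewrite !gt_eqF.
  rewrite lef_pV2 ?posrE ?expR_gt0//.
  have := expR_ge_pow 1 y0; rewrite expr1 divr1 => h; rewrite (le_trans _ h)//.
  by rewrite expr2 -mulrA ler_peMl// ltW.
have K0 : 0 <= C1 * M + C2 by rewrite addr_ge0// mulr_ge0.
have pi1 : 1 <= pi :> R by rewrite (le_trans _ (pi_ge2 R))// ler1n.
near=> j.
have j1 : 1 <= j.+1%:R * pi :> R by rewrite mulr_ege1// ler1n.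
rewrite (le_trans (bound _ j1))// [leRHS](splitr e) lerD2l.
have j0 : 0 < j.+1%:R :> R by rewrite ltr0n.
rewrite (@le_trans _ _ ((C1 * M + C2) / j.+1%:R))//.
  rewrite ler_wpM2l// lef_pV2 ?posrE//; first by rewrite ler_peMr// ltW.
  by rewrite (lt_le_trans _ j1).
have jK : (C1 * M + C2) / (e / 2) <= j%:R by near: j; exact: nbhs_infty_ger.
have e20 : 0 < e / 2 by rewrite divr_gt0.
rewrite ler_pdivrMr// [leRHS]mulrC -ler_pdivrMr//.
by rewrite (le_trans jK)// ler_nat.
Unshelve. all: by end_near.
Qed.

(** The factor pi makes [pi / b_ j] the harmonic sequence [1 / (j + 1)], the parameter of the
    Gaussian [E] on the frequency side. *)
Let b_ (j : nat) : R := j.+1%:R * pi.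
Let b_gt0 j : 0 < b_ j. Proof. by rewrite mulr_gt0 ?ltr0n ?pi_gt0. Qed.

Let ip2E : (\int[L]_x (p x ^+ 2)%:E = S%:E)%E.
Proof. by rewrite /S fineK//; exact: (integrable_fin_num measurableT ip2). Qed.

Let iu2 b : 0 < b -> L.-integrable setT (EFin \o (fun x => u b x ^+ 2)).
Proof.
move=> b0; apply/integrableP; split.
  by apply/measurable_EFinP; apply: measurable_funX; exact: measurable_u.
under eq_integral do rewrite /= ger0_norm ?sqr_ge0//.
by rewrite (le_lt_trans (integral_u_sqr_le b0))// ltry.
Qed.

Let up_ge0 b x : 0 < b -> 0 <= u b x * p x.
Proof. by move=> b0; rewrite mulr_ge0 ?u_ge0. Qed.

Let measurable_up b : 0 < b -> measurable_fun [set: V] (fun x => u b x * p x).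
Proof. by move=> b0; apply: measurable_funM => //; exact: measurable_u. Qed.

Let iup b : 0 < b -> L.-integrable setT (EFin \o (fun x => u b x * p x)).
Proof.
move=> b0; have i := integrable_realD measurableT (iu2 b0) ip2.
apply: (le_integrable measurableT _ _ i).
  by apply/measurable_EFinP; exact: measurable_up.
move=> x _; rewrite /= lee_fin ger0_norm ?up_ge0// ger0_norm ?addr_ge0 ?sqr_ge0//.
by move: (u b x) (p x) => a c; nra.
Qed.

Let a_ (j : nat) : R := (\int[L]_x (u (b_ j) x * p x))%R.

Let Rintegral_u2_le b : 0 < b -> (\int[L]_x (u b x ^+ 2))%R <= S.
Proof.
move=> b0; have h : ((\int[L]_x (u b x ^+ 2))%R%:E = \int[L]_x (u b x ^+ 2)%:E)%E.
  by rewrite fineK//; exact: (integrable_fin_num measurableT (iu2 b0)).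
by rewrite -lee_fin h integral_u_sqr_le.
Qed.

Lemma pairing_mollifier_le b : 0 < b -> (\int[L]_x (u b x * p x))%R <= S.
Proof.
move=> b0; have iu := iup b0; have iS := iu2 b0.
have i := integrable_realD measurableT iS ip2.
have : (\int[L]_x (2 * (u b x * p x)) <= \int[L]_x (u b x ^+ 2 + p x ^+ 2))%R.
  apply: le_Rintegral.
  - exact: measurableT.
  - exact: integrable_realZ.
  - exact: i.
  - move=> x _; move: (u _ x) (p x) => a c.
    rewrite -subr_ge0 (_ : _ - _ = (a - c) ^+ 2) ?sqr_ge0//; ring.
rewrite (RintegralZl _ measurableT iu) (RintegralD measurableT iS ip2).
by have := Rintegral_u2_le b0; rewrite -/S; lra.
Qed.

Let a_le j : a_ j <= S. Proof. exact: pairing_mollifier_le. Qed.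

(** The pairings are at most [S]. The products [u p] are nonnegative and tend to [p^2] almost
    everywhere, so Fatou's lemma bounds the lower limit of the pairings below by [S]. The two bounds
    give convergence where no dominating function is at hand. *)
Let a_cvg : a_ @ \oo --> S.
Proof.
pose f j x := (u (b_ j) x * p x)%:E.
have mf j : measurable_fun setT (f j) by apply/measurable_EFinP; exact: measurable_up.
have f0 j x : [set: V] x -> (0 <= f j x)%E by move=> _; rewrite lee_fin up_ge0.
have := fatou L measurableT mf f0.
have -> : (\int[L]_x limn_einf (f ^~ x) = S%:E)%E.
  rewrite -ip2E; apply: ae_eq_integral.
  - exact: measurableT.
  - rewrite (_ : (fun x => _) = fun x => (- limn_esup (fun j => - f j x))%E).
      apply: (measurableT_comp (@oppe_measurable R setT)).
      by apply: measurable_fun_limn_esup => j; exact: (measurableT_comp (@oppe_measurable R setT) (mf j)).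
    by apply/funext => x; have := limn_esupN (f ^~ x) => ->; rewrite oppeK.
  - by apply/measurable_EFinP; exact: measurable_funX.
  - apply: filterS u_cvg => x ux _.
    have fx : f j x @[j --> \oo] --> (p x ^+ 2)%:E.
      by apply: cvg_EFin; [exact: nearW|rewrite expr2; apply: cvgM; [exact: ux|exact: cvg_cst]].
    by rewrite (cvg_limn_einf_sup fx).
have fE j : (\int[L]_x f j x = (a_ j)%:E)%E.
  by rewrite /a_ fineK//; exact: (integrable_fin_num measurableT (iup (b_gt0 j))).
under [X in limn_einf X]eq_fun do rewrite fE.
move=> h; have : (fun j => (- (a_ j))%:E) @ \oo --> (- S)%:E.
  apply: limn_esup_le_cvg; last by move=> j; rewrite lee_fin lerN2.
  rewrite (_ : (fun j => _) = (-%E \o (fun j => (a_ j)%:E))); last by apply/funext => j; rewrite /= EFinN.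
  by rewrite limn_esupN EFinN leeN2.
move=> /fine_cvg/= h1.
rewrite (_ : a_ = fun j => - (- a_ j)); last by apply/funext => j; rewrite opprK.
by rewrite -[S]opprK; apply: cvgN.
Qed.

(** In the expanded square, the integral of [u^2] is at most [S], that of [p^2] is [S], and the
    pairing tends to [S]. *)
Lemma mollifier_cvgL2 :
  (fun j : nat => (\int[L]_x ((u (j.+1%:R * pi) x - p x) ^+ 2))%R) @ \oo --> (0 : R).
Proof.
have E j : (\int[L]_x ((u (b_ j) x - p x) ^+ 2))%R <= 2 * S - 2 * a_ j.
  have iB := integrable_realB measurableT (iu2 (b_gt0 j)) (integrable_realZ measurableT 2 (iup (b_gt0 j))).
  rewrite [leLHS](_ : _ = (\int[L]_x (u (b_ j) x ^+ 2 - 2 * (u (b_ j) x * p x) + p x ^+ 2))%R); last first.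
    by apply: eq_Rintegral => x _; rewrite sqrrB; ring.
  rewrite (RintegralD measurableT iB ip2).
  rewrite (RintegralB measurableT (iu2 (b_gt0 j)) (integrable_realZ measurableT 2 (iup (b_gt0 j)))).
  rewrite (RintegralZl _ measurableT (iup (b_gt0 j))) -/(a_ j) -/S.
  by have := Rintegral_u2_le (b_gt0 j); lra.
apply: (@squeeze_cvgr _ _ _ _ (fun=> 0) (fun j => 2 * S - 2 * a_ j)).
- by apply: nearW => j; rewrite E andbT; apply: Rintegral_ge0 => x _; exact: sqr_ge0.
- exact: cvg_cst.
- have -> : (0 : R) = 2 * S - 2 * S by rewrite subrr.
  by apply: cvgB; [exact: cvg_cst|apply: cvgM; [exact: cvg_cst|exact: a_cvg]].
Qed.

Definition cosine_transform (xi : V) : R := (\int[L]_y (p y * cos (2 * pi * dotV y xi)))%R.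
Local Notation f := cosine_transform.

Let E (b : R) (xi : V) : R := expR (- ((pi / b) ^+ 2 * dotV xi xi)).

Let E_ge0 b xi : 0 <= E b xi. Proof. exact: expR_ge0. Qed.

Let measurable_E b : measurable_fun [set: V] (E b).
Proof. exact: measurable_gauss_Rn. Qed.

Let iE b : 0 < b -> L.-integrable setT (EFin \o E b).
Proof. by move=> b0; apply: integrable_gauss_Rn; rewrite divr_gt0 ?pi_gt0. Qed.

Let measurable_cos_pair : measurable_fun [set: V * V] (fun q => cos (2 * pi * dotV q.2 q.1)).
Proof.
apply: (measurableT_comp (continuous_measurable_fun (@continuous_cos R))).
apply: measurable_funM; first exact: measurable_cst.
rewrite (_ : (fun q => _) = fun q : V * V => dotV q.1 q.2); first exact: measurable_dotV.
by apply/funext => q; exact: dotVC.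
Qed.

Let measurable_cos2 y : measurable_fun [set: V] (fun xi => cos (2 * pi * dotV y xi)).
Proof. exact: (measurableT_comp measurable_cos_pair (measurable_pair2 y)). Qed.

Let measurable_cos1 xi : measurable_fun [set: V] (fun y => cos (2 * pi * dotV y xi)).
Proof. exact: (measurableT_comp measurable_cos_pair (measurable_pair1 xi)). Qed.

Let ipcos xi : L.-integrable setT (EFin \o (fun y => p y * cos (2 * pi * dotV y xi))).
Proof.
apply: (integrable_realM measurableT ip (measurable_cos1 xi) (C := 1)) => y _.
exact: cos_max.
Qed.

Let measurable_pcos : measurable_fun [set: V * V] (fun q => p q.2 * cos (2 * pi * dotV q.2 q.1)).
Proof.
apply: measurable_funM; last exact: measurable_cos_pair.
exact: (measurableT_comp mp measurable_snd).
Qed.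

Let pcos_le xi y : `|p y * cos (2 * pi * dotV y xi)| <= p y.
Proof. by rewrite normrM (ger0_norm (p0 y)) ler_piMr// cos_max. Qed.

Let f_le xi : `|f xi| <= M.
Proof.
rewrite (le_trans (le_normr_Rintegral measurableT (ipcos xi)))//.
apply: le_Rintegral.
- exact: measurableT.
- have := integrable_norm (ipcos xi); exact: eq_integrable.
- exact: ip.
- by move=> y _; exact: pcos_le.
Qed.

(** The Fubini lemma asks for a bound integrable in both variables. Multiplying by the Gaussian
    [E 1] supplies it, and this positive factor is divided out afterwards. *)
Lemma measurable_cosine_transform : measurable_fun [set: V] f.
Proof.
have i1 := iE (@ltr01 R).
have m1 : measurable_fun [set: V * V] (fun q => E 1 q.1 * (p q.2 * cos (2 * pi * dotV q.2 q.1))).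
  by apply: measurable_funM; [exact: (measurableT_comp (measurable_E 1) measurable_fst)|exact: measurable_pcos].
have bd x y : `|E 1 x * (p y * cos (2 * pi * dotV y x))| <= E 1 x * p y.
  by rewrite normrM (ger0_norm (E_ge0 1 x)) ler_wpM2l.
have := measurable_Rintegral_fubini m1 i1 ip (E_ge0 1) p0 bd.
rewrite (_ : (fun x => _) = fun x => E 1 x * f x); last first.
  by apply/funext => x; rewrite -(RintegralZl _ measurableT (ipcos x)).
move=> mEf; rewrite (_ : f = fun x => (E 1 x)^-1 * (E 1 x * f x)); last first.
  by apply/funext => x; rewrite mulKf// gt_eqF// expR_gt0.
apply: measurable_funM => //.
exact: (measurableT_comp (@measurable_invr R) (measurable_E 1)).
Qed.

(** The frequency [2 pi (x + e y)], with [e = 1] or [-1], that appears when a product of two cosines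
    is written as a sum. *)
Let linV (e : R) (x y : V) : V :=
  [tuple 2 * pi * ((tnth x i : R) + e * (tnth y i : R)) | i < n.+1].

Let dotV_linV e x y xi :
  dotV xi (linV e x y) = 2 * pi * dotV x xi + e * (2 * pi * dotV y xi).
Proof.
rewrite /dotV !mulr_sumr -big_split/=; apply: eq_bigr => i _; rewrite tnth_mktuple.
have aux (a b c q : R) : a * (2 * q * (b + e * c)) = 2 * q * (b * a) + e * (2 * q * (c * a)).
  by ring.
exact: aux.
Qed.

Let dotV_linVV e x y : e ^+ 2 = 1 -> dotV (linV e x y) (linV e x y) = (2 * pi) ^+ 2 * sqdist e x y.
Proof.
move=> ee; rewrite /sqdist /dotV mulr_sumr -!big_split/= mulr_sumr; apply: eq_bigr => i _.
rewrite tnth_mktuple.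
have aux (a b q : R) : 2 * q * (a + e * b) * (2 * q * (a + e * b)) =
    (2 * q) ^+ 2 * (a * a + 2 * e * (a * b) + b * b).
  by transitivity ((2 * q) ^+ 2 * (a * a + 2 * e * (a * b) + e ^+ 2 * (b * b))); [ring|rewrite ee mul1r].
exact: aux.
Qed.

Let integral_E_cos b e x y : 0 < b -> e ^+ 2 = 1 ->
  (\int[L]_xi (E b xi * cos (dotV xi (linV e x y))))%R = gauss_kernel n b (sqdist e x y).
Proof.
move=> b0 ee; have p0' := pi_gt0 R; have pb : 0 < pi / b by rewrite divr_gt0.
rewrite (integral_gauss_cos_Rn _ pb) dotV_linVV// /gauss_kernel; congr (_ ^+ _ * expR (- _)).
  have s0 : 0 < Num.sqrt pi :> R by rewrite sqrtr_gt0.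
  have := sqr_sqrtr (ltW p0'); move: s0; move: (Num.sqrt (pi : R)) => s s0 <-.
  by field; rewrite !gt_eqF.
by move: (pi : R) p0' (sqdist _ _ _) => q q0 s; field; rewrite !gt_eqF.
Qed.

(** The product of cosines splits into the frequencies of [x - y] and [x + y]; the latter gives the
    kernel at the reflected point. *)
Let integral_E_cos_cos b x y : 0 < b ->
  (\int[L]_xi (E b xi * cos (2 * pi * dotV x xi) * cos (2 * pi * dotV y xi)))%R =
  2^-1 * (gk b x y + gk b x (oppV y)).
Proof.
move=> b0; have ee : (1 : R) ^+ 2 = 1 by rewrite expr1n.
have iEc e : L.-integrable setT (EFin \o (fun xi => E b xi * cos (dotV xi (linV e x y)))).
  apply: (integrable_realM measurableT (iE b0) (measurable_cos_dotV1 _) (C := 1)) => xi _.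
  exact: cos_max.
rewrite {1}/gk -(integral_E_cos x y b0 e1).
rewrite /gk sqdist_oppV opprK -(integral_E_cos x y b0 ee).
rewrite -(RintegralD measurableT (iEc (-1)) (iEc 1)).
rewrite -(RintegralZl _ measurableT (integrable_realD measurableT (iEc (-1)) (iEc 1))).
apply: eq_Rintegral => xi _; rewrite !dotV_linV mulN1r mul1r cosB cosD.
by move: (cos _) (cos _) (sin _) (sin _) (E b xi) => c c' s s' X; field.
Qed.

(** Fubini moves the frequency integral inside, where it is the mean of the kernels at [y] and at
    [oppV y]; evenness of [p] merges the two. *)
Lemma fourier_gauss_transform b x : 0 < b ->
  (\int[L]_xi (f xi * E b xi * cos (2 * pi * dotV x xi)))%R = u b x.
Proof.
move=> b0.
pose F (q : V * V) : R := E b q.1 * cos (2 * pi * dotV x q.1) * (p q.2 * cos (2 * pi * dotV q.2 q.1)).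
have mF : measurable_fun [set: V * V] F.
  apply: measurable_funM; last exact: measurable_pcos.
  apply: measurable_funM; first exact: (measurableT_comp (measurable_E b) measurable_fst).
  exact: (measurableT_comp (measurable_cos2 x) measurable_fst).
have bd xi y : `|F (xi, y)| <= E b xi * p y.
  by rewrite /F/= normrM ler_pM// normrM (ger0_norm (E_ge0 b xi)) ler_piMr// cos_max.
have FE := Rintegral_fubini mF (iE b0) ip (E_ge0 b) p0 bd.
transitivity (\int[L]_xi \int[L]_y F (xi, y))%R.
  apply: eq_Rintegral => xi _.
  rewrite /F/= (RintegralZl _ measurableT (ipcos xi)) -/(f xi).
  by move: (f xi) (E b xi) (cos _) => A B C; ring.
rewrite FE.
transitivity (\int[L]_y (2^-1 * (p y * gk b x y + p y * gk b x (oppV y))))%R.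
  apply: eq_Rintegral => y _; rewrite -mulrDr mulrCA -(integral_E_cos_cos x y b0).
  have i : L.-integrable setT
      (EFin \o (fun xi => E b xi * cos (2 * pi * dotV x xi) * cos (2 * pi * dotV y xi))).
    apply: (integrable_realM measurableT _ (measurable_cos2 y) (C := 1)) => [|xi _]; last exact: cos_max.
    by apply: (integrable_realM measurableT (iE b0) (measurable_cos2 x) (C := 1)) => xi _; exact: cos_max.
  rewrite -(RintegralZl _ measurableT i); apply: eq_Rintegral => xi _.
  by rewrite /F/=; move: (E b xi) (cos _) (cos _) (p y) => A B C D; ring.
have i1 := integrable_mul_gk x b0 ip.
have mo : measurable_fun [set: V] (fun y => p y * gk b x (oppV y)).
  by apply: measurable_funM; [exact: mp|exact: (measurableT_comp (measurable_gk1 b x) (@measurable_oppV R n.+1))].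
have Eo : (\int[L]_y (p y * gk b x (oppV y))%:E = \int[L]_y (p y * gk b x y)%:E)%E.
  rewrite -(@integral_oppV R n.+1 (fun y => (p y * gk b x y)%:E)); last first.
    by apply/measurable_EFinP; apply: measurable_funM => //; exact: measurable_gk1.
  by apply: eq_integral => y _; rewrite peven.
have i2 : L.-integrable setT (EFin \o (fun y => p y * gk b x (oppV y))).
  apply: (integrable_realM measurableT ip _ (C := gauss_kernel n b 0)) => [|y _]; last exact: gk_le.
  exact: (measurableT_comp (measurable_gk1 b x) (@measurable_oppV R n.+1)).
rewrite (RintegralZl _ measurableT (integrable_realD measurableT i1 i2)) (RintegralD measurableT i1 i2).
have -> : (\int[L]_y (p y * gk b x (oppV y)))%R = u b x by rewrite /Rintegral Eo.
rewrite -/(u b x); move: (u b x) => U; by field.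
Qed.

(** A Gaussian-regularized Parseval identity: one factor [f] is unfolded and
    [fourier_gauss_transform] evaluates the inner integral. Together with [pairing_mollifier_le] it
    bounds the left-hand side by [S] uniformly in [b]. *)
Lemma integral_sqr_transform_gauss b : 0 < b ->
  (\int[L]_xi (f xi ^+ 2 * E b xi))%R = (\int[L]_y (u b y * p y))%R.
Proof.
move=> b0; have mf := measurable_cosine_transform.
pose F (q : V * V) : R := f q.1 * E b q.1 * (p q.2 * cos (2 * pi * dotV q.2 q.1)).
have mF : measurable_fun [set: V * V] F.
  apply: measurable_funM; last exact: measurable_pcos.
  apply: measurable_funM; first exact: (measurableT_comp mf measurable_fst).
  exact: (measurableT_comp (measurable_E b) measurable_fst).
have iME := integrable_realZ measurableT M (iE b0).
have ME0 xi : 0 <= M * E b xi by rewrite mulr_ge0.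
have bd xi y : `|F (xi, y)| <= M * E b xi * p y.
  by rewrite /F/= normrM ler_pM// normrM (ger0_norm (E_ge0 b xi)) ler_wpM2r.
have FE := Rintegral_fubini mF iME ip ME0 p0 bd.
transitivity (\int[L]_xi \int[L]_y F (xi, y))%R.
  apply: eq_Rintegral => xi _.
  rewrite /F/= (RintegralZl _ measurableT (ipcos xi)) -/(f xi).
  by move: (f xi) (E b xi) => A B; ring.
rewrite FE; apply: eq_Rintegral => y _; rewrite -(fourier_gauss_transform y b0) mulrC.
have i : L.-integrable setT (EFin \o (fun xi => f xi * E b xi * cos (2 * pi * dotV y xi))).
  apply: (integrable_realM measurableT _ (measurable_cos2 y) (C := 1)) => [|xi _]; last exact: cos_max.
  rewrite (_ : (fun xi => f xi * E b xi) = fun xi => E b xi * f xi); last first.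
    by apply/funext => xi; rewrite mulrC.
  exact: (integrable_realM measurableT (iE b0) mf (C := M) (fun xi _ => f_le xi)).
rewrite -(RintegralZl _ measurableT i); apply: eq_Rintegral => xi _.
by rewrite /F/=; move: (E b xi) (cos _) (f xi) (p y) => A B C D; ring.
Qed.

Let mf2E b : measurable_fun [set: V] (fun xi => f xi ^+ 2 * E b xi).
Proof. by apply: measurable_funM => //; apply: measurable_funX; exact: measurable_cosine_transform. Qed.

Let mf2 : measurable_fun [set: V] (fun xi => f xi ^+ 2).
Proof. by apply: measurable_funX; exact: measurable_cosine_transform. Qed.

Let if2E b : 0 < b -> L.-integrable setT (EFin \o (fun xi => f xi ^+ 2 * E b xi)).
Proof.
move=> b0; rewrite (_ : (fun xi => _) = fun xi => E b xi * f xi ^+ 2); last first.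
  by apply/funext => xi; rewrite mulrC.
apply: (integrable_realM measurableT (iE b0) mf2 (C := M ^+ 2)) => xi _.
by rewrite normrX lerXn2r ?nnegrE.
Qed.

Let E_cvg xi : (fun j => E (b_ j) xi) @ \oo --> (1 : R).
Proof.
have pn : pi != 0 :> R by rewrite gt_eqF// pi_gt0.
have Ej j : E (b_ j) xi = expR (- ((harmonic j : R) ^+ 2 * dotV xi xi)).
  have hb : pi / b_ j = harmonic j by rewrite /b_ invfM mulrCA divff// mulr1.
  by rewrite /E hb.
rewrite (_ : (fun j => _) = fun j => expR (- ((harmonic j : R) ^+ 2 * dotV xi xi))); last first.
  by apply/funext => j; exact: Ej.
pose q (j : nat) : R := - (harmonic j * harmonic j * dotV xi xi).
have hq : q @ \oo --> (- (0 * 0 * dotV xi xi) : R).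
  apply: cvgN; apply: cvgM; last exact: cvg_cst.
  by apply: cvgM; exact: cvg_harmonic.
have := cvg_comp q (@expR R) hq (@continuous_expR R _).
by rewrite !mul0r oppr0 expR0.
Qed.

Let E_le1 b xi : E b xi <= 1.
Proof. by rewrite -expR0 ler_expR oppr_le0 mulr_ge0 ?sqr_ge0 ?dotV_ge0. Qed.

(** [E (b_ j)] increases to 1 with [j], so monotone convergence carries the uniform bound [S] over
    to [f^2]. *)
Lemma integrable_sqr_transform : L.-integrable setT (EFin \o (fun xi => f xi ^+ 2)).
Proof.
apply/integrableP; split; first by apply/measurable_EFinP; exact: mf2.
under eq_integral do rewrite /= ger0_norm ?sqr_ge0//.
pose g j xi := (f xi ^+ 2 * E (b_ j) xi)%:E.
have mg j : measurable_fun setT (g j) by apply/measurable_EFinP; exact: mf2E.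
have g0 j xi : [set: V] xi -> (0 <= g j xi)%E by move=> _; rewrite lee_fin mulr_ge0 ?sqr_ge0.
have ndg xi : [set: V] xi -> nondecreasing_seq (g ^~ xi).
  move=> _ i j ij; rewrite lee_fin ler_wpM2l ?sqr_ge0// ler_expR lerN2 ler_wpM2r ?dotV_ge0//.
  rewrite lerXn2r ?nnegrE ?divr_ge0 ?pi_ge0 ?(ltW (b_gt0 _))//.
  rewrite ler_wpM2l ?pi_ge0// lef_pV2 ?posrE//.
  by rewrite ler_wpM2r ?pi_ge0// ler_nat ltnS.
have cg xi : g j xi @[j --> \oo] --> (f xi ^+ 2)%:E.
  apply: cvg_EFin; first exact: nearW.
  have := cvgM (cvg_cst (f xi ^+ 2)) (E_cvg xi); rewrite mulr1; exact.
have -> : (\int[L]_xi (f xi ^+ 2)%:E = \int[L]_xi limn (g ^~ xi))%E.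
  by apply: eq_integral => xi _; apply/esym/cvg_lim => //; exact: cg.
have h := @cvg_monotone_convergence _ _ _ L _ measurableT _ mg g0 ndg.
have le j : (\int[L]_xi g j xi <= S%:E)%E.
  have -> : (\int[L]_xi g j xi = ((\int[L]_xi (f xi ^+ 2 * E (b_ j) xi))%R)%:E)%E.
    by rewrite fineK//; exact: (integrable_fin_num measurableT (if2E (b_gt0 j))).
  rewrite lee_fin integral_sqr_transform_gauss//; exact: pairing_mollifier_le.
apply: (@le_lt_trans _ _ S%:E); last exact: ltry.
rewrite -(cvg_lim (@ereal_hausdorff R) h).
by apply: lime_le; [exact: (cvgP _ h)|exact: nearW].
Qed.

(** Dominated convergence with majorant [f^2], as [0 <= E <= 1]. *)
Lemma transform_gauss_cvgL2 :
  (fun j => (\int[L]_xi ((f xi * E (b_ j) xi - f xi) ^+ 2))%R) @ \oo --> (0 : R).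
Proof.
have if2 := integrable_sqr_transform.
pose g j xi : \bar R := ((f xi * E (b_ j) xi - f xi) ^+ 2)%:E.
have [] := @dominated_convergence _ _ _ L setT measurableT g (cst 0%E) (EFin \o (fun xi => f xi ^+ 2)).
- move=> j; apply/measurable_EFinP; apply: measurable_funX; apply: measurable_funB.
    by apply: measurable_funM => //; exact: measurable_cosine_transform.
  exact: measurable_cosine_transform.
- exact: measurable_cst.
- apply: aeW => xi _; apply: cvg_EFin; first exact: nearW.
  have h : (fun j => f xi * E (b_ j) xi - f xi) @ \oo --> f xi * 1 - f xi.
    by apply: cvgB; [apply: cvgM; [exact: cvg_cst|exact: E_cvg]|exact: cvg_cst].
  have h0 : (0 : R) = (f xi * 1 - f xi) * (f xi * 1 - f xi) by rewrite mulr1 subrr mul0r.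
  rewrite [X in _ --> X]h0 (_ : fine \o _ = fun j => (f xi * E (b_ j) xi - f xi) * (f xi * E (b_ j) xi - f xi)).
    by apply: cvgM; exact: h.
  by apply/funext => j; rewrite /= expr2.
- exact: if2.
- apply: aeW => xi j _; rewrite /g /= lee_fin ger0_norm ?sqr_ge0//.
  rewrite -[X in _ - X]mulr1 -mulrBr exprMn ler_piMr ?sqr_ge0//.
  rewrite -[leLHS]real_normK ?num_real// exprn_ile1// ler_norml.
  have := E_le1 (b_ j) xi; have := E_ge0 (b_ j) xi; move: (E _ _) => X; lra.
move=> _ _; rewrite integral0; exact: fine_cvg.
Qed.

Let f_oppV xi : f (oppV xi) = f xi.
Proof. by apply: eq_Rintegral => y _; rewrite dotV_oppVr mulrN cosN. Qed.

(** The approximating sequence is [f * E (b_ j)]: the Gaussian makes the bounded [f] integrable, and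
    the Fourier transform of the product is the mollification of [p]. Evenness of [p] absorbs the
    reflection in [is_inv_fourierL2]. *)
Theorem inversion : is_inv_fourierL2 (fun xi => (f xi)%:C%C) (fun x => (p x)%:C%C).
Proof.
have mf := measurable_cosine_transform; have if2 := integrable_sqr_transform.
pose h j xi := f xi * E (b_ j) xi.
have ih j : L.-integrable setT (EFin \o h j).
  rewrite (_ : h j = fun xi => E (b_ j) xi * f xi); last first.
    by apply/funext => xi; rewrite /h mulrC.
  exact: (integrable_realM measurableT (iE (b_gt0 j)) mf (C := M) (fun xi _ => f_le xi)).
have mh j : measurable_fun [set: V] (h j) by apply: measurable_funM.
have ih2 j : L.-integrable setT (EFin \o (fun xi => h j xi ^+ 2)).
  apply: (le_integrable measurableT _ _ if2).
    by apply/measurable_EFinP; apply: measurable_funX; exact: mh.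
  move=> xi _; rewrite /= lee_fin !ger0_norm ?sqr_ge0// /h exprMn ler_piMr ?sqr_ge0//.
  by rewrite exprn_ile1// E_le1.
have hf2 j : L.-integrable setT (EFin \o (fun xi => (h j xi - f xi) ^+ 2)).
  apply: (le_integrable measurableT _ _ if2).
    apply/measurable_EFinP; apply: measurable_funX; apply: measurable_funB; [exact: mh|exact: mf].
  move=> xi _; rewrite /= lee_fin !ger0_norm ?sqr_ge0//.
  rewrite /h -[X in _ - X]mulr1 -mulrBr exprMn ler_piMr ?sqr_ge0//.
  rewrite -[leLHS]real_normK ?num_real// exprn_ile1// ler_norml.
  have := E_le1 (b_ j) xi; have := E_ge0 (b_ j) xi; move: (E _ _) => X; lra.
have up2 j : L.-integrable setT (EFin \o (fun x => (u (b_ j) x - p x) ^+ 2)).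
  have i := integrable_realZ measurableT 2 (integrable_realD measurableT (iu2 (b_gt0 j)) ip2).
  apply: (le_integrable measurableT _ _ i).
    apply/measurable_EFinP; apply: measurable_funX; apply: measurable_funB; last exact: mp.
    exact: measurable_u.
  move=> x _; have A0 : 0 <= 2 * (u (b_ j) x ^+ 2 + p x ^+ 2).
    by rewrite mulr_ge0// addr_ge0// sqr_ge0.
  rewrite /= lee_fin (ger0_norm A0) (ger0_norm (sqr_ge0 _)); move: (u _ x) (p x) => a c; rewrite -subr_ge0 (_ : _ - _ = (a + c) ^+ 2) ?sqr_ge0//; ring.
split.
- exact: cLp2_real.
- rewrite (_ : (fun xi => _) = (fun x => (p x)%:C%C)); first exact: cLp2_real.
  by apply/funext => xi; rewrite peven.
- exists (fun j xi => (h j xi)%:C%C); split.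
  + by move=> j; split; [exact: cLp1_real|exact: cLp2_real].
  + rewrite (_ : (fun j => _) = fun j => cLnorm 2%:E (fun xi => (h j xi - f xi)%:C%C)); last first.
      by apply/funext => j; congr cLnorm; apply/funext => xi; rewrite rmorphB.
    by apply: cLnorm2_real_cvg0 => //; exact: transform_gauss_cvgL2.
  + rewrite (_ : (fun j => _) = fun j => cLnorm 2%:E (fun x => (u (b_ j) x - p x)%:C%C)); last first.
      apply/funext => j; congr cLnorm; apply/funext => x.
      rewrite fourier_real_even//; last by move=> xi; rewrite /h f_oppV /E dotV_oppVl dotV_oppVr opprK.
      by rewrite /h fourier_gauss_transform// peven rmorphB.
    by apply: cLnorm2_real_cvg0 => //; exact: mollifier_cvgL2.
Qed.

End inversion.

(** * Square integrability and continuity of phi off the sphere *)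

Section cauchy_schwarz.
Context {R : realType} (n : nat).
Implicit Types x y : Rn R n.

(** The squared norm of [x + l y] is a nonnegative quadratic in [l], evaluated at its minimum. *)
Lemma dotV_cauchy_schwarz x y : dotV x y <= normV x * normV y.
Proof.
have Q (l : R) : 0 <= dotV x x + 2 * l * dotV x y + l ^+ 2 * dotV y y.
  have -> : dotV x x + 2 * l * dotV x y + l ^+ 2 * dotV y y =
      \sum_(i < n) ((tnth x i : R) + l * (tnth y i : R)) ^+ 2.
    rewrite /dotV !mulr_sumr -!big_split/=; apply: eq_bigr => i _.
    have aux (a b : R) : a * a + 2 * l * (a * b) + l ^+ 2 * (b * b) = (a + l * b) ^+ 2 by ring.
    exact: aux.
  by apply: sumr_ge0 => i _; exact: sqr_ge0.
rewrite -sqrtrM ?dotV_ge0//; have := dotV_ge0 y; have := dotV_ge0 x.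
move: (dotV x x) (dotV y y) (dotV x y) Q => A B c Q A0 B0.
have [c0|c0] := leP c 0; first by rewrite (le_trans c0)// sqrtr_ge0.
have cn : c != 0 by rewrite gt_eqF.
(* If [y] has norm 0 the quadratic is affine in [l], and a positive slope would let it take the
   value -1. *)
have [B1|B1] := eqVneq B 0.
  have := Q (- (A + 1) / (2 * c)).
  rewrite B1 mulr0 addr0 (_ : _ + _ = - 1); last by field; rewrite cn.
  by rewrite lerNr oppr0 ler10.
have := Q (- c / B).
rewrite (_ : _ + _ = (A * B - c ^+ 2) / B); last by field; rewrite B1.
rewrite pmulr_lge0 ?invr_gt0 ?lt_neqAle 1?eq_sym ?B1// subr_ge0 => h.
by rewrite -[leLHS](ger0_norm (ltW c0)) -sqrtr_sqr ler_wsqrtr.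
Qed.

(** The reverse triangle inequality, squared; it reduces continuity of a radial function to
    continuity in the radius. *)
Lemma normV_sqdist x y : (normV y - normV x) ^+ 2 <= sqdist (-1) x y.
Proof.
rewrite /sqdist -!normV_sqr; have := dotV_cauchy_schwarz x y.
by move: (normV x) (normV y) (dotV x y) => a b c h; lra.
Qed.

End cauchy_schwarz.

(** * Continuity and growth of the average for arguments below 1 *)

Section sphere_avg_bounds.
Context {R : realType} (n : nat).
Local Notation mu := (@lebesgue_measure R).
Local Notation J := (`]0%R, ((pi : R) / 2)%R[%classic : set R).
Local Notation mR := (measurableTypeR R).
Let mJ : measurable (J : set mR). Proof. exact: measurable_itv. Qed.
Let Joo : (mu (J : set mR) < +oo)%E. Proof. by rewrite [X in (X < _)%E]lebesgue_J ltry. Qed.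
Let sqr_sin_le1 (x : R) : sin x ^+ 2 <= 1.
Proof. by rewrite -(cos2Dsin2 x) lerDr sqr_ge0. Qed.

Let integrand z (x : R) := sin x ^+ n.+1 * hp 0 (1 - z * sin x ^+ 2).

Let m_integrand z : measurable_fun J (integrand z).
Proof.
apply: measurable_funTS.
exact: (measurableT_comp (measurable_sphere_avg_integrand n) (measurable_pair1 z)).
Qed.

Let sin_norm_le1 (x : R) : `|sin x ^+ n.+1| <= 1.
Proof. by rewrite normrX exprn_ile1// sin_max. Qed.

Let base_ge (m z x : R) : m <= 1 -> z <= 1 - m -> m <= 1 - z * sin x ^+ 2.
Proof.
move=> m1 zm; have := sqr_sin_le1 x; have := sqr_ge0 (sin x).
by move: (sin x ^+ 2) => s s0 s1; nra.
Qed.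

Lemma hp0_le (m a : R) : 0 < m -> m <= a -> hp 0 a <= (Num.sqrt m)^-1.
Proof.
move=> m0 ma; have a0 := lt_le_trans m0 ma.
by rewrite hp0E// lef_pV2 ?posrE ?sqrtr_gt0// ler_wsqrtr.
Qed.

(** With square roots [u] and [v], the difference is [(v^2 - u^2) / (u v (u + v))], whose
    denominator is at least [(sqrt m)^3]. *)
Lemma hp0_lipschitz (m a b : R) : 0 < m -> m <= a -> m <= b ->
  `|hp 0 a - hp 0 b| <= `|a - b| / (m * Num.sqrt m).
Proof.
move=> m0 ma mb; have a0 := lt_le_trans m0 ma; have b0 := lt_le_trans m0 mb.
rewrite !hp0E//.
have [sm0 sma smb] : [/\ 0 < Num.sqrt m, Num.sqrt m <= Num.sqrt a & Num.sqrt m <= Num.sqrt b].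
  by rewrite sqrtr_gt0 !ler_wsqrtr.
have Ea := sqr_sqrtr (ltW a0); have Eb := sqr_sqrtr (ltW b0); have Em := sqr_sqrtr (ltW m0).
move: Ea Eb Em sm0 sma smb; move: (Num.sqrt m) (Num.sqrt a) (Num.sqrt b) => s u v <- <- <- s0 su sv.
have u0 := lt_le_trans s0 su; have v0 := lt_le_trans s0 sv.
have -> : u^-1 - v^-1 = - (u ^+ 2 - v ^+ 2) / (u * v * (u + v)).
  by field; rewrite (gt_eqF u0) (gt_eqF v0) (gt_eqF (addr_gt0 u0 v0)).
have P0 : 0 < u * v * (u + v) by rewrite !mulr_gt0// addr_gt0.
rewrite normrM normrN normfV (gtr0_norm P0) ler_wpM2l// lef_pV2 ?posrE ?mulr_gt0 ?addr_gt0//.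
rewrite expr2 ler_pM ?mulr_ge0 ?(ltW s0)//; first by rewrite ler_pM// ltW.
by rewrite ler_wpDl// ltW.
Qed.

Lemma integrable_sphere_avg (z : R) : z < 1 -> mu.-integrable J (EFin \o integrand z).
Proof.
move=> z1; pose m := Num.min (1 - z) 1.
have m0 : 0 < m by rewrite lt_min subr_gt0 z1/=.
have [m1 zm] : m <= 1 /\ z <= 1 - m.
  by rewrite /m; split; [rewrite ge_min lexx orbT|case: (leP (1 - z) 1) => ?; lra].
apply: (integrable_bounded mJ Joo (m_integrand z) (C := (Num.sqrt m)^-1)) => x Jx.
rewrite normrM -[leRHS]mul1r ler_pM// ger0_norm ?hp_ge0// hp0_le// base_ge//.
Qed.

Lemma sphere_avg_lipschitz (m z z' : R) : 0 < m <= 1 -> z <= 1 - m -> z' <= 1 - m ->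
  `|fine (sphere_avg n z) - fine (sphere_avg n z')| <= pi / 2 * (`|z - z'| / (m * Num.sqrt m)).
Proof.
move=> /andP[m0 m1] zm zm'.
have i : mu.-integrable J (EFin \o integrand z) by apply: integrable_sphere_avg; lra.
have i' : mu.-integrable J (EFin \o integrand z') by apply: integrable_sphere_avg; lra.
rewrite -/(Rintegral _ _ (integrand z)) -/(Rintegral _ _ (integrand z')) -(RintegralB mJ i i').
have P0 : 0 < m * Num.sqrt m by rewrite mulr_gt0// sqrtr_gt0.
have mi : measurable_fun J (fun x => integrand z x - integrand z' x).
  by apply: measurable_funB; exact: m_integrand.
have bd (x : mR) : J x -> `|integrand z x - integrand z' x| <= `|z - z'| / (m * Num.sqrt m).
  move=> Jx; rewrite -mulrBr normrM.
  rewrite (@le_trans _ _ `|hp 0 (1 - z * sin x ^+ 2) - hp 0 (1 - z' * sin x ^+ 2)|)//.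
    by rewrite ler_piMl.
  rewrite (le_trans (hp0_lipschitz m0 (base_ge x m1 zm) (base_ge x m1 zm')))//.
  rewrite ler_wpM2r ?invr_ge0 ?(ltW P0)//.
  rewrite (_ : _ - _ = - (z - z') * sin x ^+ 2); last by ring.
  by rewrite normrM normrN ler_piMr// ger0_norm ?sqr_ge0.
have := normr_Rintegral_le_cst mJ Joo mi bd.
by rewrite [X in _ * fine X](_ : _ = (pi / 2)%:E) 1?[_ * (pi / 2)]mulrC//; exact: lebesgue_J.
Qed.

Lemma continuous_sphere_avg (z : R) : z < 1 -> {for z, continuous (fun y : R => fine (sphere_avg n y))}.
Proof.
move=> z1; pose m := Num.min ((1 - z) / 2) 1.
have m0 : 0 < m by rewrite /m lt_min ltr01 andbT divr_gt0// subr_gt0.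
have [m1 zm] : m <= 1 /\ z + m <= 1 - m.
  by rewrite /m; split; [rewrite ge_min lexx orbT|case: (leP ((1 - z) / 2) 1) => ?; lra].
pose K := pi / 2 * (m * Num.sqrt m)^-1.
have K0 : 0 < K by rewrite !mulr_gt0 ?pi_gt0 ?invr_gt0 ?mulr_gt0 ?sqrtr_gt0.
apply/cvgrPdist_le => e e0; near=> y.
have yz : `|z - y| < Num.min m (e / K).
  near: y; apply: cvgr_dist_lt => //; by rewrite lt_min m0 divr_gt0.
move: yz; rewrite lt_min => /andP[yz yz']; move: (yz); rewrite ltr_norml => /andP[l1 l2].
have zm1 : z <= 1 - m by lra.
have ym : y <= 1 - m by lra.
have m01 : 0 < m <= 1 by rewrite m0.
apply: (le_trans (sphere_avg_lipschitz m01 zm1 ym)).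
by rewrite mulrCA -/K -ler_pdivlMr// ltW.
Unshelve. all: by end_near. Qed.

(** Cauchy-Schwarz for the mean of [(1 - z sin^2)^(-1/2)], whose square has a known integral. The
    actual singularity at [z = 1] is logarithmic, but a bound of the square by [(1 - z)^(-1/2)] is
    integrable across the sphere, which suffices for square integrability. *)
Lemma sphere_avg_sqr_le (z : R) : 0 <= z < 1 ->
  fine (sphere_avg n z) ^+ 2 <= (pi / 2) ^+ 2 * hp 0 (1 - z).
Proof.
move=> z01; have /andP[z0 z1] := z01; have z2 : 0 < 1 - z by rewrite subr_gt0.
have p2 : 0 < pi / 2 :> R by rewrite divr_gt0 ?pi_gt0.
(* [k = (1 - z)^(1/4)] balances the two terms of the AM-GM bound: each integrates to half of
   [(pi / 2) / k]. *)
rewrite hp0E//; set k := Num.sqrt (Num.sqrt (1 - z)).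
have k0 : 0 < k by rewrite !sqrtr_gt0.
have k2 : Num.sqrt (1 - z) = k ^+ 2 by rewrite sqr_sqrtr// sqrtr_ge0.
have i := integrable_sphere_avg z1.
have A0 : 0 <= fine (sphere_avg n z).
  by rewrite fine_ge0//; apply: integral_ge0 => x Jx; rewrite lee_fin sphere_avg_integrand_ge0.
suff le : fine (sphere_avg n z) <= pi / 2 / k.
  rewrite k2 -exprVn -exprMn ler_pXn2r// nnegrE// ltW// divr_gt0//.
have Iq := integral_oneB_sqr_sin z01.
have q0 x : 0 < 1 - z * sin x ^+ 2.
  by rewrite (lt_le_trans z2)// base_ge//; lra.
have mq : measurable_fun J (fun x : R => (1 - z * sin x ^+ 2)^-1).
  apply: measurable_funTS; apply: (measurableT_comp (@measurable_invr R)).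
  apply: measurable_funB => //; apply: measurable_funM => //; apply: measurable_funX.
  exact: continuous_measurable_fun (@continuous_sin R).
have iq : mu.-integrable J (EFin \o (fun x : R => (1 - z * sin x ^+ 2)^-1)).
  apply/integrableP; split; first exact/measurable_EFinP.
  under eq_integral do rewrite /= ger0_norm ?invr_ge0 ?(ltW (q0 _))//.
  by rewrite Iq ltry.
have i1 : mu.-integrable J (EFin \o (fun _ : R => k^-1)).
  by apply: (integrable_bounded mJ Joo _ (C := `|k^-1|)); [exact: measurable_cst|].
have iB := integrable_realZ mJ (k / 2) iq.
have iC := integrable_realZ mJ (1 / 2) i1.
have -> : pi / 2 / k = (\int[mu]_(x in J) (k / 2 * (1 - z * sin x ^+ 2)^-1 + 1 / 2 * k^-1))%R.
  rewrite (RintegralD mJ iB iC) (RintegralZl _ mJ iq) (RintegralZl _ mJ i1).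
  rewrite (Rintegral_cst _ mJ) [X in fine X](_ : _ = (pi / 2)%:E); last exact: lebesgue_J.
  rewrite {1}/Rintegral Iq /= k2; move: (pi : R) k k0 {p2 k2 i1 iB iC} => q k k0.
  by field; rewrite gt_eqF.
rewrite -/(Rintegral _ _ (integrand z)).
apply: le_Rintegral => //; first exact: (integrable_realD mJ iB iC).
move=> x Jx; rewrite (@le_trans _ _ (hp 0 (1 - z * sin x ^+ 2)))//.
  rewrite ler_piMl ?hp_ge0// (le_trans (ler_norm _))//.
rewrite hp0E//; have := sqr_sqrtr (ltW (q0 x)); have : 0 < Num.sqrt (1 - z * sin x ^+ 2) by rewrite sqrtr_gt0.
move: (Num.sqrt (1 - z * _)) => s s0 <-; rewrite -subr_ge0.
(* AM-GM: [2 / s <= k / s^2 + 1 / k] *)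
have -> : k / 2 * (s ^+ 2)^-1 + 1 / 2 * k^-1 - s^-1 = (k - s) ^+ 2 / (2 * k * s ^+ 2).
  by field; rewrite !gt_eqF.
by rewrite divr_ge0 ?sqr_ge0// mulr_ge0 ?sqr_ge0// mulr_ge0// ltW.
Qed.

End sphere_avg_bounds.

Section phi_square_integrable.
Context {R : realType} (n : nat) (t : R) (t0 : 0 < t).
Local Notation mu := (@lebesgue_measure R).
Local Notation L := (lebesgue_Rn R n.+1).
Local Notation phit := (@phi R n.+1 t).
Let A (z : R) : R := fine (sphere_avg n z).
Let c : R := 2 / pi / (wprod 0 n.+1 * t ^+ n.+1).
Let c_gt0 : 0 < c.
Proof. by rewrite /c !divr_gt0 ?pi_gt0// mulr_gt0 ?wprod_gt0// exprn_gt0. Qed.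

Let sphere_avgE (z : R) : z < 1 -> sphere_avg n z = (A z)%:E.
Proof.
move=> z1; rewrite /A fineK//; apply: integrable_fin_num; first exact: measurable_itv.
exact: (integrable_sphere_avg n z1).
Qed.

Lemma phi_inside (x : Rn R n.+1) : normV x < t -> phit x = c * A (normV x ^+ 2 / t ^+ 2).
Proof.
move=> xt; apply: EFin_inj; rewrite (phi_sphere_avg t0) ?lt_eqF// [in RHS]EFinM -sphere_avgE//.
by rewrite ltr_pdivrMr ?exprn_gt0// mul1r ltrXn2r// ?nnegrE ?normV_ge0 ?ltW.
Qed.

Lemma phi_outside (x : Rn R n.+1) : t < normV x ->
  phit x = c * ((t / normV x) ^+ n.+2 * A ((t / normV x) ^+ 2)).
Proof.
move=> xt; have x0 := lt_trans t0 xt; have q0 : 0 < t / normV x by rewrite divr_gt0.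
apply: EFin_inj; rewrite (phi_sphere_avg t0) ?gt_eqF//.
rewrite (_ : normV x ^+ 2 / t ^+ 2 = ((t / normV x) ^+ 2)^-1); last by rewrite expr_div_n invf_div.
rewrite sphere_avgV// sphere_avgE -?EFinM//.
by rewrite expr_lt1 ?(ltW q0)// ltr_pdivrMr// mul1r.
Qed.

(** On either side of the sphere [phi] is a function of the radius built from [sphere_avg] at an
    argument below 1, where [continuous_sphere_avg] applies; outside this is due to the inversion
    [sphere_avgV]. *)
Lemma phi_continuous (x : Rn R n.+1) (e : R) : normV x != t -> 0 < e ->
  exists2 dl : R, 0 < dl & forall y, sqdist (-1) x y < dl -> `|phit y - phit x| <= e.
Proof.
move=> xt e0; have x0 := normV_ge0 x.
suff [dl dl0 h] : exists2 dl : R, 0 < dl & forall y, `|normV x - normV y| < dl -> `|phit x - phit y| <= e.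
  exists (dl ^+ 2) => [|y xy]; first exact: exprn_gt0.
  rewrite distrC h// -ltr_sqr ?nnegrE ?(ltW dl0)// real_normK ?num_real// -sqrrN opprB.
  exact: le_lt_trans (normV_sqdist x y) xy.
have cpow (f : R -> R) (s : R) m : {for s, continuous f} -> {for s, continuous (fun y => f y ^+ m)}.
  by move=> cf; apply: (@continuous_comp _ _ _ f (fun y => y ^+ m)) => //; exact: exprn_continuous.
have main (g : R -> R) (P : R -> Prop) : (\forall s \near normV x, P s) ->
    (forall y, P (normV y) -> phit y = g (normV y)) -> {for normV x, continuous g} ->
    exists2 dl : R, 0 < dl & forall y, `|normV x - normV y| < dl -> `|phit x - phit y| <= e.
  move=> Px Pg cg.
  have cge := proj1 (@cvgrPdist_le _ _ _ _ _ g (g (normV x))) cg e e0.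
  have [dl dl0 h] := proj1 (@nbhs_ballP _ _ _ _) (filterI Px (cge _)).
  exists dl => // y xy; have [Py gy] := h _ xy.
  by rewrite (Pg _ Py) (Pg _ (nbhs_singleton Px)).
have [xlt|xgt] : normV x < t \/ t < normV x by move: xt; rewrite neq_lt => /orP.
- apply: (main (fun s => c * A (s ^+ 2 / t ^+ 2)) (fun s => s < t)).
  + exact: lt_nbhsl.
  + exact: phi_inside.
  + apply: cvgM; first exact: cvg_cst.
    apply: (@continuous_comp _ _ _ (fun s : R => s ^+ 2 / t ^+ 2) A).
      by apply: cvgM; [exact: exprn_continuous|exact: cvg_cst].
    apply: continuous_sphere_avg.
    by rewrite ltr_pdivrMr ?exprn_gt0// mul1r ltrXn2r// ?nnegrE ?normV_ge0 ?ltW.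
- have xp := lt_trans t0 xgt.
  have cq : {for normV x, continuous (fun s : R => t / s)}.
    by apply: cvgM; [exact: cvg_cst|apply: cvgV => //; rewrite gt_eqF].
  apply: (main (fun s => c * ((t / s) ^+ n.+2 * A ((t / s) ^+ 2))) (fun s => t < s)).
  + exact: lt_nbhsr.
  + exact: phi_outside.
  + apply: cvgM; first exact: cvg_cst.
    apply: cvgM; first exact: (cpow _ _ _ cq).
    apply: (@continuous_comp _ _ _ (fun s : R => (t / s) ^+ 2) A); first exact: (cpow _ _ _ cq).
    apply: continuous_sphere_avg.
    by rewrite expr_lt1 ?divr_ge0 ?(ltW t0) ?(ltW xp)// ltr_pdivrMr// mul1r.
Qed.

(** As a function of the radius this is [(s - t)^(-1/2)] on the shell [t < s < 2 t], the majorant of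
    the square of [phi] just outside the sphere. *)
Let ring_hp (s : R) : R := if s < 2 * t then hp 0 (s - t) else 0.

Let ring_hp_ge0 s : 0 <= ring_hp s.
Proof. by rewrite /ring_hp; case: ifPn => // _; exact: hp_ge0. Qed.

Let measurable_ring_hp : measurable_fun [set: R] ring_hp.
Proof.
apply: measurable_fun_ifT => //; first exact: measurable_fun_ltr.
by apply: (measurableT_comp (measurable_hp 0)); exact: measurable_funB.
Qed.

(** In polar coordinates [s^n] is at most [(2 t)^n] on the shell, and [s = t + x^2] turns
    [(s - t)^(-1/2) ds] into [2 dx]. *)
Let integrable_ring_hp : L.-integrable setT (EFin \o (fun x => ring_hp (normV x))).
Proof.
have mK : measurable_fun [set: R] (fun s => (ring_hp s)%:E) by exact/measurable_EFinP.
have K0 s : (0 <= (ring_hp s)%:E)%E by rewrite lee_fin.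
apply/integrableP; split.
  exact: (measurableT_comp mK (@measurable_normV R n.+1)).
under eq_integral do rewrite /= ger0_norm//.
rewrite (ge0_integral_polar n mK K0).
pose C : R := n.+1%:R * wprod 1 n.+1 * (2 * t) ^+ n.
have w0 : 0 < wprod 1 n.+1 :> R by exact: wprod_gt0.
have C0 : 0 <= C by rewrite !mulr_ge0 ?exprn_ge0 ?(ltW w0)// mulr_ge0 ?ltW.
have t2 : 0 <= 2 * t by rewrite mulr_ge0 ?ltW.
apply: (@le_lt_trans _ _ (\int[mu]_s ((ring_hp s)%:E * C%:E))%E).
  rewrite [leLHS]integral_mkcond; apply: ge0_le_integral => //.
  - by move=> s _; apply: erestrict_ge0 => {}s /=; rewrite in_itv/= andbT => s0;
      rewrite mule_ge0// lee_fin !mulr_ge0 ?exprn_ge0 ?(ltW s0) ?(ltW w0).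
  - apply/(measurable_restrictT _ _).1 => //; apply: measurable_funTS.
    apply: emeasurable_funM => //; apply/measurable_EFinP; apply: measurable_funM => //.
  - by apply: emeasurable_funM.
  - move=> s _; rewrite patchE; case: ifPn => [|_]; last by rewrite mule_ge0.
    rewrite inE/= in_itv/= andbT -!EFinM lee_fin /ring_hp => s0; case: ifPn => [s2|_].
      rewrite ler_wpM2l ?hp_ge0// /C ler_wpM2l ?mulr_ge0 ?(ltW w0)//.
      by rewrite lerXn2r ?nnegrE// ltW.
    by rewrite !mul0r.
rewrite ge0_integralZr//.
have tt : t <= 2 * t by rewrite ler_peMl ?(ltW t0)// ler1n.
have -> : (\int[mu]_s (ring_hp s)%:E = \int[mu]_(s in `]t, (2 * t)%R[) (ring_hp s)%:E)%E.
  rewrite [RHS]integral_mkcond; apply: eq_integral => s _.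
  rewrite patchE mem_setE in_itv/= /ring_hp /hp subr_gt0.
  by case: (t < s) => /=; case: (s < 2 * t).
have s0 : 0 < Num.sqrt t by rewrite sqrtr_gt0.
have dF (x : R) : is_derive x (1 : R) (fun x : R => t + x ^+ 2) (2 * x).
  have d2 : is_derive x (1 : R) (fun y : R => y ^+ 2) (2 * x).
    by apply: (@is_derive_pow R id 2 x 1 _ (is_derive_id x 1)); rewrite expr1 mulr1.
  by apply: (is_derive_add (is_derive_const t x) d2); rewrite add0r.
have cF : continuous (fun x : R => 2 * x).
  by apply: continuous_mul; [exact: continuous_const|move=> x].
have := @ge0_integral_substitution R _ _ 0 (Num.sqrt t) _ (ltW s0) dF cF _ _ mK K0.
have -> : t + 0 ^+ 2 = t by rewrite expr0n/= addr0.
have -> : t + Num.sqrt t ^+ 2 = 2 * t by rewrite sqr_sqrtr ?(ltW t0)//; ring.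
move=> <-.
- apply: (@le_lt_trans _ _ (\int[mu]_(x in `]0%R, (Num.sqrt t)%R[) (cst 2%:E x) * C%:E)%E).
    rewrite lee_wpmul2r ?lee_fin//; apply: ge0_le_integral => //.
    + by move=> x /=; rewrite in_itv/= => /andP[x0 _]; rewrite mule_ge0// lee_fin mulr_ge0// ltW.
    + apply: emeasurable_funM.
        apply: measurable_funTS; apply: (measurableT_comp mK).
        by apply: measurable_funD => //; exact: measurable_funX.
      by apply/measurable_EFinP; exact: measurable_funM.
    + move=> x /=; rewrite in_itv/= => /andP[x0 _]; rewrite -EFinM lee_fin /ring_hp.
      case: ifPn => _; last by rewrite mul0r.
      rewrite (_ : t + x ^+ 2 - t = x ^+ 2); last by ring.
      rewrite hp0E ?exprn_gt0// sqrtr_sqr gtr0_norm// mulrCA mulVf ?mulr1// gt_eqF//.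
  rewrite integral_cst//= lebesgue_measure_itv/= lte_fin s0 -!EFinM ltry//.
- by move=> x /andP[x0 _]; rewrite mulr_ge0// ltW.
- move=> x y; rewrite !in_itv/= => /andP[x0 _] /andP[y0 _].
  by rewrite ltrD2l ltr_sqr.
Qed.

Let integrable_hp0_Rn : L.-integrable setT (EFin \o (fun x => hp 0 (t ^+ 2 - dotV x x))).
Proof.
apply/integrableP; split; first exact: measurable_hp_Rn.
under eq_integral do rewrite /= ger0_norm ?hp_ge0//.
by rewrite integral_hp_Rn ltry.
Qed.

(** Three integrable majorants are added: a multiple of [(t^2 - |x|^2)_+^(-1/2)] inside, one of
    [ring_hp] on the shell, and one of [phi] itself beyond radius [2 t], where [phi] is bounded. *)
Lemma integrable_phi_sqr : L.-integrable setT (EFin \o (fun x => phit x ^+ 2)).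
Proof.
pose k : R := c ^+ 2 * (pi / 2) ^+ 2.
have k0 : 0 <= k by rewrite mulr_ge0 ?sqr_ge0.
(* Beyond [2 t], [1 - (t / |x|)^2] is at least [1/4], so [phi^2 <= B] with [B = k (1/4)^(-1/2)].
   Then [phi^2 <= (1 + B) phi], whether [phi] is at most 1 or larger. *)
pose k3 : R := 1 + k * (Num.sqrt (1 / 4))^-1.
have k30 : 0 <= k3 by rewrite addr_ge0// mulr_ge0 ?invr_ge0 ?sqrtr_ge0.
(* On the shell, [1 - (t / |x|)^2 >= (|x| - t) / (2 t)], because [|x|^2 <= 2 t (|x| + t)] there. *)
pose k2 : R := k * hp 0 (2 * t)^-1.
have k20 : 0 <= k2 by rewrite mulr_ge0 ?hp_ge0.
(* Inside, [1 - |x|^2 / t^2 = t^-2 (t^2 - |x|^2)], and the power -1/2 of [t^-2] is [t]. *)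
pose k1 : R := k * t.
have k10 : 0 <= k1 by rewrite mulr_ge0 ?(ltW t0).
have i1 := integrable_realZ measurableT k1 integrable_hp0_Rn.
have i2 := integrable_realZ measurableT k2 integrable_ring_hp.
have i3 := integrable_realZ measurableT k3 (integrable_phi n t0).
have i12 := integrable_realD measurableT i1 i2.
have i := integrable_realD measurableT i12 i3.
apply: (le_integrable measurableT _ _ i).
  by apply/measurable_EFinP; apply: measurable_funX; exact: measurable_phi.
move=> x _; rewrite /= lee_fin (ger0_norm (sqr_ge0 _)).
have h1 : 0 <= k1 * hp 0 (t ^+ 2 - dotV x x) by rewrite mulr_ge0 ?hp_ge0.
have h2 : 0 <= k2 * ring_hp (normV x) by rewrite mulr_ge0.
have h3 : 0 <= k3 * phit x by rewrite mulr_ge0// phi_ge0.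
rewrite (ger0_norm (addr_ge0 (addr_ge0 h1 h2) h3)).
have outer : t < normV x -> phit x ^+ 2 <= k * hp 0 (1 - (t / normV x) ^+ 2).
  move=> xt; have x0 := lt_trans t0 xt; have q0 : 0 < t / normV x by rewrite divr_gt0.
  have q1 : t / normV x < 1 by rewrite ltr_pdivrMr// mul1r.
  rewrite (phi_outside xt) exprMn [X in _ * X <= _]exprMn /k -mulrA ler_wpM2l ?sqr_ge0//.
  rewrite -[leRHS]mul1r ler_pM ?sqr_ge0//.
    by rewrite exprn_ile1 ?sqr_ge0 ?exprn_ge0 ?exprn_ile1// ltW.
  by apply: sphere_avg_sqr_le; rewrite sqr_ge0/= expr_lt1 ?(ltW q0).
have [xt|tx|xt] := ltgtP (normV x) t.
- have z1 : normV x ^+ 2 / t ^+ 2 < 1.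
    by rewrite ltr_pdivrMr ?exprn_gt0// mul1r ltrXn2r// ?nnegrE ?normV_ge0 ?ltW.
  apply: (@le_trans _ _ (k1 * hp 0 (t ^+ 2 - dotV x x))); last first.
    by rewrite -addrA lerDl addr_ge0.
  rewrite (phi_inside xt) exprMn /k1 /k -[_ * t]mulrA -mulrA -[_ * hp 0 _]mulrA ler_wpM2l ?sqr_ge0//.
  have z0 : 0 <= normV x ^+ 2 / t ^+ 2 by rewrite divr_ge0 ?sqr_ge0.
  have := @sphere_avg_sqr_le R n (normV x ^+ 2 / t ^+ 2); rewrite z0 z1 => /(_ isT) h.
  rewrite (le_trans h)// ler_wpM2l ?sqr_ge0// le_eqVlt; apply/orP; left; apply/eqP.
  have tn : t != 0 by rewrite gt_eqF.
  rewrite -normV_sqr (_ : 1 - _ = (t ^+ 2)^-1 * (t ^+ 2 - normV x ^+ 2)); last by field.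
  rewrite hpM ?invr_gt0 ?exprn_gt0// hp0E ?invr_gt0 ?exprn_gt0//.
  by rewrite sqrtrV ?sqr_ge0// invrK sqrtr_sqr gtr0_norm.
- have h := outer tx; have x0 := lt_trans t0 tx.
  have xn : normV x != 0 by rewrite gt_eqF.
  have [x2|x2] := ltP (normV x) (2 * t).
    apply: (@le_trans _ _ (k2 * ring_hp (normV x))); last by rewrite [X in X + _]addrC -addrA lerDl addr_ge0.
    apply: (le_trans h); rewrite /ring_hp x2 /k2 -mulrA ler_wpM2l// -hpM ?invr_gt0 ?mulr_gt0//.
    have m0 : 0 < (2 * t)^-1 * (normV x - t) by rewrite mulr_gt0 ?invr_gt0 ?mulr_gt0 ?subr_gt0.
    rewrite [leRHS]hp0E// hp0_le//.
    rewrite (_ : 1 - _ = (normV x + t) / normV x ^+ 2 * (normV x - t)); last by field.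
    rewrite ler_wpM2r ?subr_ge0 ?(ltW tx)// ler_pdivlMr ?exprn_gt0// mulrC ler_pdivrMr ?mulr_gt0//.
    move: (normV x) x0 x2 => s s0 s2; nra.
  apply: (@le_trans _ _ (k3 * phit x)); last by rewrite lerDr addr_ge0.
  have hB : phit x ^+ 2 <= k * (Num.sqrt (1 / 4))^-1.
    apply: (le_trans h); rewrite ler_wpM2l// hp0_le ?divr_gt0//.
    have q2 : t / normV x <= 1 / 2 by rewrite ler_pdivrMr//; lra.
    have q0 : 0 <= t / normV x by rewrite divr_ge0// ltW.
    by move: (t / normV x) q0 q2 => q q0 q2; nra.
  rewrite /k3; move: (phit x) (phi_ge0 t0 x) (k * _) hB => p p0 B hB.
  have B0 : 0 <= B by rewrite (le_trans _ hB)// sqr_ge0.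
  have [p1|p1] := leP p 1; nra.
- have -> : phit x ^+ 2 = 0 by rewrite phi_normV// xt eqxx expr0n.
  exact: addr_ge0 (addr_ge0 h1 h2) h3.
Qed.

End phi_square_integrable.

Theorem theorem2 (R : realType) (d : nat) (d1 : (1 <= d)%N) (t : R) (t0 : 0 < t) :
  is_inv_fourierL2
    (fun xi : Rn R d => (m_mult d (t * normV xi))%:C%C)
    (fun x : Rn R d => (phi t x)%:C%C)
  /\ Lnorm (lebesgue_Rn R d) 1%:E (fun x => (phi t x)%:E) = 1%E.
Proof.
case: d d1 => // n _; split.
  (* By [m_multE] and [fourier_phi], [m (t |xi|)] and the cosine transform of [phi t] are both
     [sphere_multiplier] at [2 pi t |xi|]. *)
  rewrite (_ : (fun xi : Rn R n.+1 => _) = fun xi => (cosine_transform (phi t) xi)%:C%C); last first.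
    apply/funext => xi; rewrite m_multE ?mulr_ge0 ?normV_ge0 ?(ltW t0)//.
    by rewrite /cosine_transform fourier_phi.
  apply: inversion.
  - exact: phi_ge0.
  - exact: measurable_phi.
  - exact: integrable_phi.
  - exact: integrable_phi_sqr.
  - exact: phi_oppV.
  - by apply: filterS (@ae_normV_neq R n t) => x xt e e0; exact: phi_continuous.
rewrite Lnorm1 -(integral_phi n t0); apply: eq_integral => x _.
by rewrite /= ger0_norm ?phi_ge0.
Qed.
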